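(* There are constants $c, d_0>0$ for which the following holds. For all integers $d\ge d_0$, all even integers $L\ge 4$ and all real $\lambda$ with $$\lambda \ge c\,d^{-1/4}\log^{3/4} d,$$ the Glauber dynamics chain $\mathcal{M}_\lambda$ on $\mathcal{I}(T_{L,d})$ satisfies $$\tau_{\mathcal{M}_\lambda(T_{L,d})}\ \ge\ \exp\left\{\frac{L^{d-1}}{d^4\log^2 L}\right\}.$$
   Context: For $L$ even, $T_{L,d}$ (the even discrete torus) is the graph on vertex set $\{0,\dots,L-1\}^d$ in which two vertices are adjacent if they differ on exactly one coordinate and differ by $1 \pmod L$ on that coordinate. For a finite simple graph $\Sigma=(V,E)$, $\mathcal{I}(\Sigma)$ is the set of independent sets of $\Sigma$ (sets of vertices spanning no edges). For $\lambda>0$ the hard-core measure $\pi_\lambda$ on $\mathcal{I}(\Sigma)$ is given by $\pi_\lambda(\{I\})=\lambda^{|I|}/Z_\lambda(\Sigma)$, where $Z_\lambda(\Sigma)=\sum_{I\in\mathcal{I}(\Sigma)}\lambda^{|I|}$. Glauber dynamics $\mathcal{M}_\lambda=\mathcal{M}_\lambda(\Sigma)$ is the Markov chain on state space $\mathcal{I}(\Sigma)$ with transition probabilities $P_\lambda(I,J)=0$ if $|I\triangle J|>1$; $P_\lambda(I,J)=\frac{1}{|V|}\frac{\lambda}{1+\lambda}$ if $|I\triangle J|=1$ and $I\subseteq J$; $P_\lambda(I,J)=\frac{1}{|V|}\frac{1}{1+\lambda}$ if $|I\triangle J|=1$ and $J\subseteq I$; $P_\lambda(I,I)=1-\sum_{J'\ne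 I}P_\lambda(I,J')$. It is ergodic with unique stationary distribution $\pi_\lambda$. The mixing time is $$\tau_{\mathcal{M}_\lambda(\Sigma)}=\max_{I\in\mathcal{I}(\Sigma)}\min\left\{t_0:\ \tfrac12\sum_{J\in\mathcal{I}(\Sigma)}|P^t(I,J)-\pi_\lambda(J)|\le \tfrac1e\ \ \forall t>t_0\right\},$$ where $P^t(I,\cdot)$ is the distribution of the chain at time $t$ when started at $I$. Here $\log$ is the natural logarithm. *)

(* Defs.v *)
From mathcomp Require Import all_boot all_order all_algebra.
From mathcomp Require Import classical_sets reals constructive_ereal ereal.
From mathcomp Require Import sequences exp.

Set Implicit Arguments.
Unset Strict Implicit.
Unset Printing Implicit Defensive.

Import Order.TTheory GRing.Theory Num.Theory.
Local Open Scope ring_scope.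

Definition indep (T : finType) (e : rel T) (A : {set T}) : bool :=
  [forall x in A, forall y in A, ~~ e x y].

Notation indepset e := {A : {set _} | indep e A}.

Section HardCore.
Context {T : finType} (e : rel T).
Local Notation indset := (indepset e).

Definition symdiff (A B : {set T}) : {set T} := (A :\: B) :|: (B :\: A).

Context {R : realType} (lambda : R).

Definition partition_function : R := \sum_(I : indset) lambda ^+ #|val I|.

Definition hardcore (I : indset) : R := lambda ^+ #|val I| / partition_function.

(* Transition probabilities between distinct states; the value is 0 when
   I = J. *)
Definition glauber_move (I J : indset) : R :=
  if #|symdiff (val I) (val J)| == 1%N then
    if val I \subset val J then #|T|%:R^-1 * (lambda / (1 + lambda))
    else #|T|%:R^-1 * (1 / (1 + lambda))
  else 0.

Definition glauber (I J : indset) : R :=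
  if I == J then 1 - \sum_(K : indset | K != I) glauber_move I K
  else glauber_move I J.

Fixpoint glauber_iter (t : nat) (I J : indset) : R :=
  if t is t'.+1 then \sum_(K : indset) glauber_iter t' I K * glauber K J
  else (I == J)%:R.

Definition tv_dist (t : nat) (I : indset) : R :=
  2^-1 * \sum_(J : indset) `|glauber_iter t I J - hardcore J|.

(* Infimum in the extended reals of a set of natural numbers: it is the
   minimum when the set is nonempty (as it is for an ergodic chain), and +oo
   otherwise. *)
Definition mixing_time_from (I : indset) : \bar R :=
  ereal_inf [set (t0%:R)%:E | t0 in
    [set t0 : nat | forall t : nat, (t0 < t)%N ->
       tv_dist t I <= (expR 1)^-1]]%classic.

Definition mixing_time : \bar R :=
  \big[maxe/-oo%E]_(I : indset) mixing_time_from I.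

End HardCore.

Section Torus.
Context (L d : nat).

Local Notation torus := {ffun 'I_d -> 'I_L}.

Definition torus_adj (u v : torus) : bool :=
  [exists i : 'I_d,
    [&& [forall j : 'I_d, (u j != v j) == (j == i)] &
        ((u i).+1 == v i %[mod L])%N || ((v i).+1 == u i %[mod L])%N]].

Lemma torus_adj_sym : symmetric torus_adj.
Proof.
move=> u v; rewrite /torus_adj; apply: eq_existsb => i.
by rewrite orbC; congr (_ && _); apply: eq_forallb => j; rewrite [u j == _]eq_sym.
Qed.

Lemma torus_adj_irrefl : irreflexive torus_adj.
Proof.
move=> u; apply/negbTE/existsP => -[i /andP[/forallP /(_ i)]].
by rewrite !eqxx.
Qed.

End Torus.

(* Main.v *)
(* The set B of independent sets I with as many even as odd vertices separates
   the chain into two halves exchanged by a translation, so the mixing time is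
   at least of order 1 / pi(B).  To bound pi(B), attach to I the region X made
   of the neighbours of the even part of I and of the even vertices whose whole
   neighbourhood has been reached.  The vertices incident to the edge boundary
   of X fall into clusters.  A cluster with fewer than L^(d-1) vertices bounds a
   small region (mod 2 cohomology of the torus), which can be filled in; this is
   done greedily until the number of possible positions of the clusters is at
   most exponential in a small multiple of the boundary.  The resulting region
   is described by a code: a small set of boundary vertices meeting the
   neighbourhood of every vertex with many boundary edges around it, and a few
   corrections.  There are few codes, and a code determines X up to an error
   that is small on the odd side.  Shifting I by one step inside X vacates
   vertices that can be occupied freely, which gains a factor (1 + lambda)^t,
   with t the boundary size divided by the degree (or a small power of it, when
   the code leaves the region undetermined); summing over codes, this gain wins
   as soon as lambda is at least of order d^(-1/4).  Balanced sets with few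
   vertices are rare for a direct reason: their even part is a small subset of
   the remaining even vertices. *)

Require Import Defs.
From mathcomp Require Import boolp classical_sets reals constructive_ereal ereal.
From mathcomp Require Import sequences exp.
From mathcomp Require Import all_boot all_order all_algebra zify ring lra.

Set Implicit Arguments.
Unset Strict Implicit.
Unset Printing Implicit Defensive.

(** * Cayley graphs with a parity *)

(** The side [L] may be huge compared with [d]. Locating one connected piece of boundary then costs
    a factor up to [L^d], which a short piece cannot repay; this is why clusters have to be erased
    at all. The erasing is constrained in three ways. The final region must be a function of the
    even part of [I] alone, because decoding the shift recovers the even part before anything else.
    It must agree with the original region around the boundary that is left, so that the shift stays
    legal there. And both the region and its complement must keep at least a proportion of order
    [1/d] of the vertices, so that isoperimetry still forces a long boundary. Logarithms of [d] are
    never tracked: [q] is the integer part of [d^(1/48)], and for large [d] the logarithm of the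
    degree is below [q]. All comparisons of gain and cost thus become comparisons of powers of [q],
    with [lambda] at least [2 q^-12]. *)

Lemma leq_sum_card (I : finType) (A : {set I}) (F : I -> nat) c :
  (forall i, i \in A -> c <= F i) -> #|A| * c <= \sum_(i in A) F i.
Proof. by move=> h; rewrite -sum_nat_const; apply: leq_sum. Qed.

Lemma sum_card_fiber (I J : finType) (P : I -> J -> bool) :
  \sum_(i : I) #|[set j | P i j]| = #|[set p : I * J | P p.1 p.2]|.
Proof.
rewrite (eq_bigr (fun i => \sum_(j | P i j) 1)).
  by rewrite pair_big_dep sum1dep_card.
by move=> i _; rewrite sum1dep_card.
Qed.

(** Commuting steps are the geometric input: an edge and a further direction span a four-cycle.
    Regions, codes and shifts are handled with this and the bipartition alone; isoperimetry and the
    existence of fillings enter as section hypotheses and are proved on the torus. *)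
Record cayley := Cayley {
  vert : finType;
  dir : finType;
  st : vert -> dir -> vert;
  op : dir -> dir;
  par : pred vert;
  stI : forall x, injective (st x);
  stK : forall x a, st (st x a) (op a) = x;
  opK : involutive op;
  stC : forall x a b, st (st x a) b = st (st x b) a;
  parS : forall x a, par (st x a) = ~~ par x }.

Section Cayley.
Variable G : cayley.
Local Notation T := (vert G).
Local Notation Dir := (dir G).
Local Notation D := #|Dir|.

Lemma stKV (x : T) a : st (st x (op a)) a = x.
Proof. by rewrite -{2}[a]opK stK. Qed.

Lemma st_inj (a : Dir) : injective (fun x : T => st x a).
Proof. exact: (@can_inj _ _ _ (fun x : T => st x (op a)) (fun x => stK x a)). Qed.

Lemma op_bij : bijective (@op G). Proof. by exists (@op G); apply: opK. Qed.

Lemma reindex_op (F : Dir -> nat) : \sum_a F (op a) = \sum_a F a.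
Proof. by rewrite [RHS](reindex (@op G)) //; apply: onW_bij; apply: op_bij. Qed.

Lemma sum_st a (F : T -> nat) : \sum_x F (st x a) = \sum_x F x.
Proof.
rewrite [RHS](reindex (fun x : T => st x a)) //; apply: onW_bij.
by exists (fun x : T => st x (op a)) => x; [apply: stK | apply: stKV].
Qed.

Definition bdeg (X : {set T}) y := #|[set a | (y \in X) != (st y a \in X)]|.
Definition din (X : {set T}) y := #|[set a | st y a \in X]|.
(** Edges are oriented outwards, so [gam] counts every boundary edge once, whereas the sum of [bdeg]
    over all vertices counts it twice. *)
Definition bdry (X : {set T}) : {set T * Dir} :=
  [set p | (p.1 \in X) && (st p.1 p.2 \notin X)].
Definition gam X := #|bdry X|.
Definition Bd (X : {set T}) := [set y | 0 < bdeg X y].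
Definition nbs (X : {set T}) := [set x | [exists a, st x a \in X]].

Lemma din_leq X y : din X y <= D.
Proof. exact: max_card. Qed.
Lemma bdeg_leq X y : bdeg X y <= D.
Proof. exact: max_card. Qed.

Lemma din_subset (X Y : {set T}) y : X \subset Y -> din X y <= din Y y.
Proof.
move=> sXY; apply: subset_leq_card; apply/subsetP => a.
by rewrite !inE; apply: (subsetP sXY).
Qed.

Lemma din_compl (X : {set T}) y : din (~: X) y + din X y = D.
Proof.
rewrite addnC -(cardsC [set a | st y a \in X]); congr (_ + _).
by apply: eq_card => a; rewrite !inE.
Qed.

Lemma din_in (X : {set T}) y : y \in X -> din X y + bdeg X y = D.
Proof.
move=> yX; rewrite -(cardsC [set a | st y a \in X]); congr (_ + _).
by apply: eq_card => a; rewrite !inE yX; case: (_ \in X).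
Qed.

Lemma din_out (X : {set T}) y : y \notin X -> din X y = bdeg X y.
Proof.
by move=> /negbTE yX; apply: eq_card => a; rewrite !inE yX; case: (_ \in X).
Qed.

Lemma sum_din (X Y : {set T}) :
  \sum_(x in X) din Y x = \sum_(y in Y) din X y.
Proof.
have E (A B : {set T}) :
    \sum_(x in A) din B x = \sum_x \sum_a ((x \in A) && (st x a \in B)).
  rewrite big_mkcond; apply: eq_bigr => x _; case: (x \in A) => /=.
    by rewrite /din -sum1dep_card big_mkcond.
  by rewrite big1.
rewrite !E exchange_big [RHS]exchange_big /= -[RHS]reindex_op.
apply: eq_bigr => a _; rewrite -[RHS](sum_st a).
by apply: eq_bigr => x _; rewrite stK andbC.
Qed.

Lemma gamE X : gam X = \sum_(x in X) bdeg X x.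
Proof.
rewrite /gam -(sum_card_fiber (fun x a => (x \in X) && (st x a \notin X))).
rewrite [RHS]big_mkcond; apply: eq_bigr => x _; rewrite /bdeg.
case: (x \in X) => /=; last by apply: eq_card0 => a; rewrite !inE.
by apply: eq_card => a; rewrite !inE; case: (_ \in X).
Qed.

Lemma gam_din X : gam X = \sum_(x in X) din (~: X) x.
Proof.
rewrite gamE; apply: eq_bigr => x xX.
by have := din_in xX; have := din_compl X x; lia.
Qed.

Lemma gam_out X : gam X = \sum_(x in ~: X) bdeg X x.
Proof.
rewrite gam_din sum_din; apply: eq_bigr => x; rewrite inE => xX.
by rewrite din_out.
Qed.

Lemma sum_bdeg X : \sum_x bdeg X x = (gam X).*2.
Proof.
rewrite (bigID (mem X)) /= -gamE -addnn; congr (_ + _).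
by rewrite gam_out; apply: eq_bigl => x; rewrite inE.
Qed.

Lemma gam_card X : gam X + \sum_(x in X) din X x = #|X| * D.
Proof.
rewrite gamE -big_split /= -sum_nat_const; apply: eq_bigr => x xX.
by rewrite addnC din_in.
Qed.

Lemma mem_Bd (X : {set T}) x a : (x \in X) != (st x a \in X) -> x \in Bd X.
Proof.
by move=> h; rewrite inE card_gt0; apply/set0Pn; exists a; rewrite inE.
Qed.

Lemma BdP (X : {set T}) x : reflect (exists a, (x \in X) != (st x a \in X)) (x \in Bd X).
Proof.
apply: (iffP idP) => [|[a]]; last exact: mem_Bd.
by rewrite inE card_gt0 => /set0Pn[a]; rewrite inE; exists a.
Qed.

Lemma mem_Bd_st (X : {set T}) x a : (x \in X) != (st x a \in X) -> st x a \in Bd X.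
Proof. by move=> h; apply: (@mem_Bd _ _ (op a)); rewrite stK eq_sym. Qed.

(** * Balls in the graph distance *)

Fixpoint near_rec (r : nat) (x y : T) : bool :=
  if r is r'.+1 then near_rec r' x y || [exists a, near_rec r' x (st y a)]
  else x == y.
Fact near_key : unit. Proof. exact: tt. Qed.
(* There is a path of length at most [r] between [x] and [y]; locked because
   unification would otherwise unfold the recursion for numeral radii. *)
Definition near := locked_with near_key near_rec.

Lemma near0E x y : near 0 x y = (x == y).
Proof. by rewrite /near unlock. Qed.

Lemma nearSE r x y : near r.+1 x y = near r x y || [exists a, near r x (st y a)].
Proof. by rewrite /near unlock. Qed.

Lemma near_refl r x : near r x x.
Proof. by elim: r => [|r IH]; rewrite ?near0E ?nearSE ?eqxx ?IH. Qed.

Lemma nearS r x y : near r x y -> near r.+1 x y.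
Proof. by rewrite nearSE => ->. Qed.

Lemma near_st r x y a : near r x (st y a) -> near r.+1 x y.
Proof. by move=> h; rewrite nearSE; apply/orP; right; apply/existsP; exists a. Qed.

Lemma near_st' r x y a : near r x y -> near r.+1 x (st y a).
Proof. by move=> h; apply: (@near_st _ _ _ (op a)); rewrite stK. Qed.

Lemma near_mono r s x y : r <= s -> near r x y -> near s x y.
Proof.
by move=> /subnKC <-; elim: (s - r) => [|k IH] h; rewrite ?addn0 // addnS nearS ?IH.
Qed.

Lemma near1 (x : T) a : near 1 x (st x a).
Proof. by apply: near_st'; rewrite near_refl. Qed.

Lemma near_trans r s x y z : near r x y -> near s y z -> near (r + s) x z.
Proof.
move=> hxy; elim: s z => [|s IH] z; first by rewrite near0E addn0 => /eqP <-.
rewrite nearSE addnS => /orP[/IH/nearS//|/existsP[a /IH h]].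
exact: near_st h.
Qed.

Lemma near_sym r (x y : T) : near r x y = near r y x.
Proof.
suff h s (u v : T) : near s u v -> near s v u by apply/idP/idP; apply: h.
elim: s v => [|s IH] v; first by rewrite !near0E eq_sym.
rewrite nearSE => /orP[/IH/nearS//|/existsP[a /IH h]].
apply: (@near_trans 1 s _ (st v a)) => //; exact: near1.
Qed.

Lemma card_near r x : #|[set y | near r x y]| <= D.+1 ^ r.
Proof.
elim: r => [|r IH].
  by rewrite expn0 (_ : [set y | _] = [set x]) ?cards1 //; apply/setP=> y; rewrite !inE near0E eq_sym.
have sub : [set y | near r.+1 x y] \subset
    [set y | near r x y] :|: [set st p.1 p.2 | p in setX [set y | near r x y] setT].
  apply/subsetP => y; rewrite in_setU !in_set nearSE => /orP[->//|/existsP[a h]].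
  apply/orP; right; apply/imsetP; exists (st y a, op a); first by rewrite in_setX !in_set h.
  by rewrite stK.
apply: (leq_trans (subset_leq_card sub)); apply: (leq_trans (leq_card_setU _ _)).
have := leq_imset_card (fun p => st p.1 p.2) (setX [set y | near r x y] [set: Dir]).
rewrite cardsX cardsT expnS => h.
have := leq_mul2l D #|[set y | near r x y]| (D.+1 ^ r).
rewrite IH orbT => h2; rewrite mulSn; apply: leq_add IH _.
by apply: (leq_trans h); rewrite mulnC.
Qed.

(** All boundary edges lead from an odd vertex inside to an even vertex outside, and no odd vertex
    inside or even vertex outside is isolated on its side. The clauses are local, so they survive
    the erasing of clusters ([agrees_closed]). *)
Definition closed (X : {set T}) : bool :=
  [forall x, if par x then (x \in X) ==> [exists a, st x a \in X]
     else if x \in X then [forall a, st x a \in X] else [exists a, st x a \notin X]].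

Definition odds (X : {set T}) := [set x in X | par x].
Definition evens (X : {set T}) := [set x in X | ~~ par x].

Section Closed.
Variable X : {set T}.
Hypothesis clX : closed X.

Lemma cl_even (x : T) a : ~~ par x -> x \in X -> st x a \in X.
Proof.
by move=> /negbTE px xX; have /forallP/(_ x) := clX; rewrite px xX => /forallP.
Qed.

Lemma cl_odd (x : T) : par x -> x \in X -> exists a, st x a \in X.
Proof.
by move=> px xX; have /forallP/(_ x) := clX; rewrite px xX => /existsP.
Qed.

Lemma cl_even_out (x : T) : ~~ par x -> x \notin X -> exists a, st x a \notin X.
Proof.
by move=> /negbTE px /negbTE xX; have /forallP/(_ x) := clX; rewrite px xX => /existsP.
Qed.

Lemma cl_odd_out (x : T) a : par x -> x \notin X -> st x a \notin X.
Proof.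
move=> px xX; apply: contra xX => h.
by rewrite -(stK x a); apply: cl_even; rewrite ?parS ?px.
Qed.

Lemma bdry_par (x : T) a : x \in X -> st x a \notin X -> par x.
Proof. by move=> xX; apply: contraR => px; apply: cl_even. Qed.

(* For every direction [b], one of the two edges leaving [x] and [st x c]
   along [b] crosses the boundary. *)
Lemma cross (x : T) c : (x \in X) != (st x c \in X) ->
  D <= bdeg X x + bdeg X (st x c).
Proof.
suff h (y : T) b : y \in X -> st y b \notin X -> D <= bdeg X y + bdeg X (st y b).
  case xX: (x \in X); case sX: (_ \in X) => // _; first by apply: h; rewrite ?sX.
  by rewrite addnC; have := h (st x c) (op c); rewrite stK; apply; rewrite ?xX.
move=> yX sX; have py := bdry_par yX sX.
rewrite -cardsT -cardsUI; apply: (@leq_trans #|[set: Dir]|) => //.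
apply: leq_trans (leq_addr _ _); apply: subset_leq_card; apply/subsetP => a _.
rewrite !inE yX (negbTE sX) /=.
case h: (st y a \in X) => //=.
by rewrite stC cl_even // parS py.
Qed.

(** All [D] edges at an even vertex of [X] end at odd vertices of [X]; the other edges at odd
    vertices of [X] are the boundary edges. So [gam X / D] is the surplus of odd vertices, which is
    the gain of a shift inside a completely known region. *)
Lemma gam_diff : gam X + #|evens X| * D = #|odds X| * D.
Proof.
have -> : gam X = \sum_(x in odds X) bdeg X x.
  rewrite gamE (bigID (@par G)) /= [X in _ + X]big1 ?addn0.
    by apply: eq_bigl => x; rewrite !inE.
  move=> x /andP[xX px]; apply: eq_card0 => a.
  by rewrite !inE xX cl_even.
rewrite -!sum_nat_const.
have -> : \sum_(x in evens X) D = \sum_(x in evens X) din X x.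
  apply: eq_bigr => x; rewrite inE => /andP[xX px].
  rewrite -[RHS]addn0 -(din_in xX); congr (_ + _).
  by apply: eq_card0 => a; rewrite !inE xX cl_even.
have -> : \sum_(x in evens X) din X x = \sum_(x in odds X) din X x.
  have E : \sum_(x in odds X) din X x = \sum_(x in odds X) din (evens X) x.
    apply: eq_bigr => x; rewrite inE => /andP[_ px].
    by apply: eq_card => a; rewrite !inE parS px andbT.
  rewrite E [RHS]sum_din; apply: eq_bigr => x; rewrite inE => /andP[_ px].
  by apply: eq_card => a; rewrite !inE parS px andbT.
rewrite -big_split /=; apply: eq_bigr => x; rewrite inE => /andP[xX _].
by rewrite addnC din_in.
Qed.

End Closed.

End Cayley.

(** * Vertices surrounded by boundary edges *)

(* Each new element of the cover is chosen so that it covers at least the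
   average fraction [k / m] of what is still uncovered. *)
Lemma greedy_cover (I J : finType) (H : {set I}) (w : J -> nat)
    (r : I -> J -> bool) (k : nat) (m := \sum_y w y) :
  (forall x, x \in H -> k <= \sum_(y | r x y) w y) -> forall n,
  exists Q : {set J}, [/\ #|Q| <= n, forall y, y \in Q -> 0 < w y &
    #|[set x in H | ~~ [exists y in Q, r x y]]| * m ^ n <= #|H| * (m - k) ^ n].
Proof.
move=> hk; elim=> [|n [Q [cQ pQ uQ]]].
  exists set0; split; rewrite ?cards0 // ?expn0 ?muln1; first by move=> y; rewrite inE.
  by apply: subset_leq_card; apply/subsetP => x; rewrite inE => /andP[].
have [m0|m0] := posnP m.
  exists Q; split=> //; first exact: leqW.
  by rewrite m0 exp0n // muln0.
pose W := [set x in H | ~~ [exists y in Q, r x y]].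
pose Wy y := [set x in W | r x y].
have tot : k * #|W| <= \sum_y w y * #|Wy y|.
  have -> : \sum_y w y * #|Wy y| = \sum_(x in W) \sum_(y | r x y) w y.
    rewrite (exchange_big_dep xpredT) //=; apply: eq_bigr => y _.
    by rewrite mulnC -sum_nat_const; apply: eq_bigl => x; rewrite inE.
  rewrite mulnC; apply: leq_sum_card => x; rewrite inE => /andP[xH _].
  exact: hk.
have [y wy hy] : exists2 y, 0 < w y & k * #|W| <= #|Wy y| * m.
  apply/exists_inP; apply: contraT => /exists_inPn h.
  suff : (\sum_y w y * #|Wy y|) * m < m * (k * #|W|).
    by rewrite mulnC ltn_pmul2l // ltnNge tot.
  have em : m = \sum_y w y by [].
  rewrite [X in _ < X * _]em !big_distrl /=.
  have [y0 wy0] : exists y, 0 < w y.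
    apply/existsP; apply: contraLR m0 => /existsPn h0.
    by rewrite -leqNgt leqn0 /m big1 // => y _; apply/eqP; rewrite -leqn0 leqNgt h0.
  rewrite (bigD1 y0) //= [X in _ < X](bigD1 y0) //= -addSn.
  have lt y : 0 < w y -> #|Wy y| * m < k * #|W| by move=> /h; rewrite -ltnNge.
  apply: leq_add; first by rewrite -mulnA ltn_pmul2l // lt.
  apply: leq_sum => y _; rewrite -mulnA.
  by have [->//|wy] := posnP (w y); rewrite leq_pmul2l // ltnW // lt.
exists (y |: Q); split.
- by rewrite cardsU1; case: (_ \notin _) => //=; rewrite ?add1n ?ltnS // add0n leqW.
- by move=> z; rewrite !inE => /orP[/eqP->//|/pQ].
have -> : [set x in H | ~~ [exists z in y |: Q, r x z]] = W :\: Wy y.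
  apply/setP => x; rewrite !inE -!andbA.
  case: (x \in H) => //=; apply/idP/idP.
    move=> /exists_inPn h; apply/andP; split.
      rewrite negb_and; apply/orP; right; apply: h; exact: setU11.
    by apply/exists_inPn => z zQ; apply: h; apply: setU1r.
  move=> /andP[h1 /[dup] h2 /exists_inPn h3]; apply/exists_inPn => z.
  rewrite !inE => /orP[/eqP->|/h3//].
  by move: h1; rewrite h2.
have sW : Wy y \subset W by apply/subsetP => x; rewrite inE => /andP[].
rewrite cardsDS // !expnS.
have h1 : (#|W| - #|Wy y|) * m <= #|W| * (m - k) by rewrite mulnBl mulnBr (mulnC _ k); lia.
rewrite mulnA; apply: leq_trans (leq_mul h1 (leqnn _)) _.
by rewrite mulnAC (mulnC (m - k)) mulnA leq_mul2r uQ orbT.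
Qed.

Section Smoothing.
Variable G : cayley.
Local Notation T := (vert G).
Local Notation Dir := (dir G).
Local Notation D := #|Dir|.

Definition hdeg (X : {set T}) x := \sum_a bdeg X (st x a).
(** Heavy vertices are surrounded by boundary edges. The majority vote [smooth] differs little from
    the region on the odd side and, away from heavy vertices, is locally constant. *)
Definition heavy (X : {set T}) s := [set x | s * D <= hdeg X x].
Definition smooth (X : {set T}) := [set x | D < (din X x).*2].

Lemma hdegE (X : {set T}) x : hdeg X x = \sum_(y | [exists a, st x a == y]) bdeg X y.
Proof.
rewrite /hdeg -(big_imset (bdeg X)) /=; last by move=> a b _ _; apply: stI.
apply: eq_bigl => y; apply/imsetP/existsP => [[a _ ->]|[a /eqP <-]].
  by exists a.
by exists a.
Qed.

Lemma sum_hdeg (X : {set T}) : \sum_x hdeg X x = D * (gam X).*2.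
Proof.
rewrite exchange_big /= -sum_bdeg -sum_nat_const.
by apply: eq_bigr => a _; rewrite (sum_st a (bdeg X)).
Qed.

Lemma odd_nsmooth (X : {set T}) x : x \in odds X :\: smooth X -> D <= (bdeg X x).*2.
Proof.
by rewrite !inE -leqNgt => /and3P[h xX _]; move: (din_in xX); lia.
Qed.

Lemma card_odd_nsmooth (X : {set T}) : #|odds X :\: smooth X| * D <= (gam X).*2.
Proof.
apply: (@leq_trans (\sum_(x in odds X :\: smooth X) (bdeg X x).*2)).
  by apply: leq_sum_card => x; apply: odd_nsmooth.
have sub : odds X :\: smooth X \subset X.
  by apply/subsetP => x; rewrite !inE => /and3P[].
rewrite gamE -muln2 big_distrl /= [X in _ <= X](big_setID (odds X :\: smooth X)) /=.
rewrite (setIidPr sub).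
by apply: leq_trans (leq_addr _ _); apply: leq_sum => x _; rewrite muln2.
Qed.

Section OneSet.
Variable X : {set T}.
Hypothesis clX : closed X.
Variable s : nat.
Hypothesis s6 : 6 * s <= D.
Hypothesis D0 : 0 < D.

Lemma hdeg_lower x : bdeg X x * (D - bdeg X x) <= hdeg X x.
Proof.
rewrite /hdeg (bigID (fun a => (x \in X) != (st x a \in X))) /=.
apply: leq_trans (leq_addr _ _).
rewrite {1}/bdeg -sum1dep_card big_distrl /=; apply: leq_sum => a h.
by rewrite mul1n leq_subLR; apply: cross.
Qed.

(** By [hdeg_lower], the boundary degree [k] of a vertex that is not heavy satisfies
    [k * (D - k) < s * D], which leaves only values close to 0 or to [D]. *)
Lemma din_polarized x : x \notin heavy X s -> din X x < s.*2 \/ D - s.*2 < din X x.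
Proof.
rewrite inE -ltnNge => h.
have := leq_ltn_trans (hdeg_lower x) h.
have kD := bdeg_leq X x; move: (bdeg X x) kD (@din_in _ X x) (@din_out _ X x) => k kD hi ho hk.
have [h1|h1] : k < s.*2 \/ D - k < s.*2 by nia.
  have [xX|xX] := boolP (x \in X); last by left; rewrite ho.
  by right; move: (hi xX) h1; have := din_leq X x; lia.
have [xX|xX] := boolP (x \in X); first by left; move: (hi xX); lia.
by right; rewrite ho //; lia.
Qed.

(** If the vote changed along the edge, polarization would give more than [D - 4 s], hence at least
    [2 s], directions in which the parallel edge crosses the boundary. By [cross] each of them
    contributes [D] to the two values of [hdeg], and one end would be heavy. This is the origin of
    [6 * s <= D]. *)
Lemma smooth_adj x c : x \notin heavy X s -> st x c \notin heavy X s ->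
  (x \in smooth X) = (st x c \in smooth X).
Proof.
suff h (y : T) b : y \notin heavy X s -> st y b \notin heavy X s ->
    y \in smooth X -> st y b \in smooth X.
  move=> h1 h2; apply/idP/idP; first exact: h.
  by move=> h3; rewrite -(stK x c); apply: h => //; rewrite stK.
move=> h1 h2; rewrite !inE => d1; rewrite ltnNge; apply/negP => d2.
have e1 : D - s.*2 < din X y by case: (din_polarized h1); lia.
have e2 : din X (st y b) < s.*2 by case: (din_polarized h2); lia.
pose A := [set a | st y a \in X]; pose B := [set a | st (st y b) a \notin X].
have cB : #|B| + din X (st y b) = D.
  rewrite -(din_compl X (st y b)); congr (_ + _).
  by apply: eq_card => a; rewrite !inE.
have cAB : s.*2 <= #|A :&: B|.
  have uAB : #|A :|: B| <= D by apply: max_card.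
  have iAB : #|A :|: B| + #|A :&: B| = din X y + #|B| by rewrite cardsUI.
  lia.
have : #|A :&: B| * D <= hdeg X y + hdeg X (st y b).
  rewrite /hdeg -big_split /= (bigID (mem (A :&: B))) /=.
  apply: leq_trans (leq_addr _ _); apply: leq_sum_card => a.
  rewrite !inE => /andP[a1 a2]; rewrite [st (st y b) a]stC.
  by apply: cross => //; rewrite a1 stC (negbTE a2).
by move: h1 h2; rewrite !inE -!ltnNge; nia.
Qed.

Lemma smooth_odd (x : T) : par x -> x \in smooth X -> x \in X.
Proof.
move=> px; apply: contraLR => xX; rewrite inE -leqNgt.
suff -> : din X x = 0 by [].
by apply: eq_card0 => a; rewrite inE (negbTE (cl_odd_out _ _ _ _)).
Qed.

Lemma smooth_even (x : T) : ~~ par x -> x \in X -> x \in smooth X.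
Proof.
move=> px xX; rewrite inE.
suff -> : din X x = D by lia.
by rewrite /din -cardsT; apply: eq_card => a; rewrite !inE cl_even.
Qed.

(** Without a heavy vertex nearby the vote is constant around a boundary edge from [v] inside to [u]
    outside. But [v] has an even neighbour in [X], which votes inside, and [u] has an odd neighbour
    outside [X], which cannot; closedness provides both. *)
Lemma near_heavy x : x \in Bd X -> exists2 z, z \in heavy X s & near 2 x z.
Proof.
move=> xB; apply/exists_inP; apply: contraT => /exists_inPn h.
have nh z : near 2 x z -> z \notin heavy X s.
  by move=> nz; apply/negP => /h; rewrite nz.
suff key v b : v \in X -> st v b \notin X -> near 1 x v -> near 1 x (st v b) -> False.
  have [a] := BdP _ _ xB; case xX: (x \in X) => /= h1; exfalso.
    by apply: (key x a); rewrite ?xX ?near_refl ?near1.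
  apply: (key (st x a) (op a)); rewrite ?stK ?xX ?near_refl ?near1 //.
  by move: h1; case: (_ \in X).
move=> vX uX n1 n2; have pv := bdry_par clX vX uX.
have nv := nh _ (nearS n1); have nu := nh _ (nearS n2).
have [vs|vs] := boolP (v \in smooth X).
  have [] := @cl_even_out _ X clX (st v b) _ uX; first by rewrite parS pv.
  move=> c yX; have ny := nh _ (near_st' c n2).
  have := smooth_adj nu ny; rewrite -(smooth_adj nv nu) vs => /esym ys.
  by move: yX; rewrite (smooth_odd _ ys) // !parS pv.
have [c wX] := cl_odd clX pv vX.
have := smooth_adj nv (nh _ (near_st' c n1)).
by rewrite (negbTE vs) smooth_even // parS pv.
Qed.

End OneSet.

Lemma heavy_nbs (X : {set T}) s x : 0 < s * D -> x \in heavy X s ->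
  exists a, st x a \in Bd X.
Proof.
move=> sD; rewrite inE => h; apply/existsP; apply: contraT => /existsPn h1.
move: (leq_trans sD h); rewrite /hdeg big1 // => a _.
by apply/eqP; rewrite -leqn0 leqNgt; have := h1 a; rewrite inE.
Qed.

Lemma heavy_cover (X : {set T}) s n (m := (gam X).*2) : 0 < s * D ->
  exists Q : {set T}, exists w : nat,
    [/\ Q \subset Bd X, heavy X s \subset nbs Q, #|Q| <= n + w &
     w * m ^ n <= #|heavy X s| * (m - s * D) ^ n].
Proof.
move=> sD.
have h x : x \in heavy X s -> s * D <= \sum_(y | [exists a, st x a == y]) bdeg X y.
  by rewrite -hdegE inE.
have [Q [cQ pQ]] := greedy_cover h n; rewrite sum_bdeg -/m.
set W := [set x in _ | _] => uQ.
(* Each heavy vertex missed by the greedy set gets a boundary neighbour of its own, which accounts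
   for the summand [w]. The default [x] never occurs at a heavy vertex. *)
pose f x := if [pick a | st x a \in Bd X] is Some a then st x a else x.
have fW x : x \in heavy X s -> (f x \in Bd X) /\ exists a, st x a = f x.
  move=> hx; rewrite /f; case: pickP => [a ha|h0]; first by split=> //; exists a.
  by have [a] := heavy_nbs sD hx; rewrite h0.
exists (Q :|: f @: W), #|W|; split=> //.
- apply/subsetP => y; rewrite in_setU => /orP[/pQ|/imsetP[x]]; first by rewrite inE.
  by rewrite inE => /andP[/fW[h1 _] _] ->.
- apply/subsetP => x xH; rewrite inE; apply/existsP.
  have [/exists_inP[y yQ /existsP[a /eqP ay]]|xW] := boolP [exists y in Q, [exists a, st x a == y]].
    by exists a; rewrite ay in_setU yQ.
  have [_ [a ea]] := fW _ xH; exists a; rewrite ea in_setU imset_f ?orbT //.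
  by rewrite inE xH.
- apply: leq_trans (leq_card_setU _ _) _; apply: leq_add => //.
  exact: leq_imset_card.
Qed.

Lemma card_heavy (X : {set T}) s : #|heavy X s| * (s * D) <= D * (gam X).*2.
Proof.
rewrite -sum_hdeg (bigID (mem (heavy X s))) /=; apply: leq_trans (leq_addr _ _).
by apply: leq_sum_card => x; rewrite inE.
Qed.

End Smoothing.

(** * Components away from the skeleton *)

Section Components.
Variable G : cayley.
Local Notation T := (vert G).
Local Notation Dir := (dir G).
Local Notation D := #|Dir|.

Definition cadj (P : {set T}) : rel T :=
  [rel x y | [&& x \notin P, y \notin P & [exists a, st x a == y]]].
Definition comps P := equivalence_partition (connect (cadj P)) (~: P).

Lemma cadj_sym P : symmetric (cadj P).
Proof.
suff h x y : cadj P x y -> cadj P y x by move=> x y; apply/idP/idP; apply: h.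
move=> /and3P[xP yP /existsP[a /eqP exy]]; apply/and3P; split=> //.
by apply/existsP; exists (op a); rewrite -exy stK.
Qed.

Lemma comps_partition P : partition (comps P) (~: P).
Proof.
apply: equivalence_partitionP => x y z _ _ _; split; first exact: connect0.
by move=> h; rewrite (same_connect (sym_connect_sym (@cadj_sym P)) h).
Qed.

Lemma compsP (P K : {set T}) : K \in comps P ->
  exists2 x, x \notin P & K = [set y in ~: P | connect (cadj P) x y].
Proof. by move=> /imsetP[x]; rewrite inE => xP ->; exists x. Qed.

Lemma comps_st (P K : {set T}) x a :
  K \in comps P -> x \in K -> st x a \notin K -> st x a \in P.
Proof.
move=> /compsP[z zP ->]; rewrite !inE => /andP[xP cx]; apply: contraR => aP.
rewrite aP; apply: connect_trans cx _; apply: connect1.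
by apply/and3P; split=> //; apply/existsP; exists a.
Qed.

Lemma sum_gam_comps (P : {set T}) : \sum_(K in comps P) gam K <= #|P| * D.
Proof.
have -> : #|P| * D = \sum_x din P x.
  rewrite -sum_nat_const -[RHS](eq_bigl _ _ (in_setT (T:=T))) sum_din.
  apply: eq_bigr => y _; rewrite /din -cardsT.
  by apply: eq_card => a; rewrite !inE.
rewrite (bigID (mem (~: P))) /=; apply: leq_trans (leq_addr _ _).
rewrite (set_partition_big _ (comps_partition P)) /=; apply: leq_sum => K KP.
rewrite gam_din; apply: leq_sum => x xK; apply: subset_leq_card.
by apply/subsetP => a; rewrite !inE; apply: comps_st KP xK.
Qed.

Lemma exit_near (P K : {set T}) r x y :
  (forall z a, z \in K -> st z a \notin K -> st z a \in P) ->
  near r x y -> x \in K -> y \notin K -> exists2 p, p \in P & near r x p.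
Proof.
move=> hK; elim: r y => [|r IH] y; first by rewrite near0E => /eqP -> ->.
rewrite nearSE => /orP[h xK yK|/existsP[a h] xK yK].
  by have [p pP np] := IH _ h xK yK; exists p => //; apply: nearS.
have [aK|aK] := boolP (st y a \in K).
  exists y; last exact: near_st h.
  by rewrite -(stK y a); apply: hK => //; rewrite stK.
by have [p pP np] := IH _ h xK aK; exists p => //; apply: nearS.
Qed.

Variable M : nat.
Hypothesis isoA : forall K : {set T}, #|K| < M -> #|K| * D <= (gam K).*2.
Hypothesis isoB : forall K : {set T}, M <= #|K| -> (#|K|).*2 <= #|T| -> D * D <= gam K.
Hypothesis ballM : forall (K : {set T}) x, x \in K -> #|K| < M ->
  exists2 y, y \notin K & near 4 x y.

Definition large_comps (P : {set T}) := [set K in comps P | M <= #|K|].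

(** Edges leaving components end in [P], so there are at most [#|P| * D] of them. Each large
    component sends out at least [D * D], except possibly one that contains more than half of the
    vertices. Since [P] is the neighbourhood of a skeleton of size [n], only about [n] components
    remain, and choosing a subfamily costs [2 ^ n.+1]. *)
Lemma card_large_comps (P : {set T}) : 0 < D ->
  #|large_comps P| * D <= #|P| + D.
Proof.
move=> D0; pose H := [set K in large_comps P | #|T| < (#|K|).*2].
have H1 : #|H| <= 1.
  rewrite leqNgt; apply/negP => /card_gt1P[A [B [AH BH AB]]].
  move: AH BH; rewrite !inE => /andP[/andP[Ac _] hA] /andP[/andP[Bc _] hB].
  have /and3P[_ /trivIsetP tr _] := comps_partition P.
  have := tr A B Ac Bc AB; rewrite -setI_eq0 => /eqP AB0.
  have := cardsUI A B; have uAB : #|A :|: B| <= #|T| by apply: max_card.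
  by rewrite AB0 cards0; lia.
have : #|large_comps P :\: H| * (D * D) <= #|P| * D.
  apply: leq_trans (sum_gam_comps P).
  rewrite (big_setID (large_comps P :\: H)) /=; apply: leq_trans (leq_addr _ _).
  rewrite (setIidPr _); last by apply/subsetP => K; rewrite !inE => /and3P[].
  apply: leq_sum_card => K; rewrite in_setD => /andP[h KL].
  move: (KL); rewrite in_set => /andP[_ KM]; apply: isoB => //.
  by move: h; rewrite in_set KL -leqNgt.
rewrite mulnA leq_mul2r -[_ == 0]negbK -lt0n D0 /= => h.
have e1 := cardsID H (large_comps P).
have e2 : #|large_comps P :&: H| <= #|H| by apply: subset_leq_card; apply: subsetIr.
have e3 : #|large_comps P| <= #|large_comps P :\: H| + 1 by lia.
by apply: leq_trans (leq_mul e3 (leqnn D)) _; rewrite mulnDl mul1n leq_add2r.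
Qed.

Definition small_part (P : {set T}) := cover [set K in comps P | #|K| < M].

Lemma card_small_part (P : {set T}) : 0 < D -> #|small_part P| <= #|P|.*2.
Proof.
move=> D0; rewrite -(leq_pmul2r D0) -doubleMl.
apply: (@leq_trans (\sum_(K in comps P) (gam K).*2)); last first.
  rewrite (eq_bigr (fun K : {set T} => gam K * 2)); last by move=> K _; rewrite muln2.
  by rewrite -big_distrl /= muln2 leq_double sum_gam_comps.
rewrite [X in _ <= X](big_setID [set K : {set T} | #|K| < M]) /=.
apply: leq_trans (leq_addr _ _).
apply: (@leq_trans (\sum_(K in comps P :&: [set K : {set T} | #|K| < M]) #|K| * D)).
  rewrite -big_distrl leq_mul2r /=; apply/orP; right.
  have -> : small_part P = cover (comps P :&: [set K : {set T} | #|K| < M]).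
    by congr cover; apply/setP => K; rewrite !inE.
  exact: leq_card_cover.
by apply: leq_sum => K; rewrite !inE => /andP[_]; apply: isoA.
Qed.

Lemma small_part_near (P : {set T}) x : x \in small_part P ->
  exists2 p, p \in P & near 4 x p.
Proof.
move=> /bigcupP[K]; rewrite inE => /andP[Kc KM] xK.
have [y yK nxy] := ballM xK KM.
by apply: exit_near nxy xK yK => z a; apply: comps_st.
Qed.

Definition odd_part (B : {set {set T}}) := odds (cover B).
(** Once [P] contains the heavy vertices, [smooth X] is constant on every component, so a single bit
    per component tells on which side it lies. *)
Definition inner_comps (P X : {set T}) := [set K in large_comps P | K \subset smooth X].

Section OneSet.
Variables (X P : {set T}) (s : nat).
Hypothesis clX : closed X.
Hypothesis s6 : 6 * s <= D.
Hypothesis D0 : 0 < D.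
Hypothesis hP : heavy X s \subset P.

Lemma smooth_connect x y : connect (cadj P) x y -> (x \in smooth X) = (y \in smooth X).
Proof.
move=> /connectP[p]; elim: p x => [|z p IH] x /=; first by move=> _ ->.
move=> /andP[/and3P[xP zP /existsP[a /eqP xz]] /IH h] /h <-.
rewrite -xz; apply: (smooth_adj clX s6 D0).
  by apply: contra xP; apply: (subsetP hP).
by rewrite xz; apply: contra zP; apply: (subsetP hP).
Qed.

Lemma odd_part_sub : odd_part (inner_comps P X) \subset odds X.
Proof.
apply/subsetP => x; rewrite !inE => /andP[/bigcupP[K]].
rewrite inE => /andP[_ /subsetP hK] /hK xs px; rewrite px andbT.
exact: smooth_odd xs.
Qed.

Lemma odd_part_rest :
  odds X :\: odd_part (inner_comps P X) \subset
    (odds X :\: smooth X) :|: P :|: small_part P.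
Proof.
apply/subsetP => x; rewrite !in_setU [x \in _ :\: _]in_setD => /andP[h xX].
have [xs|xs] := boolP (x \in smooth X); last by rewrite in_setD xs xX.
have [xP|xP] := boolP (x \in P); first by rewrite orbT.
apply/orP; right; pose K := [set y in ~: P | connect (cadj P) x y].
have xK : x \in K by rewrite !inE xP connect0.
have Kc : K \in comps P by apply/imsetP; exists x; rewrite ?inE.
apply/bigcupP; exists K => //; rewrite inE Kc ltnNge /=.
apply: contra h => KM; move: xX; rewrite !inE => /andP[_ ->]; rewrite andbT.
apply/bigcupP; exists K => //; rewrite !inE Kc KM /=.
by apply/subsetP => y; rewrite inE => /andP[_ /smooth_connect <-].
Qed.

Lemma card_odd_part_rest :
  #|odds X :\: odd_part (inner_comps P X)| * D <= (gam X).*2 + 3 * #|P| * D.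
Proof.
have h1 := card_odd_nsmooth X; have h2 := card_small_part P D0.
have h3 := subset_leq_card odd_part_rest.
have h4 := (leq_card_setU ((odds X :\: smooth X) :|: P) (small_part P)).1.
have h5 := (leq_card_setU (odds X :\: smooth X) P).1.
have h6 : #|odds X :\: odd_part (inner_comps P X)| <= #|odds X :\: smooth X| + 3 * #|P|.
  by move: h2 h3 h4 h5; lia.
by apply: leq_trans (leq_mul h6 (leqnn D)) _; rewrite mulnDl leq_add2r.
Qed.

Lemma odd_part_rest_near x : x \in odds X :\: odd_part (inner_comps P X) ->
  (x \in Bd X) \/ exists2 p, p \in P & near 4 x p.
Proof.
move=> /(subsetP odd_part_rest); rewrite !in_setU -orbA => /or3P[h|h|h].
- by left; have := odd_nsmooth h; rewrite inE; lia.
- by right; exists x => //; apply: near_refl.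
- by right; apply: small_part_near.
Qed.

End OneSet.

End Components.

(** * Refining an approximation by a few corrections *)

Section Refine.
Variable G : cayley.
Local Notation T := (vert G).
Local Notation Dir := (dir G).
Local Notation D := #|Dir|.

(* Adding to [F] the neighbourhoods of [Y1] leaves few neighbours outside for
   the even vertices of the set; removing from the even vertices that look
   inside the neighbourhoods of [Y2] does the same for odd outer vertices. *)
Definition grow (F Y1 : {set T}) := F :|: nbs Y1.
Definition full_evens s (F : {set T}) := [set u | ~~ par u & D - s <= din F u].
Definition refine_out s F Y1 Y2 := full_evens s (grow F Y1) :\: nbs Y2.
Definition refine_in s F Y1 Y2 :=
  grow F Y1 :|: [set v | par v & s <= din (refine_out s F Y1 Y2) v].

Lemma sub_nbs (A B : {set T}) : A \subset B -> nbs A \subset nbs B.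
Proof.
move=> sAB; apply/subsetP => x; rewrite !inE => /existsP[a aA].
by apply/existsP; exists a; apply: (subsetP sAB).
Qed.

(** [Y1] and [Y2] are taken of maximal size among sets whose elements each pay with [s] fresh
    vertices, added to [F] or removed from the even side. This bounds their sizes, and a vertex
    violating one of the degree conditions could still be adjoined, against maximality. *)
Lemma refine_exists (X F : {set T}) s : closed X -> 0 < s -> s.*2 <= D ->
  F \subset odds X ->
  exists Y1 Y2 : {set T},
  [/\ #|Y1| * s <= #|odds X :\: F|,
      #|Y2| * s * D <= (gam X).*2,
      (forall y, y \in Y1 -> exists a, st y a \in odds X :\: F),
      (forall y, y \in Y2 -> exists a, st y a \in Bd X) &
   [/\ refine_in s F Y1 Y2 \subset odds X,
       evens X \subset refine_out s F Y1 Y2,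
       #|refine_out s F Y1 Y2 :\: evens X| * D <= (gam X).*2,
       (forall u, u \in refine_out s F Y1 Y2 -> D - s <= din (refine_in s F Y1 Y2) u) &
       (forall v, par v -> v \notin refine_in s F Y1 Y2 -> din (refine_out s F Y1 Y2) v < s)]].
Proof.
move=> clX s0 s2 FX.
pose C1 := [set u in evens X | [exists a, st u a \in odds X :\: F]].
pose P1 (Y : {set T}) := (Y \subset C1) && (#|F| + #|Y| * s <= #|grow F Y|).
have P10 : P1 set0 by rewrite /P1 sub0set cards0 mul0n addn0 subset_leq_card ?subsetUl.
case: (arg_maxnP (fun Y : {set T} => #|Y|) P10) => Y1 /andP[Y1C hY1] maxY1.
have growX : grow F Y1 \subset odds X.
  apply/subsetP => x; rewrite !inE => /orP[/(subsetP FX)|/existsP[a /(subsetP Y1C)]].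
    by rewrite inE.
  rewrite !inE parS negbK => /andP[/andP[aX px] _]; rewrite px andbT.
  by rewrite -(stK x a); apply: cl_even => //; rewrite parS px.
have cY1 : #|Y1| * s <= #|odds X :\: F|.
  rewrite cardsDS //; have := subset_leq_card growX.
  by have := subset_leq_card FX; lia.
have goodE u : u \in evens X -> D - s <= din (grow F Y1) u.
  move=> uE; apply: contraT; rewrite -ltnNge => bad.
  have uX a : st u a \in odds X.
    by move: uE; rewrite !inE parS => /andP[ux pu]; rewrite cl_even.
  pose N := [set st u a | a in [set a | st u a \notin grow F Y1]].
  have cN : #|N| + din (grow F Y1) u = D.
    rewrite card_in_imset; last by move=> a b _ _; apply: stI.
    rewrite -(din_compl (grow F Y1) u); congr (_ + _).
    by apply: eq_card => a; rewrite !inE.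
  have sN : s <= #|N|.
    rewrite leqNgt; apply/negP => sN; move: bad; rewrite ltnNge => /negP; apply.
    by rewrite leq_subLR -{1}cN leq_add2r ltnW.
  have disN : [disjoint grow F Y1 & N].
    rewrite disjoint_sym disjoint_subset; apply/subsetP => _ /imsetP[a ha ->].
    by rewrite inE in ha; rewrite inE.
  have sub : grow F Y1 :|: N \subset grow F (u |: Y1).
    apply/subsetP => x; rewrite !inE => /orP[/orP[->//|/existsP[a aY]]|/imsetP[a _ ->]].
      by apply/orP; right; apply/existsP; exists a; rewrite !inE aY orbT.
    by apply/orP; right; apply/existsP; exists (op a); rewrite stK setU11.
  have cg := subset_leq_card sub; rewrite cardsU (disjoint_setI0 disN) cards0 subn0 in cg.
  have uC : u \in C1.
    rewrite inE uE /=; apply/existsP.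
    have : 0 < #|N| by apply: leq_trans sN.
    rewrite card_gt0 => /set0Pn[x /imsetP[a ha _]]; rewrite inE in ha; exists a.
    rewrite in_setD uX andbT; apply: contra ha => aF.
    by rewrite in_setU aF.
  have uY : u \notin Y1.
    apply/negP => uY; move: bad; rewrite ltnNge => /negP; apply.
    suff -> : din (grow F Y1) u = D by apply: leq_subr.
    rewrite /din -cardsT; apply: eq_card => a; rewrite in_set in_setT in_setU.
    by apply/orP; right; rewrite inE; apply/existsP; exists (op a); rewrite stK.
  have : P1 (u |: Y1).
    rewrite /P1 subUset sub1set uC Y1C cardsU1 uY /= add1n.
    by apply: leq_trans cg; rewrite mulSn (addnC s) addnA leq_add.
  by move=> /maxY1; rewrite cardsU1 uY /= add1n ltnn.
set S0 := full_evens s (grow F Y1).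
have ES0 : evens X \subset S0.
  apply/subsetP => u uE; rewrite inE goodE // andbT.
  by move: uE; rewrite inE => /andP[].
have S0Bd u : u \in S0 :\: evens X -> D - s <= bdeg X u /\ u \notin X.
  rewrite in_setD !inE => /and3P[h pu hu]; rewrite pu andbT in h; split=> //.
  rewrite -din_out //; apply: leq_trans hu _; apply: din_subset.
  by apply: subset_trans growX _; apply/subsetP => x; rewrite inE => /andP[].
have cS0 : #|S0 :\: evens X| * D <= (gam X).*2.
  have : #|S0 :\: evens X| * (D - s) <= gam X.
    rewrite gam_out (bigID (mem (S0 :\: evens X))) /=.
    apply: leq_trans (leq_addr _ _).
    have -> : \sum_(i in ~: X | i \in S0 :\: evens X) bdeg X i
            = \sum_(i in S0 :\: evens X) bdeg X i.
      apply: eq_bigl => i; rewrite andb_idl // => /S0Bd[_].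
      by rewrite inE.
    by apply: leq_sum_card => u /S0Bd[].
  move=> h; apply: (@leq_trans (#|S0 :\: evens X| * (D - s)).*2).
    by rewrite -muln2 -mulnA leq_mul2l; apply/orP; right; clear -s2; lia.
  by rewrite leq_double.
pose C2 := [set v | [&& par v, v \notin X & [exists a, st v a \in S0 :\: evens X]]].
pose P2 (Y : {set T}) := (Y \subset C2) && (#|S0 :\: nbs Y| + #|Y| * s <= #|S0|).
have P20 : P2 set0.
  rewrite /P2 sub0set cards0 mul0n addn0 subset_leq_card //.
  exact: subsetDl.
case: (arg_maxnP (fun Y : {set T} => #|Y|) P20) => Y2 /andP[Y2C hY2] maxY2.
have nY2 : [disjoint nbs Y2 & evens X].
  rewrite disjoint_subset; apply/subsetP => x; rewrite inE => /existsP[a].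
  move=> /(subsetP Y2C); rewrite !inE => /and3P[pa aX _].
  rewrite negb_and; apply/orP; left; apply: contra aX => xX.
  by apply: cl_even => //; move: pa; rewrite parS.
have EE : evens X \subset refine_out s F Y1 Y2.
  apply/subsetP => x xE; rewrite in_setD (subsetP ES0) // andbT.
  by apply/negP => xN; have := disjoint_setI0 nY2; move=> /setP/(_ x); rewrite !in_setI xN xE inE.
have cY2 : #|Y2| * s <= #|S0 :\: evens X|.
  rewrite cardsDS //; have := subset_leq_card EE; have := subset_leq_card ES0.
  move=> h1 h2; rewrite leq_subRL // addnC.
  by apply: leq_trans hY2; rewrite addnC leq_add2r.
have sub_out : refine_out s F Y1 Y2 \subset S0 by apply: subsetDl.
have goodO v : par v -> v \notin X -> din (refine_out s F Y1 Y2) v < s.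
  move=> pv vX; rewrite ltnNge; apply/negP => bad.
  pose N := [set st v a | a in [set a | st v a \in refine_out s F Y1 Y2]].
  have cN : #|N| = din (refine_out s F Y1 Y2) v.
    by rewrite card_in_imset // => a b _ _; apply: stI.
  have Nout : N \subset refine_out s F Y1 Y2.
    by apply/subsetP => _ /imsetP[a ha ->]; rewrite inE in ha.
  have vC : v \in C2.
    rewrite inE pv vX /=; apply/existsP.
    have : 0 < #|N| by rewrite cN; apply: leq_trans bad.
    rewrite card_gt0 => /set0Pn[x /imsetP[a ha _]]; rewrite inE in ha; exists a.
    rewrite in_setD (subsetP sub_out) // andbT inE negb_and.
    by rewrite (cl_odd_out clX _ pv vX).
  have sub : S0 :\: nbs (v |: Y2) \subset refine_out s F Y1 Y2 :\: N.
    apply/subsetP => x; rewrite /refine_out -/S0 !in_setD => /andP[h ->].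
    rewrite andbT; apply/andP; split.
      apply: contra h => /imsetP[a _ ->].
      by rewrite inE; apply/existsP; exists (op a); rewrite stK setU11.
    apply: contra h; apply/subsetP; apply: sub_nbs.
    exact: subsetUr.
  have cg := subset_leq_card sub; rewrite (cardsDS Nout) cN in cg.
  have vY : v \notin Y2.
    apply/negP => vY; move: bad; rewrite leqNgt => /negP; apply.
    suff -> : din (refine_out s F Y1 Y2) v = 0 by [].
    apply: eq_card0 => a; rewrite in_set in_setD; apply/negbTE.
    rewrite negb_and negbK; apply/orP; left; rewrite inE.
    by apply/existsP; exists (op a); rewrite stK.
  have : P2 (v |: Y2).
    rewrite /P2 subUset sub1set vC Y2C cardsU1 vY /= add1n mulSn.
    have : din (refine_out s F Y1 Y2) v <= #|refine_out s F Y1 Y2|.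
      by rewrite -cN subset_leq_card.
    move=> hN; rewrite addnA; apply: leq_trans hY2; rewrite leq_add2r.
    by apply: (leq_trans (leq_add cg bad)); rewrite subnK.
  by move=> /maxY2; rewrite cardsU1 vY /= add1n ltnn.
exists Y1, Y2; split=> //.
- by apply: leq_trans cS0; rewrite leq_mul2r cY2 orbT.
- by move=> y /(subsetP Y1C); rewrite inE => /andP[_ /existsP].
- move=> y /(subsetP Y2C); rewrite inE => /and3P[_ _ /existsP[a /S0Bd[h _]]].
  exists a; rewrite inE; apply: leq_trans h; rewrite subn_gt0.
  by apply: leq_trans s2; rewrite -addnn -[X in X < _]addn0 ltn_add2l.
split=> //.
- apply/subsetP => x; rewrite in_setU => /orP[/(subsetP growX)//|].
  rewrite !inE => /andP[px h]; rewrite px andbT.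
  by apply: contraLR h => xX; rewrite -ltnNge; apply: goodO.
- apply: leq_trans cS0; rewrite leq_mul2r subset_leq_card ?orbT //.
  exact: setSD.
- move=> u /(subsetP sub_out); rewrite inE => /andP[_ h].
  by apply: leq_trans h _; apply: din_subset; apply: subsetUl.
- move=> v pv; rewrite in_setU negb_or => /andP[_].
  by rewrite inE pv /= -ltnNge.
Qed.

End Refine.

(** * Boundary clusters and codes *)

Section Clusters.
Variable G : cayley.
Local Notation T := (vert G).
Local Notation Dir := (dir G).
Local Notation D := #|Dir|.

(* Gaps up to 6: an odd vertex missed by a code is within distance 5 of the
   boundary, and shifting looks one step further. *)
Definition clr (X : {set T}) : rel T :=
  [rel x y | [&& x \in Bd X, y \in Bd X & near 6 x y]].
Definition clusters (X : {set T}) := equivalence_partition (connect (clr X)) (Bd X).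

Lemma clr_sym X : symmetric (clr X).
Proof.
move=> x y; apply/and3P/and3P => -[h1 h2 h3]; split=> //; by rewrite near_sym.
Qed.

Lemma clusters_partition X : partition (clusters X) (Bd X).
Proof.
apply: equivalence_partitionP => x y z _ _ _; split; first exact: connect0.
by move=> h; rewrite (same_connect (sym_connect_sym (@clr_sym X)) h).
Qed.

Definition cluster (X : {set T}) x := [set y in Bd X | connect (clr X) x y].

Lemma clustersP (X C : {set T}) :
  reflect (exists2 x, x \in Bd X & C = cluster X x) (C \in clusters X).
Proof. exact: imsetP. Qed.

Lemma cluster_sub (X C : {set T}) : C \in clusters X -> C \subset Bd X.
Proof.
by move=> /clustersP[x _ ->]; apply/subsetP => y; rewrite inE => /andP[].
Qed.

Lemma card_clusters (X : {set T}) : #|clusters X| <= #|T|.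
Proof.
have pC := clusters_partition X; have [/eqP covC tr nz] := and3P pC.
apply: (@leq_trans #|Bd X|); last exact: max_card.
rewrite -covC -(eqP tr) -sum1_card; apply: leq_sum => C hC.
by rewrite card_gt0; apply: contraNneq nz => <-.
Qed.

Lemma cluster_near (X C : {set T}) x y : C \in clusters X ->
  x \in C -> y \in Bd X -> near 6 x y -> y \in C.
Proof.
move=> /clustersP[z _ ->]; rewrite !inE => /andP[xB cx] yB nxy; rewrite yB /=.
by apply: connect_trans cx _; apply: connect1; rewrite /clr /= inE xB inE yB.
Qed.

Lemma cluster_step (X C : {set T}) x a : C \in clusters X ->
  (x \in X) != (st x a \in X) -> (x \in C) = (st x a \in C).
Proof.
move=> hC h; apply/idP/idP => hx; apply: (cluster_near hC hx).
- exact: mem_Bd_st h.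
- by apply: (@near_mono _ 1) => //; apply: near1.
- exact: mem_Bd h.
- by rewrite near_sym; apply: (@near_mono _ 1) => //; apply: near1.
Qed.

(** Every point of [Q] is reached from the roots [R] within [Q]. The formulation through cuts is
    monotone in [R], as needed when explored vertices become roots. *)
Definition cut_connected (r : rel T) (R Q : {set T}) := forall Z : {set T},
  R \subset Z -> Z \proper Q -> exists z q, [/\ z \in Z, q \in Q :\: Z & r z q].

(** A step of length 6 inside a cluster is shadowed by a step of length [3 + 6 + 3] between points
    of [Q]. One root per cluster is therefore enough, and only the roots have to be located
    freely. *)
Lemma cluster_roots (X Q : {set T}) : Q \subset Bd X ->
  (forall x, x \in Bd X -> exists2 q, q \in Q & near 3 x q) ->
  exists R : {set T}, [/\ R \subset Q, #|R| = #|clusters X| & cut_connected (near 12) R Q].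
Proof.
move=> QB hQ.
have [/eqP covC tr nz] := and3P (clusters_partition X).
pose f (C : {set T}) := [pick q in C :&: Q].
have fP C : C \in clusters X -> exists2 q, f C = Some q & q \in C :&: Q.
  move=> hC; rewrite /f; case: pickP => [q hq|h0]; first by exists q.
  have [x xB eC] := clustersP _ _ hC.
  have xC : x \in C by rewrite eC inE xB connect0.
  have [q qQ nq] := hQ x xB.
  have := h0 q; rewrite inE qQ (cluster_near hC xC) //; first exact: (subsetP QB).
  by apply: near_mono nq.
have [x0 _|emp] := pickP (mem Q); last first.
  exists set0; rewrite sub0set cards0; split=> //.
    suff -> : clusters X = set0 by rewrite cards0.
    apply/setP => C; rewrite [RHS]inE; apply/negP => /fP[q _].
    by rewrite inE => /andP[_ qQ]; have := emp q; rewrite /= qQ.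
  by move=> Z _ /properP[_ [q qQ]]; have := emp q; rewrite /= qQ.
pose g C := odflt x0 (f C).
have gP C : C \in clusters X -> g C \in C :&: Q by move=> /fP[q e h]; rewrite /g e.
exists [set g C | C in clusters X]; split.
- by apply/subsetP => _ /imsetP[C /gP h ->]; move: h; rewrite inE => /andP[].
- apply: card_in_imset => A B hA hB e; apply/eqP; apply: contraT => AB.
  have := (trivIsetP tr) A B hA hB AB; rewrite -setI_eq0 => /eqP/setP/(_ (g A)).
  have := gP _ hA; have := gP _ hB; rewrite -e !inE.
  by move=> /andP[-> _] /andP[-> _].
move=> Z RZ /properP[ZQ [q qQ qZ]].
case: (boolP [exists z in Z, [exists q' in Q :\: Z, near 12 z q']]).
  by move=> /exists_inP[z zZ /exists_inP[q' h1 h2]]; exists z, q'.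
move=> /exists_inPn h; exfalso.
have hZ z q' : z \in Z -> q' \in Q -> near 12 z q' -> q' \in Z.
  move=> zZ q'Q n; apply: contraT => q'Z; have /exists_inPn/(_ q') := h _ zZ.
  by rewrite inE q'Z q'Q n => /(_ isT).
(* If no step of length 12 leaves [Z], this property propagates along a cluster from its root, so it
   reaches [q]. *)
pose W x := forall q', q' \in Q -> near 3 x q' -> q' \in Z.
have qB : q \in Bd X by apply: (subsetP QB).
have hC : cluster X q \in clusters X by apply/clustersP; exists q.
have := gP _ hC; rewrite in_setI inE => /andP[/andP[gB cqg] gQ].
have W0 : W (g (cluster X q)).
  move=> q' q'Q n; apply: (hZ (g (cluster X q))) => //; last exact: near_mono n.
  by apply: (subsetP RZ); apply: imset_f.
suff : W q by move=> /(_ q qQ (near_refl _ _)); rewrite (negbTE qZ).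
have step x y : clr X x y -> W x -> W y.
  move=> /and3P[xB yB nxy] Wx q' q'Q n.
  have [q'' q''Q n''] := hQ x xB.
  apply: (hZ q'' q') => //; first exact: Wx.
  rewrite (_ : 12 = 3 + 6 + 3) //; apply: near_trans n; apply: near_trans nxy.
  by rewrite near_sym.
have : connect (clr X) (g (cluster X q)) q.
  by rewrite (sym_connect_sym (@clr_sym X)).
move=> /connectP[p]; elim: p (g _) W0 => [|y p IH] x Wx /=; first by move=> _ ->.
by move=> /andP[xy hp] e; apply: (IH y) => //; apply: step Wx.
Qed.

End Clusters.

(** * Codes of closed regions *)

Section Codes.
Variable G : cayley.
Local Notation T := (vert G).
Local Notation Dir := (dir G).
Local Notation D := #|Dir|.

Definition ball_around r (Q : {set T}) := [set x | [exists q in Q, near r q x]].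

Lemma card_ball_around r (Q : {set T}) : #|ball_around r Q| <= D.+1 ^ r * #|Q|.
Proof.
have -> : ball_around r Q = \bigcup_(q in Q) [set x | near r q x].
  apply/setP => x; rewrite inE; apply/exists_inP/bigcupP => -[q qQ h]; exists q => //.
    by rewrite inE.
  by move: h; rewrite inE.
apply: leq_trans (_ : \sum_(q in Q) #|[set x | near r q x]| <= _); last first.
  rewrite mulnC -sum_nat_const; apply: leq_sum => q _; exact: card_near.
elim/big_rec2: _ => [|q k A _ IH]; first by rewrite cards0.
by apply: (leq_trans (leq_card_setU _ _).1); rewrite leq_add2l.
Qed.

Lemma card_nbs (Q : {set T}) : #|nbs Q| <= D * #|Q|.
Proof.
have sub : nbs Q \subset [set st p.1 (op p.2) | p in setX Q [set: Dir]].
  apply/subsetP => x; rewrite inE => /existsP[a h]; apply/imsetP; exists (st x a, a).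
    by rewrite in_setX h in_setT.
  by rewrite stK.
apply: (leq_trans (subset_leq_card sub)); apply: (leq_trans (leq_imset_card _ _)).
by rewrite cardsX cardsT mulnC.
Qed.

(* Skeleton, large components of its complement lying inside the region, and the
   correction sets of the two rounds of [refine_in] and [refine_out]. *)
Definition code : Type :=
  {set T} * {set {set T}} * ({set T} * {set T}) * ({set T} * {set T}).
Definition skel (c : code) := c.1.1.1.
Definition compo (c : code) := c.1.1.2.
Definition set1 (c : code) := c.1.2.1.
Definition set2 (c : code) := c.1.2.2.
Definition set3 (c : code) := c.2.1.
Definition set4 (c : code) := c.2.2.

(** Two rounds are used because the components may miss of order [D * n] odd vertices, too many for
    corrections that pay only [s] each. With threshold [D %/ 4] a multiple of [n] corrections brings
    this down to [2 * t]; a second round with threshold [s] then needs about [t / s]. *)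
Definition approx1 c := refine_in (D %/ 4) (odd_part (compo c)) (set1 c) (set2 c).
Definition approx_in s c := refine_in s (approx1 c) (set3 c) (set4 c).
Definition approx_out s c := refine_out s (approx1 c) (set3 c) (set4 c).

Definition valid_code M n c := [&& #|skel c| <= n,
  compo c \subset large_comps M (nbs (skel c)) &
  all (fun Y : {set T} => (Y \subset ball_around 6 (skel c)) && (#|Y| <= 32 * n))
    [:: set1 c; set2 c; set3 c; set4 c]].

(** The edges between [S] and [F] number at most [#|F| * D]. The edges at [S] that miss [F] either
    join even vertices of [X] to missed odd vertices, each of which sees fewer than [s] vertices of
    [S], or start at one of the extra even vertices, at most [s] from each. This replaces [gam_diff]
    for the approximation. *)
Lemma approx_balance (X F S : {set T}) s : closed X ->
  F \subset odds X -> evens X \subset S ->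
  (forall u, u \in S -> D - s <= din F u) ->
  (forall v, par v -> v \notin F -> din S v < s) ->
  #|S| * D <= #|F| * D + (#|odds X :\: F| + #|S :\: evens X|) * s.
Proof.
move=> clX FX ES hS hF.
have -> : #|S| * D = \sum_(u in S) din F u + \sum_(u in S) (D - din F u).
  rewrite -big_split -sum_nat_const; apply: eq_bigr => u _ /=.
  by rewrite subnKC // din_leq.
apply: leq_add.
  by rewrite sum_din -sum_nat_const; apply: leq_sum => v _; apply: din_leq.
rewrite (big_setID (evens X)) /= (setIidPr ES) mulnDl; apply: leq_add.
  have -> : \sum_(u in evens X) (D - din F u) = \sum_(u in evens X) din (odds X :\: F) u.
    apply: eq_bigr => u; rewrite inE => /andP[uX pu].
    rewrite -(din_compl F u) addnK; apply: eq_card => a.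
    by rewrite !inE (cl_even clX a pu uX) parS pu /= andbT.
  rewrite sum_din -sum_nat_const; apply: leq_sum => v; rewrite !inE => /and3P[vF _ pv].
  by apply: leq_trans (ltnW (hF v pv vF)); apply: din_subset.
rewrite -sum_nat_const; apply: leq_sum => u; rewrite inE => /andP[_ /hS].
by rewrite !leq_subLR addnC.
Qed.

Lemma near_skeleton (X Q : {set T}) s : closed X -> 6 * s <= D -> 0 < D ->
  heavy X s \subset nbs Q -> forall x, x \in Bd X -> exists2 q, q \in Q & near 3 x q.
Proof.
move=> clX s6 D0 hQ x xB; have [z /(subsetP hQ)] := near_heavy clX s6 D0 xB.
rewrite inE => /existsP[a aQ] n2; exists (st z a) => //.
exact: near_st'.
Qed.

Variable M : nat.
Hypothesis isoA : forall K : {set T}, #|K| < M -> #|K| * D <= (gam K).*2.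
Hypothesis ballM : forall (K : {set T}) x, x \in K -> #|K| < M ->
  exists2 y, y \notin K & near 4 x y.

Lemma code_exists (X : {set T}) s t n (Q : {set T}) : closed X -> gam X = t * D ->
  0 < s -> 8 * s <= D -> 8 <= D -> t <= s * n ->
  Q \subset Bd X -> heavy X s \subset nbs Q -> #|Q| <= n ->
  exists c, [/\ skel c = Q, valid_code M n c &
  let F := approx_in s c in let S := approx_out s c in
  [/\ F \subset odds X, evens X \subset S, (forall u, u \in S -> D - s <= din F u),
      #|S| * D <= #|F| * D + (#|odds X :\: F| + #|S :\: evens X|) * s &
      forall x, x \in odds X :\: F -> exists2 q, q \in Q & near 5 q x]].
Proof.
move=> clX gX s0 s8 D8 tn QB hQ cQ.
have D0 : 0 < D by apply: leq_trans D8.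
have s6 : 6 * s <= D by apply: leq_trans s8; rewrite leq_mul2r orbT.
have BdQ x : x \in Bd X -> exists2 q, q \in Q & near 3 q x.
  by move=> /(near_skeleton clX s6 D0 hQ)[q qQ nq]; exists q; rewrite // near_sym.
pose B := inner_comps M (nbs Q) X; pose F0 := odd_part B.
have F0X : F0 \subset odds X by apply: odd_part_sub.
have F0near x : x \in odds X :\: F0 -> exists2 q, q \in Q & near 5 q x.
  move=> /(odd_part_rest_near ballM clX s6 D0 hQ)[/BdQ[q qQ nq]|[p]].
    by exists q => //; apply: near_mono nq.
  rewrite inE => /existsP[a aQ] np; exists (st p a) => //.
  by rewrite near_sym; apply: near_st'.
have cF0 : #|odds X :\: F0| <= 2 * t + 3 * (D * n).
  rewrite -(leq_pmul2r D0).
  apply: leq_trans (card_odd_part_rest isoA clX s6 D0 hQ) _.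
  rewrite gX -mul2n mulnA mulnDl leq_add2l leq_mul2r leq_mul2l /=.
  by rewrite (leq_trans (card_nbs Q)) ?orbT // leq_mul2l cQ orbT.
set s1 := D %/ 4.
have s1D : D <= 8 * s1 by rewrite /s1; clear -D8; lia.
have s10 : 0 < s1 by rewrite divn_gt0 // (leq_trans _ D8).
have s12 : s1.*2 <= D by rewrite /s1; clear; lia.
have [Y1 [Y2 [cY1 cY2 nY1 nY2 [F1X ES1 cS1 gS1 gF1]]]] := refine_exists clX s10 s12 F0X.
set F1 := refine_in _ _ _ _ in F1X gS1 gF1; set S1 := refine_out _ _ _ _ in ES1 cS1 gS1 gF1.
(* A missed odd vertex has fewer than [D %/ 4] neighbours in [S1], hence in [X], so at least half of
   its edges are boundary edges. *)
have cF1 : #|odds X :\: F1| <= 2 * t.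
  rewrite -(leq_pmul2r D0) -mulnA -gX mul2n.
  apply: (@leq_trans (\sum_(x in odds X :\: F1) (bdeg X x).*2)).
    apply: leq_sum_card => x; rewrite in_setD [x \in odds X]in_set => /and3P[xF xX px].
    have := gF1 x px xF; have := din_in xX.
    have : din X x <= din S1 x.
      apply: subset_leq_card; apply/subsetP => a aX; rewrite in_set in aX.
      by rewrite in_set; apply: (subsetP ES1); rewrite inE aX parS px.
    by move: (din X x) (din S1 x) (bdeg X x) => u v w; clear -s12; lia.
  rewrite gamE -mul2n big_distrr /=.
  rewrite [X in _ <= X](big_setID (odds X :\: F1)) /= (setIidPr _); last first.
    by apply/subsetP => x; rewrite in_setD [x \in odds X]in_set => /and3P[].
  by apply: leq_trans (leq_addr _ _); apply: leq_sum => x _; rewrite mul2n.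
have s2 : s.*2 <= D by rewrite -mul2n (leq_trans _ s8) // leq_mul2r orbT.
have [Y3 [Y4 [cY3 cY4 nY3 nY4 [F2X ES2 cS2 gS2 gF2]]]] := refine_exists clX s0 s2 F1X.
have F01 : F0 \subset F1.
  by apply: subset_trans (subsetUl _ _); apply: subsetUl.
have F12 : F1 \subset refine_in s F1 Y3 Y4.
  by apply: subset_trans (subsetUl _ _); apply: subsetUl.
exists (Q, B, (Y1, Y2), (Y3, Y4)); split=> //.
- have near_odd (F : {set T}) y : F0 \subset F ->
      (exists a, st y a \in odds X :\: F) -> y \in ball_around 6 Q.
    move=> sF [a]; rewrite in_setD => /andP[aF aX].
    have [|q qQ nq] := F0near (st y a).
      by rewrite in_setD aX andbT; apply: contra aF; apply: (subsetP sF).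
    by rewrite inE; apply/exists_inP; exists q => //; apply: near_st nq.
  have near_bd y : (exists a, st y a \in Bd X) -> y \in ball_around 6 Q.
    move=> [a /BdQ[q qQ nq]]; rewrite inE; apply/exists_inP; exists q => //.
    by apply: (@near_mono _ 4) => //; apply: near_st nq.
  rewrite /valid_code /skel /= cQ andbT /=; apply/andP; split.
    by apply/subsetP => K; rewrite inE => /andP[].
  apply/and4P; split; apply/andP; split.
  + by apply/subsetP => y /nY1; apply: near_odd.
  (* Here [2 * t + 3 * D * n] is at most [26 * n * s1], by [t <= s * n], [8 * s <= D] and
     [D <= 8 * s1]. It is the largest of the four bounds; 32 is a round value above it. *)
  + rewrite -(leq_pmul2r s10); apply: leq_trans cY1 _; apply: leq_trans cF0 _.
    by move: tn s8 s1D; clear; nia.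
  + by apply/subsetP => y /nY2; apply: near_bd.
  + have h : #|Y2| * s1 <= 2 * t.
      by rewrite -(leq_pmul2r D0) -(mulnA 2) -gX mul2n.
    rewrite -(leq_pmul2r s10); apply: leq_trans h _.
    by move: tn s8 s1D; clear; nia.
  + by apply/subsetP => y /nY3; apply: near_odd.
  + rewrite -(leq_pmul2r s0); apply: leq_trans cY3 _; apply: leq_trans cF1 _.
    by move: tn; clear; nia.
  + by apply/subsetP => y /nY4; apply: near_bd.
  + have h : #|Y4| * s <= 2 * t.
      by rewrite -(leq_pmul2r D0) -(mulnA 2) -gX mul2n.
    rewrite -(leq_pmul2r s0); apply: leq_trans h _.
    by move: tn; clear; nia.
- split=> //; first exact: approx_balance.
  move=> x; rewrite in_setD => /andP[xF xX]; apply: F0near.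
  rewrite in_setD xX andbT; apply: contra xF => xF.
  by apply: (subsetP F12); apply: (subsetP F01).
Qed.

(** A closed region is determined by its odd vertices. This is what makes listing the odd vertices
    missed by a code sufficient to know the region. *)
Lemma full_evens_odds (X : {set T}) : closed X -> full_evens 0 (odds X) = evens X.
Proof.
move=> clX; apply/setP => u; rewrite !inE subn0 andbC; case pu: (par u) => /=; rewrite ?andbF ?andbT //.
apply/idP/idP => h.
  apply: contraT => uX; have [|a aX] := cl_even_out clX _ uX; first by rewrite pu.
  move: h; rewrite leqNgt => /negP; case.
  rewrite -[X in _ < X](din_compl (odds X) u) -add1n leq_add2r card_gt0.
  by apply/set0Pn; exists a; rewrite !inE negb_and aX.
rewrite -cardsT; apply: subset_leq_card; apply/subsetP => a _.
by rewrite !inE parS pu cl_even ?pu.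
Qed.

End Codes.

(** * Filling a cluster *)

Section Filling.
Variable G : cayley.
Local Notation T := (vert G).
Local Notation Dir := (dir G).
Local Notation D := #|Dir|.

Definition cgam (X C : {set T}) := \sum_(x in C) bdeg X x.

Lemma sum_cgam (X : {set T}) : \sum_(C in clusters X) cgam X C = (gam X).*2.
Proof.
rewrite -sum_bdeg (bigID (mem (Bd X))) /= [X in _ + X]big1 ?addn0.
  by rewrite (set_partition_big _ (clusters_partition X)).
by move=> x; rewrite inE -eqn0Ngt => /eqP.
Qed.

(** [X'] arises from [X] by erasing boundary clusters: around the boundary that is left nothing has
    changed, so local facts about [X] there remain available. *)
Definition agrees (X X' : {set T}) :=
  forall x z, x \in Bd X' -> near 6 x z -> (z \in X') = (z \in X).

Lemma agrees_Bd (X X' : {set T}) : agrees X X' -> Bd X' \subset Bd X.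
Proof.
move=> h; apply/subsetP => x xB; have [a ha] := BdP _ _ xB; apply: (@mem_Bd _ _ _ a).
rewrite -(h x) ?near_refl // -(h x (st x a)) //.
by apply: (@near_mono _ 1) => //; apply: near1.
Qed.

Lemma agrees_trans X X' X'' : agrees X X' -> agrees X' X'' -> agrees X X''.
Proof.
move=> h h' x z xB n; rewrite (h' x) // (h x) //.
exact: (subsetP (agrees_Bd h')).
Qed.

Lemma agrees_st (X X' : {set T}) x a : agrees X X' -> x \in Bd X' ->
  (x \in X') = (x \in X) /\ (st x a \in X') = (st x a \in X).
Proof.
move=> h xB; split; apply: (h x) => //; first exact: near_refl.
by apply: (@near_mono _ 1) => //; apply: near1.
Qed.

Lemma agrees_closed (X X' : {set T}) : 0 < D -> closed X -> agrees X X' -> closed X'.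
Proof.
move=> /card_gt0P[a0 _] clX h; apply/forallP => x.
have [xB|xB] := boolP (x \in Bd X').
  have e := fun a => agrees_st a h xB.
  have -> : [exists a, st x a \in X'] = [exists a, st x a \in X].
    by apply: eq_existsb => a; rewrite (e a).2.
  have -> : [forall a, st x a \in X'] = [forall a, st x a \in X].
    by apply: eq_forallb => a; rewrite (e a).2.
  by rewrite (e a0).1; apply: (forallP clX x).
have nB a : (st x a \in X') = (x \in X').
  by apply/esym/eqP; apply: contraNT xB; apply: mem_Bd.
case: (par x); first by apply/implyP => xX; apply/existsP; exists a0; rewrite nB.
have [xX|xX] := boolP (x \in X'); first by apply/forallP => a; rewrite nB.
by apply/existsP; exists a0; rewrite nB.
Qed.

Section Fill.
Variables (X C Y : {set T}).
Hypothesis clX : closed X.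
Hypothesis hC : C \in clusters X.
Hypothesis hY : forall x a,
  ((x \in Y) != (st x a \in Y)) = ((x \in X) != (st x a \in X)) && (x \in C).

Lemma fill_bdeg x : bdeg Y x = if x \in C then bdeg X x else 0.
Proof.
case: ifP => xC.
  by apply: eq_card => a; rewrite !inE hY xC andbT.
by apply: eq_card0 => a; rewrite !inE hY xC andbF.
Qed.

Lemma fill_gam : (gam Y).*2 = cgam X C.
Proof.
rewrite -sum_bdeg (bigID (mem C)) /= [X in _ + X]big1 ?addn0.
  by apply: eq_bigr => x xC; rewrite fill_bdeg xC.
by move=> x xC; rewrite fill_bdeg (negbTE xC).
Qed.

(** Next to a boundary edge of [C], on the side of [Y], lies a vertex at no boundary edge of [X]: an
    even vertex of [X] or an odd vertex outside [X]. All its neighbours lie on the same side of [Y].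
    With isoperimetry this forces the filled boundary to be of order [D * D]. *)
Lemma fill_card : D <= #|Y|.
Proof.
have [x0 xB eC] := clustersP _ _ hC.
have xC : x0 \in C by rewrite eC inE xB connect0.
have key w : w \in Y -> (forall a, (w \in X) = (st w a \in X)) -> D <= #|Y|.
  move=> wY hw; rewrite -(card_imset predT (@stI G w)); apply: subset_leq_card.
  apply/subsetP => _ /imsetP[b _ ->]; have := hY w b.
  by rewrite -hw eqxx wY; case: (_ \in Y).
have [a ha] := BdP _ _ xB.
have [v [b [vX uX vC]]] : exists v b, [/\ v \in X, st v b \notin X & v \in C].
  case xX: (x0 \in X) ha => h; first by exists x0, a; rewrite xX xC; move: h; case: (_ \in X).
  exists (st x0 a), (op a); rewrite stK xX -(cluster_step hC) ?xX //.
  by move: h; case: (_ \in X).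
have pv := bdry_par clX vX uX.
have := hY v b; rewrite vX (negbTE uX) vC /= => hvu.
have [vY|vY] := boolP (v \in Y).
  have [c wX] := cl_odd clX pv vX.
  apply: (key (st v c)) => [|d]; last by rewrite wX cl_even // parS pv.
  by have := hY v c; rewrite vX wX vY; case: (_ \in Y).
have uY : st v b \in Y by move: hvu; rewrite (negbTE vY); case: (_ \in Y).
have [|c yX] := cl_even_out clX _ uX; first by rewrite parS pv.
apply: (key (st (st v b) c)) => [|d].
  by have := hY (st v b) c; rewrite (negbTE uX) (negbTE yX) uY; case: (_ \in Y).
by rewrite (negbTE yX) (negbTE (cl_odd_out _ _ _ yX)) // !parS pv.
Qed.

(* Whether [X] and [Y] agree is constant along the cluster: they cross the
   boundary together near it. *)
Lemma fill_orientation x y : x \in C -> y \in C ->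
  ((x \in X) == (x \in Y)) = ((y \in X) == (y \in Y)).
Proof.
have nearo x0 z j : x0 \in C -> j <= 6 -> near j x0 z ->
    ((z \in X) == (z \in Y)) = ((x0 \in X) == (x0 \in Y)).
  move=> xC; elim: j z => [|j IH] z j6; first by rewrite near0E => /eqP ->.
  rewrite nearSE => /orP[|/existsP[a n]]; first by apply: IH; apply: ltnW.
  rewrite -(IH _ (ltnW j6) n); have := hY z a.
  have [e|ne] := eqVneq (z \in X) (st z a \in X).
    by rewrite /= -e => /negbFE/eqP ->.
  rewrite (cluster_step hC ne) (cluster_near hC xC) //=.
  - by move: ne; do 4 case: (_ \in _).
  - exact: mem_Bd_st ne.
  - by apply: near_mono n; apply: ltnW.
move=> xC yC; have [x0 xB eC] := clustersP _ _ hC.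
suff h z : connect (clr X) x0 z -> ((z \in X) == (z \in Y)) = ((x0 \in X) == (x0 \in Y)).
  by move: xC yC; rewrite eC !inE => /andP[_ /h ->] /andP[_ /h ->].
have : x0 \in C by rewrite eC inE xB connect0.
move=> x0C /connectP[p]; elim: p x0 x0C {xB eC} => [|w p IH] x0 x0C /=; first by move=> _ ->.
move=> /andP[/and3P[xB wB n] hp] e.
have wC : w \in C := cluster_near hC x0C wB n.
by rewrite (IH w wC hp e); apply: (nearo x0 w 6).
Qed.

Lemma fill_exists : exists X' : {set T},
  [/\ agrees X X', #|clusters X'| < #|clusters X|,
      #|X| <= #|X'| + #|Y| & #|~: X| <= #|~: X'| + #|Y|].
Proof.
have [x0 xB eC] := clustersP _ _ hC.
have x0C : x0 \in C by rewrite eC inE xB connect0.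
(* The value of [X] on the outer side of [Y] along the cluster, the same at all its vertices by
   [fill_orientation]. Giving this value to all of [Y] erases [C] and creates no boundary edge. *)
pose c0 := (x0 \in X) != (x0 \in Y).
pose X' := [set x | if x \in Y then c0 else x \in X].
have inC x : x \in C -> x \notin Y -> (x \in X) = c0.
  move=> xC xY; have := fill_orientation xC x0C; rewrite /c0 (negbTE xY).
  by case: (x \in X); case: ((x0 \in X) == (x0 \in Y)).
have outX x : x \notin Y -> (x \in X') = (x \in X) by rewrite inE => /negbTE ->.
have stepB x a : (x \in X') != (st x a \in X') ->
    [/\ (x \in X) != (st x a \in X), x \notin Y, st x a \notin Y & x \notin C].
  have := hY x a; rewrite !inE.
  have [xY|xY] := boolP (x \in Y); have [aY|aY] := boolP (st x a \in Y); rewrite ?eqxx //=.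
  - move=> /esym/andP[h xC]; rewrite (inC (st x a)) ?eqxx //.
    by rewrite -(cluster_step hC h).
  - by move=> /esym/andP[h xC]; rewrite (inC x) ?eqxx.
  - by move=> e h; split=> //; apply/negP => xC; move: e; rewrite h xC.
have BdX' x : (x \in Bd X') = [&& x \in Bd X, x \notin C & x \notin Y].
  apply/idP/and3P => [/BdP[a /stepB[h xY aY xC]]|[/BdP[a h] xC xY]].
    by split=> //; apply: mem_Bd h.
  apply: (@mem_Bd _ _ _ a); rewrite !outX //.
  by have := hY x a; rewrite (negbTE xC) andbF (negbTE xY); case: (_ \in Y).
have nY x z j : x \in Bd X' -> j <= 6 -> near j x z -> z \notin Y.
  rewrite BdX' => /and3P[xBX xC xY]; elim: j z => [|j IH] z j6.
    by rewrite near0E => /eqP <-.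
  rewrite nearSE => /orP[|/existsP[a n]]; first by apply: IH; apply: ltnW.
  have aY := IH _ (ltnW j6) n; apply/negP => zY.
  have := hY z a; rewrite zY (negbTE aY) /= => /esym/andP[h zC].
  move: xC; rewrite (cluster_near hC _ xBX (x:=st z a)) //.
    by rewrite -(cluster_step hC h).
  by rewrite near_sym; apply: near_mono n; apply: ltnW.
have agr : agrees X X' by move=> x z xB' n; apply: outX; apply: nY n.
exists X'; split=> //.
- apply: proper_card; apply/properP; split; last first.
    exists C => //; apply/negP => /clustersP[x xB' eC'].
    have : x \in C by rewrite eC' inE xB' connect0.
    by move: xB'; rewrite BdX' => /and3P[_ /negbTE ->].
  (* A remaining boundary vertex keeps all its cluster neighbours, so the clusters of [X'] are among
     those of [X], without [C]. *)
  have cl1 x y : x \in Bd X' -> clr X x y = clr X' x y.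
    move=> xB'; have := xB'; rewrite BdX' => /and3P[xBX xC xY].
    apply/and3P/and3P => -[h1 h2 h3]; split=> //; last first.
      by move: h2; rewrite BdX' => /and3P[].
    rewrite BdX' h2 (nY x y 6) // andbT; apply: contra xC => yC.
    by apply: (cluster_near hC yC) => //; rewrite near_sym.
  have cl2 x y : x \in Bd X' -> connect (clr X) x y = connect (clr X') x y.
    move=> xB'; apply/idP/idP.
      move=> /connectP[p]; elim: p x xB' => [|w p IH] x xB' /=; first by move=> _ ->.
      rewrite cl1 // => /andP[xw hp] e.
      apply: connect_trans (connect1 xw) _; apply: IH => //.
      by move: xw => /and3P[].
    apply: connect_sub => u v uv; apply: connect1; rewrite cl1 //.
    by move: uv => /and3P[].
  apply/subsetP => C' /clustersP[x xB' ->]; apply/clustersP; exists x.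
    exact: (subsetP (agrees_Bd agr)).
  apply/setP => y; rewrite ![y \in cluster _ _]in_set -cl2 //; case cxy: (connect _ _ _); rewrite ?andbF // !andbT.
  apply/idP/idP; first exact: (subsetP (agrees_Bd agr)).
  move=> yB; move: cxy; rewrite cl2 // => /connectP[p].
  elim: p x xB' => [|w p IH] x xB' /=; first by move=> _ ->.
  by move=> /andP[/and3P[_ wB _]]; apply: IH.
- apply: leq_trans (leq_card_setU _ _).1; apply: subset_leq_card.
  by apply/subsetP => x xX; rewrite !inE; case: ifP; rewrite ?xX ?orbT.
- apply: leq_trans (leq_card_setU _ _).1; apply: subset_leq_card.
  by apply/subsetP => x; rewrite !inE => xX; case: ifP; rewrite ?xX ?orbT.
Qed.

End Fill.

End Filling.

(** * The discrete torus *)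

Import GRing.Theory.

Section Torus.
Variables (d l : nat).
Hypothesis l_gt0 : 0 < l.
Hypothesis l_even : ~~ odd l.
(** In this form ordinals below [L] carry a ring structure, so vertices form an additive group and
    steps are translations. Positivity of [l] makes the unit vector differ from its opposite. *)
Local Notation L := l.+2.
Local Notation T := {ffun 'I_d -> 'I_L}.

Definition unit_vec (i : 'I_d) : T := [ffun j => if j == i then 1%R else 0%R].
Local Notation e_ := unit_vec.
Definition torus_gen (a : 'I_d * bool) : T :=
  if a.2 then e_ a.1 else (- e_ a.1)%R.
Definition torus_st (x : T) a : T := (x + torus_gen a)%R.
Definition torus_op (a : 'I_d * bool) := (a.1, ~~ a.2).
Definition torus_par (x : T) := odd (\sum_i x i).

Lemma torus_gen_op a : torus_gen (torus_op a) = (- torus_gen a)%R.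
Proof. by rewrite /torus_gen /=; case: a.2; rewrite //= opprK. Qed.

Lemma torus_stK x a : torus_st (torus_st x a) (torus_op a) = x.
Proof. by rewrite /torus_st torus_gen_op addrK. Qed.

Lemma torus_opK : involutive torus_op.
Proof. by case=> i b; rewrite /torus_op /= negbK. Qed.

Lemma torus_stC x a b : torus_st (torus_st x a) b = torus_st (torus_st x b) a.
Proof. by rewrite /torus_st addrAC. Qed.

Lemma torus_gen0 a j : j != a.1 -> torus_gen a j = 0%R.
Proof.
by move=> /negbTE h; rewrite /torus_gen; case: a.2; rewrite !ffunE h ?oppr0.
Qed.

Lemma torus_gen1 a : torus_gen a a.1 = (if a.2 then 1 else -1)%R.
Proof. by rewrite /torus_gen; case: a.2; rewrite !ffunE eqxx. Qed.

Lemma one_neq_opp : (1 : 'I_L)%R != (-1)%R.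
Proof.
apply/eqP => /(congr1 val) /=.
rewrite [1 %% _]modn_small // subn1 /= modn_small // => -[e].
by move: l_gt0; rewrite -e.
Qed.

Lemma torus_gen_inj : injective torus_gen.
Proof.
move=> a b h; have := congr1 (fun x : T => x a.1) h; rewrite torus_gen1.
have [e|ne] := eqVneq a.1 b.1.
  rewrite e torus_gen1 => h2; case: a b e h2 {h} => [i p] [j q] /= -> h2; congr (_, _).
  by have /eqP h3 := one_neq_opp; case: p q h2 => [] [] //= h2; case: h3.
rewrite torus_gen0 //; case: a.2 => /eqP; last by rewrite oppr_eq0 oner_eq0.
by rewrite oner_eq0.
Qed.

Lemma torus_stI x : injective (torus_st x).
Proof. by move=> a b /addrI/torus_gen_inj. Qed.

Lemma torus_par_e x i : torus_par (x + e_ i)%R = ~~ torus_par x.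
Proof.
rewrite /torus_par (bigD1 i) //= [in RHS](bigD1 i) //= !oddD -addNb; congr (_ (+) odd _).
  rewrite !ffunE eqxx /= odd_mod ?oddD /= ?modn_small ?addbT //.
  by rewrite /= l_even.
by apply: eq_bigr => j /negbTE ji; rewrite !ffunE ji addr0.
Qed.

Lemma torus_parS x a : torus_par (torus_st x a) = ~~ torus_par x.
Proof.
rewrite /torus_st /torus_gen; case: a.2; first exact: torus_par_e.
by rewrite -[in RHS](subrK (e_ a.1) x) torus_par_e negbK.
Qed.

Definition torusG : cayley :=
  Cayley torus_stI torus_stK torus_opK torus_stC torus_parS.

Local Notation D := #|dir torusG|.

Lemma torus_deg : D = d.*2.
Proof. by rewrite card_prod card_ord card_bool muln2. Qed.

Lemma torus_card : #|T| = L ^ d.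
Proof. by rewrite card_ffun !card_ord. Qed.

Lemma torus_step (x : vert torusG) a : st x a = (x + torus_gen a)%R :> T.
Proof. by []. Qed.

Lemma e_mulr i m j : (e_ i *+ m)%R j = if j == i then inZp m else 0%R.
Proof.
rewrite ffunMnE ffunE; case: (j == i); last by rewrite mul0rn.
exact: Zp_nat.
Qed.

Lemma e_mulrL i : (e_ i *+ L)%R = 0%R.
Proof.
apply/ffunP => j; rewrite e_mulr ffunE; case: (j == i) => //.
by apply: val_inj; rewrite /= modnn.
Qed.

Lemma vec_sum (x : T) : x = (\sum_i e_ i *+ (x i : nat))%R.
Proof.
apply/ffunP => j; rewrite sum_ffunE (bigD1 j) //= e_mulr eqxx big1 ?addr0.
  by apply: val_inj; rewrite /= modn_small.
by move=> i /negbTE ij; rewrite e_mulr eq_sym ij.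
Qed.

Definition base (i : 'I_d) (x : T) : T := [ffun j => if j == i then 0%R else x j].

Lemma baseE i x : x = (base i x + e_ i *+ (x i : nat))%R.
Proof.
apply/ffunP => j; rewrite ffunE ffunE e_mulr; case: eqP => [->|_]; last by rewrite addr0.
by rewrite add0r; apply: val_inj; rewrite /= modn_small.
Qed.

Lemma base_line i x m : base i (x + e_ i *+ m)%R = base i x.
Proof.
by apply/ffunP => j; rewrite !ffunE e_mulr; case: eqP => // _; rewrite addr0.
Qed.

Lemma base_eq i x y : base i x = base i y -> exists m, y = (x + e_ i *+ m)%R.
Proof.
move=> h; exists ((y i : nat) + (L - x i)).
rewrite {1}(baseE i y) -h {2}(baseE i x) mulrnDr addrA -[RHS]addrA -[in RHS]addrA.
rewrite [(e_ i *+ _ + (_ + _))%R]addrCA -mulrnDr subnKC ?e_mulrL ?addr0 //.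
exact: ltnW.
Qed.

Lemma ed_sym (A B : {set T}) :
  \sum_(x in A) din (G := torusG) B x = \sum_(x in B) din (G := torusG) A x.
Proof. exact: (@sum_din torusG). Qed.

(** * Edge isoperimetry on the torus *)

Lemma leq_expr m n k : m <= n -> m ^ k <= n ^ k.
Proof. by case: k => // k h; rewrite leq_exp2r. Qed.

Lemma half_power a b : a <= b -> 4 ^ a * a ^ a * b ^ b <= (a + b) ^ (a + b).
Proof.
move=> ab; have -> : 4 ^ a * a ^ a * b ^ b = (4 * (a * b)) ^ a * b ^ (b - a).
  by rewrite -{2}(subnKC ab) expnD !expnMn; lia.
have -> : (a + b) ^ (a + b) = ((a + b) ^ 2) ^ a * (a + b) ^ (b - a).
  by rewrite -expnM -expnD; congr (_ ^ _); lia.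
apply: leq_mul; apply: leq_expr; first exact: nat_AGM2.
exact: leq_addl.
Qed.

Lemma double_power a b e1 e2 c : c <= 2 * a -> c <= 2 * b ->
  2 ^ e1 <= a ^ (2 * a) -> 2 ^ e2 <= b ^ (2 * b) ->
  2 ^ (e1 + e2 + 2 * c) <= (a + b) ^ (2 * (a + b)).
Proof.
wlog ab : a b e1 e2 / a <= b.
  move=> h ca cb h1 h2; have [ab|/ltnW ba] := leqP a b; first exact: h.
  by rewrite (addnC a) (addnC e1); apply: h.
move=> ca _ h1 h2; rewrite expnD (expnD 2 e1).
have h3 : 2 ^ (2 * c) <= 16 ^ a.
  by rewrite (_ : 16 = 2 ^ 4) // -expnM leq_exp2l //; lia.
apply: leq_trans (leq_mul (leq_mul h1 h2) h3) _.
have -> : (a + b) ^ (2 * (a + b)) = ((a + b) ^ (a + b)) ^ 2 by rewrite -expnM mulnC.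
have -> : a ^ (2 * a) * b ^ (2 * b) * 16 ^ a = (4 ^ a * a ^ a * b ^ b) ^ 2.
  rewrite !expnMn -!expnM (mulnC 2 a) (mulnC 2 b) (_ : 16 = 4 ^ 2) // -expnM (mulnC 2 a); lia.
by rewrite leq_exp2r // half_power.
Qed.

(** As on the hypercube: split [Y] by the value of a coordinate that is not constant on it; a vertex
    has at most two edges across, so at most [2 * min(a, b)] edges cross, and [half_power] absorbs
    them. The exponential form states that [Y] spans at most [#|Y| * log2 #|Y|] edges without using
    logarithms. *)
Lemma iso_edges (Y : {set T}) :
  2 ^ (\sum_(x in Y) din (G := torusG) Y x) <= #|Y| ^ (2 * #|Y|).
Proof.
have [n] := ubnP #|Y|; elim: n Y => // n IH Y Yn.
have [Y1|] := leqP #|Y| 1.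
  have -> : \sum_(x in Y) din (G := torusG) Y x = 0; last first.
    by case: #|Y| Y1 => [|[|//]] //=.
  apply: big1 => x xY; apply: eq_card0 => a; rewrite inE.
  apply/negbTE; apply/negP => aY.
  have e := (card_le1_eqP Y1) _ _ aY xY.
  have := torus_gen1 a; have -> : torus_gen a = 0%R by apply: (@addrI _ x); rewrite addr0.
  rewrite ffunE => /esym/eqP; case: a.2; by rewrite ?oppr_eq0 oner_eq0.
move=> /card_gt1P[x [y [xY yY xy]]].
have [i xyi] : exists i, x i != y i.
  by apply/existsP; apply: contraNT xy => /existsPn h; apply/eqP/ffunP => i; apply/eqP; rewrite -[_ == _]negbK.
pose A := [set z in Y | z i == x i]; pose B := [set z in Y | z i != x i].
have AB : A :|: B = Y by apply/setP => z; rewrite !inE; case: (z \in Y); case: (z i == _).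
have AIB : A :&: B = set0 by apply/setP => z; rewrite !inE; case: (z \in Y); case: (z i == _).
have cAB : #|Y| = #|A| + #|B| by rewrite -AB cardsU AIB cards0 subn0.
have A0 : 0 < #|A| by apply/card_gt0P; exists x; rewrite inE xY eqxx.
have B0 : 0 < #|B| by apply/card_gt0P; exists y; rewrite inE yY eq_sym.
have dsplit z : din (G := torusG) Y z = din (G := torusG) A z + din (G := torusG) B z.
  rewrite /din -cardsUI [X in _ + X]eq_card0 ?addn0; last first.
    by move=> a; rewrite !inE; case: (_ \in Y); case: (_ == _).
  by apply: eq_card => a; rewrite !inE; case: (_ \in Y); case: (_ == _).
have split (Z : {set T}) : \sum_(z in Y) din (G := torusG) Z z =
    \sum_(z in A) din (G := torusG) Z z + \sum_(z in B) din (G := torusG) Z z.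
  rewrite (bigID (fun z : T => z i == x i)) /=.
  by congr (_ + _); apply: eq_bigl => z; rewrite inE.
have two (P : 'I_d * bool -> bool) : (forall a, P a -> a.1 = i) -> #|[set a | P a]| <= 2.
  move=> hP; have sub : [set a | P a] \subset [set (i, true); (i, false)].
    apply/subsetP => -[j b]; rewrite !inE => /hP /= ->.
    by case: b; rewrite !xpair_eqE !eqxx ?orbT.
  apply: leq_trans (subset_leq_card sub) _.
  by rewrite cards2; case: (_ != _).
have cA : \sum_(z in A) din (G := torusG) B z <= 2 * #|A|.
  rewrite mulnC -sum_nat_const; apply: leq_sum => z; rewrite inE => /andP[_ /eqP zi].
  apply: two => a; rewrite inE => /andP[_]; apply: contraNeq => ai.
  by rewrite torus_step ffunE torus_gen0 1?eq_sym // addr0 zi.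
have cB : \sum_(z in A) din (G := torusG) B z <= 2 * #|B|.
  rewrite ed_sym mulnC -sum_nat_const; apply: leq_sum => z; rewrite inE => /andP[_ zi].
  apply: two => a; rewrite inE => /andP[_]; apply: contraTeq => ai.
  have g0 : torus_gen a i = 0%R by apply: torus_gen0; rewrite eq_sym.
  by rewrite torus_step ffunE g0 addr0.
have -> : \sum_(z in Y) din (G := torusG) Y z =
    \sum_(z in A) din (G := torusG) A z + \sum_(z in B) din (G := torusG) B z
    + 2 * \sum_(z in A) din (G := torusG) B z.
  have e1 := split A; have e2 := split B; have e3 := ed_sym A B.
  have e4 : \sum_(z in Y) din (G := torusG) Y z =
      \sum_(z in Y) din (G := torusG) A z + \sum_(z in Y) din (G := torusG) B z.
    by rewrite -big_split; apply: eq_bigr.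
  by rewrite e4 e1 e2 -e3 mul2n -addnn [RHS]addnACA; congr (_ + _); apply: addnC.
by rewrite cAB; apply: double_power => //; apply: IH; lia.
Qed.

Lemma iso_small (Y : {set T}) : #|Y| <= 2 ^ (D %/ 4) -> #|Y| * D <= (gam (G := torusG) Y).*2.
Proof.
move=> hY; have h := iso_edges Y.
have : \sum_(x in Y) din (G := torusG) Y x <= (D %/ 4) * (2 * #|Y|).
  rewrite -(leq_exp2l (m := 2)) // expnM; apply: (leq_trans h).
  exact: leq_expr.
have := gam_card (G := torusG) Y; move: (gam _) (\sum_(x in Y) _) => u v.
have : D %/ 4 * 4 <= D by apply: leq_trunc_div.
by move: (D %/ 4) => q; move: #|Y| D => y D'; nia.
Qed.

Definition exit_set (s : T) (Y : {set T}) := [set y in Y | (y + s)%R \notin Y].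

Lemma exit_add (s s' : T) Y : #|exit_set (s + s')%R Y| <= #|exit_set s Y| + #|exit_set s' Y|.
Proof.
have sub : exit_set (s + s')%R Y \subset
    exit_set s Y :|: [set (y - s)%R | y : T in exit_set s' Y].
  apply/subsetP => y; rewrite in_setU !in_set => /andP[yY h].
  rewrite yY /=; have [ysY|] //= := boolP ((y + s)%R \in Y).
  apply/imsetP; exists (y + s)%R; last by rewrite addrK.
  by rewrite in_set ysY -addrA.
apply: leq_trans (subset_leq_card sub) _.
apply: leq_trans (leq_card_setU _ _).1 _.
by rewrite leq_add2l leq_imset_card.
Qed.

Lemma exit_mulr s m Y : #|exit_set (s *+ m)%R Y| <= m * #|exit_set s Y|.
Proof.
elim: m => [|m IH]; last by rewrite mulrS mulSn (leq_trans (exit_add _ _ _)) ?leq_add2l.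
by rewrite leqn0 cards_eq0; apply/eqP/setP => y; rewrite !inE mulr0n addr0 andbN.
Qed.

Lemma exit_gam Y : \sum_i #|exit_set (e_ i) Y| <= gam (G := torusG) Y.
Proof.
rewrite (sum_card_fiber (fun i y => (y \in Y) && ((y + e_ i)%R \notin Y))).
rewrite -(card_imset _ (f := fun p : 'I_d * T => (p.2, (p.1, true)))).
  apply: subset_leq_card; apply/subsetP => _ /imsetP[[i y] h ->].
  by move: h; rewrite !inE.
by move=> [i y] [j z] [-> ->].
Qed.

(** The left side counts the exits of [Y] under all translations. Exits are subadditive, and a
    translation is a sum of fewer than [L] unit steps in each direction. *)
Lemma iso_global (Y : {set T}) : #|Y| * #|~: Y| <= #|T| * (L * gam (G := torusG) Y).
Proof.
have -> : #|Y| * #|~: Y| = \sum_s #|exit_set s Y|.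
  rewrite (sum_card_fiber (fun s y => (y \in Y) && ((y + s)%R \notin Y))).
  rewrite -cardsX -(card_imset (mem (setX Y (~: Y))) (f := fun p : T * T => ((p.2 - p.1)%R, p.1))).
    apply: eq_card => -[s y]; rewrite [RHS]inE /=; apply/imsetP/andP.
      by move=> [[u v]]; rewrite !inE /= => /andP[uY vY] [-> ->]; rewrite addrC subrK.
    by move=> [yY sY]; exists (y, (y + s)%R); rewrite ?inE /= ?yY // addrC addKr.
  by move=> [u v] [u' v'] [/= h1 h2]; move: h1; rewrite h2 => /addIr ->.
rewrite -sum_nat_const; apply: leq_sum => s _.
apply: leq_trans (_ : \sum_i (s i : nat) * #|exit_set (e_ i) Y| <= _); last first.
  apply: leq_trans (_ : \sum_i L * #|exit_set (e_ i) Y| <= _).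
    by apply: leq_sum => i _; rewrite leq_mul2r (ltnW (ltn_ord _)) orbT.
  by rewrite -big_distrr leq_mul2l exit_gam orbT.
rewrite {1}(vec_sum s); elim/big_ind2: _ => [|m1 v1 m2 v2 h1 h2|i _]; last exact: exit_mulr.
  by rewrite leqn0 cards_eq0; apply/eqP/setP => y; rewrite !inE addr0 andbN.
by apply: leq_trans (exit_add _ _ _) _; apply: leq_add.
Qed.

Lemma card_line_exit i (Y Z : {set T}) : Z \subset Y ->
  (forall x, x \in Z -> exists m, (x + e_ i *+ m)%R \notin Y) ->
  #|[set base i x | x in Z]| <= gam (G := torusG) Y.
Proof.
move=> ZY h; apply: leq_trans (_ : #|[set base i x | x in exit_set (e_ i) Y]| <= _).
  apply: subset_leq_card; apply/subsetP => _ /imsetP[x xZ ->].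
  have [m0 hm0] := h x xZ; have ex : exists m, (x + e_ i *+ m)%R \notin Y by exists m0.
  case: (ex_minnP ex) => -[|m] hm hmin.
    by move: hm; rewrite mulr0n addr0 (subsetP ZY).
  apply/imsetP; exists (x + e_ i *+ m)%R; last by rewrite base_line.
  rewrite in_set -addrA -mulrSr hm andbT; apply: contraT => /hmin.
  by rewrite ltnn.
apply: leq_trans (leq_imset_card _ _) _; apply: leq_trans (exit_gam Y).
by rewrite (bigD1 i) //= leq_addr.
Qed.

Lemma card_base i : L ^ d <= #|[set base i x | x : T]| * L.
Proof.
have -> : #|[set base i x | x : T]| * L = #|setX [set base i x | x : T] [set: 'I_L]|.
  by rewrite cardsX cardsT card_ord.
rewrite -torus_card -(card_imset predT (f := fun x : T => (base i x, x i))).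
  apply: subset_leq_card; apply/subsetP => _ /imsetP[x _ ->].
  by rewrite in_setX in_setT imset_f.
by move=> x y [h1 h2]; rewrite (baseE i x) h1 h2 -baseE.
Qed.

Definition full (Y : {set T}) i (x : T) := [forall m : 'I_L, (x + e_ i *+ m)%R \in Y].

Lemma e_mulr_mod i m : (e_ i *+ m = e_ i *+ (inZp m : 'I_L))%R.
Proof.
apply/ffunP => j; rewrite !e_mulr; case: (j == i) => //.
by apply: val_inj; rewrite /= modn_mod.
Qed.

Lemma fullP (Y : {set T}) i (x : T) m : full Y i x -> (x + e_ i *+ m)%R \in Y.
Proof. by move=> /forallP/(_ (inZp m)); rewrite [in X in _ -> X]e_mulr_mod. Qed.

Lemma base_base i x : base i (base i x) = base i x.
Proof. by apply/ffunP => w; rewrite !ffunE; case: eqP. Qed.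

Lemma base_lin i x m : exists m' : 'I_L, (base i x + e_ i *+ m = x + e_ i *+ m')%R.
Proof.
have [k hk] := base_eq (esym (base_base i x)).
exists (inZp (k + m)); rewrite hk -addrA -mulrnDr; congr (_ + _)%R.
exact: e_mulr_mod.
Qed.

Lemma base_coord i x (c : 'I_L) : (base i x + e_ i *+ c)%R i = c.
Proof.
rewrite ffunE ffunE eqxx e_mulr eqxx add0r; apply: val_inj.
by rewrite /= modn_small.
Qed.

Lemma base_add_inj i x y (c c' : 'I_L) :
  (base i x + e_ i *+ c = base i y + e_ i *+ c')%R -> base i x = base i y /\ c = c'.
Proof.
move=> e; split; last by rewrite -(base_coord i x c) e base_coord.
by have := congr1 (base i) e; rewrite !base_line !base_base.
Qed.

Lemma iso_no_full (Y : {set T}) : 2 <= d -> (forall i x, x \in Y -> ~~ full Y i x) ->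
  #|Y| <= gam (G := torusG) Y ^ 2.
Proof.
move=> d2 h; pose i1 : 'I_d := Ordinal d2; pose j0 : 'I_d := Ordinal (ltnW d2).
have hg k : #|[set base k x | x in Y]| <= gam (G := torusG) Y.
  apply: card_line_exit => // x xY; have := h k x xY.
  by rewrite negb_forall => /existsP[m hm]; exists m.
apply: leq_trans (_ : #|setX [set base j0 x | x in Y] [set base i1 x | x in Y]| <= _).
  rewrite -(card_in_imset (f := fun x => (base j0 x, base i1 x))).
    by apply: subset_leq_card; apply/subsetP => _ /imsetP[x xY ->]; rewrite in_setX !imset_f.
  move=> x y _ _ [h0 h1]; apply/ffunP => j.
  have := congr1 (fun f : T => f j) h0; have := congr1 (fun f : T => f j) h1.
  by rewrite !ffunE; case: eqP => // -> _; case: eqP.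
by rewrite cardsX (leq_mul (hg _) (hg _)).
Qed.

(** Each of the [L] slices orthogonal to [i] contains a point of the full line and one of the empty
    line. Walking between them inside the slice crosses the boundary. *)
Lemma iso_full_empty (Y : {set T}) i (x z : T) : full Y i x ->
  (forall m, (z + e_ i *+ m)%R \notin Y) -> L <= gam (G := torusG) Y.
Proof.
move=> xf zf; have <- : #|[set (p.1 : T) i | p in bdry (G := torusG) Y]| = L.
  rewrite -[RHS]card_ord -cardsT; congr #|pred_of_set _|.
  apply/setP => c; rewrite inE; apply/imsetP.
  case: (boolP [exists p : T * ('I_d * bool), (p \in bdry (G := torusG) Y) && (p.1 i == c)]).
    by move=> /existsP[p /andP[pB /eqP pc]]; exists p.
  move=> noslice; exfalso.
  pose P (s : T) := forall y : T, y \in Y -> y i = c -> (y + s)%R \in Y /\ (y + s)%R i = c.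
  have P0 : P 0%R by move=> y yY yc; rewrite addr0.
  have PD s s' : P s -> P s' -> P (s + s')%R.
    by move=> h h' y yY yc; have [h1 h2] := h y yY yc; rewrite addrA; apply: h'.
  have Pe k : k != i -> P (e_ k).
    move=> ki y yY yc; split; last first.
      by rewrite ffunE (ffunE _ i) eq_sym (negbTE ki) addr0.
    apply: contraT => h; case/negP: noslice; apply/existsP; exists (y, (k, true)).
    by rewrite inE /= yY h yc eqxx.
  have PM s m : P s -> P (s *+ m)%R.
    by move=> h; elim: m => [|m IH]; rewrite ?mulr0n // mulrS; apply: PD.
  have Ps (s : T) : s i = 0%R -> P s.
    move=> si; rewrite (vec_sum s); apply: (big_ind P) => // k _.
    have [->|ki] := eqVneq k i; first by rewrite si mulr0n.
    by apply: PM; apply: Pe.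
  pose y0 := (base i x + e_ i *+ c)%R; pose z0 := (base i z + e_ i *+ c)%R.
  have y0Y : y0 \in Y by have [m e] := base_lin i x c; rewrite /y0 e; apply: fullP.
  have z0Y : z0 \notin Y by have [m e] := base_lin i z c; rewrite /z0 e.
  have [|h _] := Ps (z0 - y0)%R _ y0 y0Y (base_coord i x c).
    have cy : y0 i = c := base_coord i x c; have cz : z0 i = c := base_coord i z c.
    by rewrite ffunE [(- y0)%R i]ffunE cy cz subrr.
  by move: z0Y; rewrite -[z0](subrK y0) addrC h.
exact: leq_imset_card.
Qed.

Lemma card_base_ge i j : j != i -> L <= #|[set base i x | x : T]|.
Proof.
move=> ji; rewrite -[X in X <= _]card_ord -(card_imset predT (f := fun c : 'I_L => (e_ j *+ c)%R)).
  apply: subset_leq_card; apply/subsetP => _ /imsetP[c _ ->]; apply/imsetP.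
  exists (e_ j *+ c)%R => //; apply/ffunP => k; rewrite !ffunE e_mulr.
  by case: (eqVneq k i) => [->|_] //; rewrite eq_sym (negbTE ji).
move=> c c' /(congr1 (fun f : T => f j)); rewrite !e_mulr eqxx => /(congr1 val) /=.
by rewrite !modn_small // => /val_inj.
Qed.

(** By its size [Y] contains at most half of the lines in direction [i]; every other line is met but
    not contained, so it carries a boundary edge. A second direction guarantees at least [L]
    lines. *)
Lemma iso_all_met (Y : {set T}) i j : j != i -> (#|Y|).*2 <= #|T| ->
  (forall x, exists m, (x + e_ i *+ m)%R \in Y) -> L <= 2 * gam (G := torusG) Y.
Proof.
move=> ji Yhalf h; set g := gam _.
pose p := #|[set base i x | x : T]|; pose Yf := [set x in Y | full Y i x].
have pL : L <= p by apply: card_base_ge ji.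
have cYf : #|[set base i x | x in Yf]| * L <= #|Y|.
  have -> : #|[set base i x | x in Yf]| * L = #|setX [set base i x | x in Yf] [set: 'I_L]|.
    by rewrite cardsX cardsT card_ord.
  rewrite -(card_in_imset (f := fun q : T * 'I_L => (q.1 + e_ i *+ q.2)%R)).
    apply: subset_leq_card; apply/subsetP => _ /imsetP[[q c] hq ->].
    move: hq; rewrite in_setX => /andP[/imsetP[u uf ->] _].
    have [m e] := base_lin i u c; rewrite /= e; apply: fullP.
    by move: uf; rewrite inE => /andP[].
  move=> [q c] [q' c']; rewrite !in_setX => /andP[/imsetP[u _ ->] _] /andP[/imsetP[u' _ ->] _] /=.
  by move=> /base_add_inj[-> ->].
have cW : #|[set base i x | x in Y :\: Yf]| <= g.
  apply: card_line_exit => [|u]; first exact: subsetDl.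
  rewrite !inE => /andP[nf uY]; move: nf; rewrite uY negb_forall => /existsP[m hm].
  by exists m.
have pcov : p <= #|[set base i x | x in Yf]| + #|[set base i x | x in Y :\: Yf]|.
  apply: leq_trans (leq_card_setU _ _).1; apply: subset_leq_card.
  apply/subsetP => _ /imsetP[u _ ->]; rewrite -imsetU.
  have [m um] := h u; rewrite -(base_line i u m); apply: imset_f.
  by rewrite in_setU in_setD in_set um /=; case: (full _ _ _).
have Tp := card_base i; rewrite -/p -torus_card in Tp.
suff : 2 * #|[set base i x | x in Yf]| <= p by move: pcov cW pL; clear; lia.
rewrite -(leq_pmul2r (m := L)) //; apply: leq_trans Tp; apply: leq_trans Yhalf.
by rewrite -mulnA mul2n leq_double.
Qed.

(** If [Y] contains no full coordinate line, two projections already determine its points and each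
    has at most [g] values. Otherwise [L <= 2 * g], and [iso_global] turns this into
    [2 * L * g <= 4 * g ^ 2]. *)
Lemma iso_poly (Y : {set T}) : 2 <= d -> (#|Y|).*2 <= #|T| ->
  #|Y| <= 4 * gam (G := torusG) Y ^ 2.
Proof.
move=> d2 Yhalf; set g := gam _.
suff [h|h] : #|Y| <= g ^ 2 \/ L <= 2 * g.
- by apply: leq_trans h _; rewrite leq_pmull.
- have h1 := iso_global Y; have h2 := cardsC Y.
  have T0 : 0 < #|T| by rewrite torus_card expn_gt0.
  have h3 : #|Y| * #|T| <= #|T| * (2 * L * g).
    rewrite -/g in h1; apply: (@leq_trans ((#|Y| * #|~: Y|).*2)).
      by rewrite -mul2n mulnCA leq_mul2l -h2 mul2n -addnn leq_add2r -(leq_add2l #|Y|) addnn h2 Yhalf orbT.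
    by rewrite -mul2n -mulnA [X in _ <= X]mulnCA leq_mul2l h1 orbT.
  rewrite mulnC leq_pmul2l // in h3; apply: leq_trans h3 _.
  rewrite -mulnA (_ : 4 * g ^ 2 = 2 * ((2 * g) * g)); last by lia.
  by rewrite leq_mul2l leq_mul2r h orbT.
case: (boolP [exists i, [exists x : T, (x \in Y) && full Y i x]]); last first.
  move=> /existsPn h; left; apply: iso_no_full => // i x xY.
  by have /existsPn/(_ x) := h i; rewrite xY.
move=> /existsP[i /existsP[x /andP[xY xf]]]; right.
have [j ji] : exists j, j != i.
  have [e|ne] := eqVneq i (Ordinal (ltnW d2)); last by exists (Ordinal (ltnW d2)); rewrite eq_sym.
  by exists (Ordinal d2); rewrite e.
case: (boolP [exists z : T, [forall m : 'I_L, (z + e_ i *+ m)%R \notin Y]]).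
  move=> /existsP[z /forallP zf]; apply: leq_trans (leq_pmull _ _) => //.
  by apply: (iso_full_empty xf (z := z)) => m; rewrite e_mulr_mod.
move=> /existsPn h; apply: (iso_all_met ji) => // z.
have := h z; rewrite negb_forall => /existsP[m]; rewrite negbK => zm.
by exists m.
Qed.

Lemma iso_mid (Y : {set T}) : 2 <= d -> (#|Y|).*2 <= #|T| ->
  4 * D ^ 4 <= 2 ^ (D %/ 4) ->
  #|Y| * D <= (gam (G := torusG) Y).*2 \/ D * D <= gam (G := torusG) Y.
Proof.
move=> d2 Yhalf hD; have [small|big] := leqP #|Y| (2 ^ (D %/ 4)).
  by left; apply: iso_small.
right; have h1 := iso_poly d2 Yhalf; rewrite -(@leq_exp2r _ _ 2) //.
have : 4 * D ^ 4 < 4 * gam (G := torusG) Y ^ 2.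
  by apply: leq_ltn_trans hD _; apply: leq_trans big h1.
rewrite expnMn -expnD -[2 + 2]/4; move: (D ^ 4) (gam _ ^ 2) => u v; lia.
Qed.

(** * Mod 2 cohomology of the torus *)

Section Cohomology.
Variable f : T -> 'I_d -> bool.
Hypothesis f_closed : forall x i k,
  f x i (+) f (x + e_ i)%R k = f x k (+) f (x + e_ k)%R i.
Hypothesis f_hol : forall x i, \big[addb/false]_(m < L) f (x + e_ i *+ m)%R i = false.

Lemma hol_grad (p : T -> bool) x i :
  \big[addb/false]_(m < L) (p (x + e_ i *+ m)%R (+) p (x + e_ i *+ m + e_ i)%R) = false.
Proof.
have h n : \big[addb/false]_(m < n) (p (x + e_ i *+ m)%R (+) p (x + e_ i *+ m + e_ i)%R)
    = p x (+) p (x + e_ i *+ n)%R.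
  elim: n => [|n IH]; first by rewrite big_ord0 mulr0n addr0 addbb.
  rewrite big_ord_recr /= IH -addrA -mulrSr.
  by case: (p x); case: (p _); case: (p _).
by rewrite h e_mulrL addr0 addbb.
Qed.

(** The cochain is integrated one direction at a time. After subtracting the potential found so far,
    the rest is invariant under the earlier directions, and zero holonomy lets it be summed from the
    zero coordinate along the next direction. *)
Lemma potential_upto n : exists p : T -> bool,
  forall x (i : 'I_d), i < n -> p x (+) p (x + e_ i)%R = f x i.
Proof.
elim: n => [|n [p hp]]; first by exists xpred0.
have [nd|dn] := ltnP n d; last first.
  by exists p => x i _; apply: hp; apply: leq_trans dn.
pose k := Ordinal nd.
pose f' x i := f x i (+) (p x (+) p (x + e_ i)%R).
have f'0 x (i : 'I_d) : i < n -> f' x i = false by move=> h; rewrite /f' hp // addbb.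
have f'c x i : f' x i (+) f' (x + e_ i)%R k = f' x k (+) f' (x + e_ k)%R i.
  rewrite /f'; have := f_closed x i k; rewrite (addrAC x (e_ k) (e_ i)).
  case: (f x i); case: (f x k); case: (f _ k); case: (f _ i) => // _;
  by case: (p x); case: (p _); case: (p _); case: (p _).
have f'hol x : \big[addb/false]_(m < L) f' (x + e_ k *+ m)%R k = false.
  by rewrite big_split /= f_hol hol_grad.
have f'inv x (i : 'I_d) : i < n -> f' (x + e_ i)%R k = f' x k.
  by move=> h; have := f'c x i; rewrite (f'0 x i h) (f'0 _ i h) addbF.
pose psi (x : T) := \big[addb/false]_(m < x k) f' (base k x + e_ k *+ m)%R k.
exists (fun x => p x (+) psi x) => x i; rewrite ltnS leq_eqVlt => /orP[/eqP ik|lt].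
  have {ik} -> : i = k by apply: val_inj.
  suff hpsi : psi x (+) psi (x + e_ k)%R = f' x k.
    have -> : p x (+) psi x (+) (p (x + e_ k)%R (+) psi (x + e_ k)%R)
            = (psi x (+) psi (x + e_ k)%R) (+) (p x (+) p (x + e_ k)%R).
      by case: (p x); case: (p _); case: (psi x); case: (psi _).
    by rewrite hpsi /f' -addbA addbb addbF.
  have bx : base k (x + e_ k)%R = base k x by have := base_line k x 1; rewrite mulr1n.
  have xk : (x + e_ k)%R k = (x k).+1 %% L :> nat.
    by rewrite !ffunE eqxx /= [1 %% _]modn_small // addn1.
  rewrite /psi bx xk; have [lt|ge] := ltnP (x k).+1 L.
    rewrite modn_small // big_ord_recr /= -baseE.
    by case: (\big[_/_]_(_ < _) _); case: (f' x k).
  have e : (x k).+1 = L by apply/eqP; rewrite eqn_leq ge ltn_ord.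
  have tot : \big[addb/false]_(m < (x k).+1) f' (base k x + e_ k *+ m)%R k = false.
    by rewrite e; apply: f'hol.
  have -> : (x k).+1 %% L = 0 by rewrite e modnn.
  move: tot; rewrite big_ord_recr /= -baseE big_ord0.
  by case: (\big[_/_]_(_ < _) _); case: (f' x k).
have ik : i != k by apply: contraTneq lt => ->; rewrite /= ltnn.
have bx : base k (x + e_ i)%R = (base k x + e_ i)%R.
  by apply/ffunP => w; rewrite !ffunE; case: eqP => // ->; rewrite eq_sym (negbTE ik) addr0.
have xk : (x + e_ i)%R k = x k.
  by rewrite !ffunE eq_sym (negbTE ik) addr0.
have -> : psi (x + e_ i)%R = psi x.
  by rewrite /psi bx xk; apply: eq_bigr => m _; rewrite addrAC f'inv.
rewrite -(hp _ _ lt).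
by case: (p x); case: (p _); case: (psi x).
Qed.

Lemma potential : exists Y : {set T},
  (forall x i, (x \in Y) != ((x + e_ i)%R \in Y) = f x i) /\ (#|Y|).*2 <= #|T|.
Proof.
have [p hp] := potential_upto d; pose Y0 := [set x | p x].
have hY0 x i : (x \in Y0) != ((x + e_ i)%R \in Y0) = f x i.
  by rewrite !inE -(hp x i) //; case: (p x); case: (p _).
have [h|h] := leqP (#|Y0|).*2 #|T|; first by exists Y0.
exists (~: Y0); split.
  by move=> x i; rewrite -hY0 !in_setC; case: (x \in Y0); case: (_ \in Y0).
have := cardsC Y0; move: h; have -> : #|{: T}| = #|T| by []; move: #|T| #|Y0| #|~: Y0|.
by lia.
Qed.

End Cohomology.

(** For neighbouring parallel lines the two sums differ by the sum of a gradient around a cycle, by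
    closedness on the squares in between. *)
Lemma hol_indep (f : T -> 'I_d -> bool) i :
  (forall x k, f x i (+) f (x + e_ i)%R k = f x k (+) f (x + e_ k)%R i) ->
  forall x y, \big[addb/false]_(m < L) f (x + e_ i *+ m)%R i
            = \big[addb/false]_(m < L) f (y + e_ i *+ m)%R i.
Proof.
move=> fc; pose h x := \big[addb/false]_(m < L) f (x + e_ i *+ m)%R i.
have hk x k : h (x + e_ k)%R = h x.
  have : h x (+) h (x + e_ k)%R = false.
    rewrite /h -big_split -[RHS](hol_grad (fun z => f z k) x i) /=.
    apply: eq_bigr => m _; have := fc (x + e_ i *+ m)%R k; rewrite (addrAC x (e_ k)).
    by case: (f _ i); case: (f _ k); case: (f _ k); case: (f _ i).
  by case: (h x); case: (h _).
suff h0 (s x : T) : h (x + s)%R = h x.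
  by move=> x y; rewrite -/(h x) -/(h y) -{1}[x](subrK y) addrC h0.
move: x; rewrite (vec_sum s); apply: (big_ind (fun s : T => forall x, h (x + s)%R = h x)).
- by move=> x; rewrite addr0.
- by move=> s1 s2 h1 h2 x; rewrite addrA h2 h1.
move=> k _; elim: (s k : nat) => [|m IH] x; first by rewrite mulr0n addr0.
by rewrite mulrS addrA IH hk.
Qed.

(** The boundary edges in [C] form a closed cochain: on a square that meets [C], every boundary edge
    of [X] belongs to [C]. A nonzero holonomy in one direction is nonzero on all [L ^ d.-1] lines of
    that direction, so [C] would meet each of them. Hence a smaller cluster is the boundary of a
    set, replaced by its complement if it exceeds half. *)
Lemma cluster_fill (X C : {set vert torusG}) : C \in clusters X ->
  #|C| < L ^ d.-1 -> exists Y : {set vert torusG}, (#|Y|).*2 <= #|T| /\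
  forall (x : vert torusG) a,
    ((x \in Y) != (st x a \in Y)) = ((x \in X) != (st x a \in X)) && (x \in C).
Proof.
move=> hC small.
pose f (x : T) i := ((x \in X) != ((x + e_ i)%R \in X)) && (x \in C).
have nearC (x y : vert torusG) : x \in C -> y \in Bd X -> near 6 x y -> y \in C.
  exact: cluster_near hC.
have step1 (x : T) i : (x \in X) != ((x + e_ i)%R \in X) -> (x \in C) = ((x + e_ i)%R \in C).
  exact: (@cluster_step torusG X C x (i, true) hC).
have n1 (x : T) i : near (G := torusG) 1 x (x + e_ i)%R.
  exact: (@near1 torusG x (i, true)).
have n6 (x y : vert torusG) r : r <= 6 -> near r x y -> near 6 x y by exact: near_mono.
have key (y z : T) j : z \in C -> near (G := torusG) 6 z y ->
    f y j = ((y \in X) != ((y + e_ j)%R \in X)).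
  move=> zC nzy; apply: andb_idr => h; apply: (nearC z) => //.
  exact: (@mem_Bd torusG X y (j, true)).
have fc x i k : f x i (+) f (x + e_ i)%R k = f x k (+) f (x + e_ k)%R i.
  have nik : near (G := torusG) 6 (x + e_ i)%R (x + e_ k)%R.
    apply: (n6 _ _ 2) => //; apply: (@near_trans torusG 1 1 _ x); last exact: n1.
    by rewrite near_sym; apply: n1.
  have ni : near (G := torusG) 6 x (x + e_ i)%R by apply: (n6 _ _ 1).
  have nk : near (G := torusG) 6 x (x + e_ k)%R by apply: (n6 _ _ 1).
  have fin (z : T) : z \in C -> near (G := torusG) 6 z x ->
      near (G := torusG) 6 z (x + e_ i)%R -> near (G := torusG) 6 z (x + e_ k)%R ->
      f x i (+) f (x + e_ i)%R k = f x k (+) f (x + e_ k)%R i.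
    move=> zC h1 h2 h3; rewrite !(key _ z) // (addrAC x (e_ k)).
    by case: (x \in X); do 3 case: (_ \in X).
  have [xC|xC] := boolP (x \in C); first by apply: (fin x) => //; apply: near_refl.
  have [iC|iC] := boolP ((x + e_ i)%R \in C).
    by apply: (fin (x + e_ i)%R) => //; [rewrite near_sym | apply: near_refl].
  have [kC|kC] := boolP ((x + e_ k)%R \in C).
    by apply: (fin (x + e_ k)%R) => //; [rewrite near_sym | rewrite near_sym | apply: near_refl].
  by rewrite /f (negbTE xC) (negbTE iC) (negbTE kC) !andbF.
have fh x i : \big[addb/false]_(m < L) f (x + e_ i *+ m)%R i = false.
  apply: contraTF small => hx; rewrite -leqNgt.
  have Cm y : exists m, (y + e_ i *+ m)%R \in C.
    have : \big[addb/false]_(m < L) f (y + e_ i *+ m)%R i by rewrite (hol_indep (fun x k => fc x i k) y x).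
    move=> hy; suff /existsP[m /andP[_ h]] : [exists m : 'I_L, f (y + e_ i *+ m)%R i] by exists m.
    apply: contraLR hy => /existsPn h; rewrite big1 // => m _; apply/negbTE; exact: h.
  apply: (@leq_trans #|[set base i x | x : T]|).
    have d0 : 0 < d by apply: leq_ltn_trans (ltn_ord i).
    by have := card_base i; rewrite -{1}(prednK d0) expnSr leq_pmul2r.
  apply: leq_trans (leq_imset_card (base i) (mem C)); apply: subset_leq_card.
  apply/subsetP => _ /imsetP[y _ ->]; have [m hm] := Cm y.
  by rewrite -(base_line i y m); apply: imset_f.
have [Y [hY Yhalf]] := potential fc fh; exists Y; split=> // x [i b].
case: b; first exact: hY.
have := hY (x - e_ i)%R i; rewrite subrK /f subrK => h.
rewrite torus_step /torus_gen /= eq_sym h eq_sym [in RHS]eq_sym.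
have [//|ne] := eqVneq (x \in X) ((x - e_ i)%R \in X).
by rewrite /= (step1 (x - e_ i)%R i) subrK // eq_sym.
Qed.

Lemma ball_exit M (K : {set vert torusG}) (x : vert torusG) : M <= 'C(d, 4) ->
  x \in K -> #|K| < M -> exists2 y, y \notin K & near 4 x y.
Proof.
move=> hM xK KM; apply/exists_inP; apply: contraT => /exists_inPn h.
have inK (y : T) : near (G := torusG) 4 x y -> y \in K.
  by move=> n; apply: contraT => yK; have := h y yK; rewrite n.
pose ev (A : {set 'I_d}) : T := [ffun j => if j \in A then 1%R else 0%R].
have evU i (A : {set 'I_d}) : i \notin A -> ev (i |: A) = (ev A + e_ i)%R.
  move=> iA; apply/ffunP => j; rewrite !ffunE !inE; case: eqP => [->|_].
    by rewrite (negbTE iA) add0r.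
  by rewrite addr0.
have near_ev n (A : {set 'I_d}) : #|A| = n -> near (G := torusG) n x (x + ev A)%R.
  elim: n A => [|n IH] A cA.
    move/eqP: cA; rewrite cards_eq0 => /eqP ->; rewrite near0E; apply/eqP/ffunP => j.
    by rewrite !ffunE inE addr0.
  have /card_gt0P[i iA] : 0 < #|A| by rewrite cA.
  have cA' : #|A :\ i| = n by move: (cardsD1 i A); rewrite iA cA add1n => -[].
  rewrite -(setD1K iA) evU ?setD11 // addrA.
  exact: (@near_st' torusG n x (x + ev (A :\ i))%R (i, true) (IH _ cA')).
have : #|[set (x + ev A)%R | A in [set A : {set 'I_d} | #|A| == 4]]| <= #|K|.
  apply: subset_leq_card; apply/subsetP => _ /imsetP[A hA ->]; apply: inK.
  by apply: near_ev; move: hA; rewrite inE => /eqP.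
rewrite card_imset; last first.
  move=> A B /addrI e; apply/setP => j; have := congr1 (fun f : T => f j) e.
  by rewrite !ffunE; case: (j \in A); case: (j \in B).
by rewrite card_draws card_ord leqNgt (leq_trans KM).
Qed.

End Torus.

(** * Counting connected skeletons *)

Lemma disjoint_setU1 (T : finType) x (A B : {set T}) :
  [disjoint x |: A & B] = (x \notin B) && [disjoint A & B].
Proof. by rewrite !disjoints_subset subUset sub1set inE. Qed.

Section Animals.
Variables (T : finType) (r : rel T) (Delta : nat).
Hypothesis degr : forall x, #|[set y | r x y]| <= Delta.

Definition cut_conn (R Q : {set T}) := [forall Z : {set T},
  (R \subset Z) && (Z \proper Q) ==> [exists z in Z, [exists q in Q :\: Z, r z q]]].
Definition rim (R : {set T}) := [set y | [exists x in R, r x y]].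
(** State of an exploration: [R] holds the accepted vertices, [F] the refused ones, and [m]
    acceptances remain. *)
Definition animals (R F : {set T}) m := [set Q : {set T} |
  [&& R \subset Q, [disjoint F & Q], #|Q| == #|R| + m & cut_conn R Q]].

Lemma card_rim R : #|rim R| <= Delta * #|R|.
Proof.
have -> : rim R = \bigcup_(x in R) [set y | r x y].
  apply/setP => y; rewrite inE; apply/exists_inP/bigcupP => -[x xR h]; exists x => //.
    by rewrite inE.
  by move: h; rewrite inE.
apply: leq_trans (_ : \sum_(x in R) #|[set y | r x y]| <= _); last first.
  by rewrite mulnC -sum_nat_const; apply: leq_sum => x _; apply: degr.
elim/big_rec2: _ => [|x k A _ IH]; first by rewrite cards0.
by apply: (leq_trans (leq_card_setU _ _).1); rewrite leq_add2l.
Qed.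

Lemma rimS (A B : {set T}) : A \subset B -> rim A \subset rim B.
Proof.
move=> sAB; apply/subsetP => y; rewrite !inE => /exists_inP[x xA h].
by apply/exists_inP; exists x => //; apply: (subsetP sAB).
Qed.

Lemma cut_connS (A B Q : {set T}) : A \subset B -> cut_conn A Q -> cut_conn B Q.
Proof.
move=> sAB /forallP h; apply/forallP => Z; apply/implyP => /andP[BZ ZQ].
by have := h Z; rewrite (subset_trans sAB BZ) ZQ.
Qed.

(* Explore the rim one vertex at a time: each query is answered "in" at most
   [m] times and asked at most [Delta * (#|R| + m)] times. *)
Lemma card_animals (R F : {set T}) m b : F \subset rim R -> [disjoint F & R] ->
  b + #|F| = Delta * (#|R| + m) ->
  #|animals R F m| * Delta ^ b <= Delta.+1 ^ (m + b).
Proof.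
have [n] := ubnP #|~: (R :|: F)|; elim: n R F m b => // n IH R F m b hn FR dFR hb.
have [y|norim] := pickP (mem (rim R :\: (R :|: F))); last first.
  have h1 : #|animals R F m| <= 1.
    apply/card_le1_eqP => Q1 Q2; suff h Q : Q \in animals R F m -> Q = R.
      by move=> /h -> /h ->.
    rewrite inE => /and4P[RQ FQ _ /forallP/(_ R)]; rewrite subxx /=.
    have [|RQ' _] := boolP (R \proper Q).
      move=> _ /exists_inP[z zR /exists_inP[q]]; rewrite inE => /andP[qR qQ] zq.
      have := norim q; rewrite /= !inE (negbTE qR) /=.
      rewrite (disjointFl FQ qQ) /= => /negbT/exists_inPn/(_ z zR).
      by rewrite zq.
    by apply/esym/eqP; move: RQ'; rewrite properEneq RQ andbT negbK.
  apply: leq_trans (leq_mul h1 (leqnn _)) _; rewrite mul1n.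
  apply: leq_trans (_ : Delta.+1 ^ b <= _).
    by case: (b) => // k; rewrite leq_exp2r.
  by rewrite leq_pexp2l // leq_addl.
rewrite /= !inE negb_or -andbA => /and3P[yR yF yrim].
have yF' : #|y |: F| = #|F|.+1 by rewrite cardsU1 yF.
have FR' : y |: F \subset rim R by rewrite subUset sub1set FR inE yrim.
have cF : #|F|.+1 <= Delta * (#|R| + m).
  rewrite -yF'; apply: leq_trans (subset_leq_card FR') _.
  by apply: leq_trans (card_rim R) _; rewrite leq_mul2l leq_addr orbT.
case: b hb => [hb|b hb]; first by move: cF; rewrite -hb ltnn.
have sub0 : #|~: (R :|: (y |: F))| < n.
  have -> : R :|: (y |: F) = y |: (R :|: F) by rewrite setUCA.
  have := cardsC (R :|: F); have := cardsC (y |: (R :|: F)).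
  by rewrite cardsU1 in_setU negb_or yR yF /=; move: hn; lia.
have h2 : #|animals R (y |: F) m| * Delta ^ b <= Delta.+1 ^ (m + b).
  apply: IH => //; last by rewrite yF' addnS -addSn.
  by rewrite disjoint_setU1 yR.
have Rsub Q : Q \in animals R F m -> y \notin Q -> Q \in animals R (y |: F) m.
  rewrite !inE => /and4P[-> FQ -> ->] yQ /=; rewrite andbT.
  by rewrite disjoint_setU1 yQ.
(* When no acceptance remains, [y] can only be refused. Otherwise the two answers contribute 1 and
   [Delta] to the factor [Delta.+1]. *)
case: m hb cF h2 Rsub => [|m] hb cF h2 Rsub.
  have -> : animals R F 0 = animals R (y |: F) 0.
    apply/setP => Q; apply/idP/idP => [hQ|].
      apply: Rsub => //; move: hQ; rewrite inE addn0 => /and4P[RQ _ /eqP cQ _].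
      suff <- : R = Q by [].
      by apply/eqP; rewrite eqEcard RQ cQ /=.
    rewrite !inE => /and4P[-> FQ -> ->]; rewrite !andbT /=.
    by apply: disjointWl FQ; apply: subsetUr.
  rewrite expnSr mulnA !add0n in h2 *; rewrite expnSr.
  by apply: leq_mul.
have h1 : #|animals (y |: R) F m| * Delta ^ b.+1 <= Delta.+1 ^ (m + b.+1).
  apply: IH.
  - by rewrite -setUA setUCA.
  - by apply: subset_trans FR _; apply: rimS; apply: subsetUr.
  - by rewrite disjoint_sym disjoint_setU1 yF disjoint_sym.
  - by rewrite hb cardsU1 yR add1n addSnnS.
have sub : animals R F m.+1 \subset animals (y |: R) F m :|: animals R (y |: F) m.+1.
  apply/subsetP => Q hQ; rewrite in_setU; have [yQ|yQ] := boolP (y \in Q); last first.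
    by rewrite Rsub ?orbT.
  apply/orP; left; move: hQ; rewrite !inE => /and4P[RQ -> /eqP cQ cc] /=.
  rewrite subUset sub1set yQ RQ cQ cardsU1 yR add1n addSnnS eqxx /=.
  by apply: cut_connS cc; apply: subsetUr.
apply: leq_trans (leq_mul (subset_leq_card sub) (leqnn _)) _.
apply: leq_trans (leq_mul (leq_card_setU _ _).1 (leqnn _)) _.
rewrite mulnDl (expnSr Delta b) [X in _ + X]mulnA.
rewrite -(expnSr Delta b).
have -> : m.+1 + b.+1 = (m + b.+1).+1 by [].
rewrite [X in _ <= X]expnSr mulnS; apply: leq_add => //.
by rewrite addSnnS in h2; apply: leq_mul.
Qed.

End Animals.

Lemma cut_connP (T : finType) (r : rel T) (R Q : {set T}) :
  (forall Z : {set T}, R \subset Z -> Z \proper Q ->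
    exists z q, [/\ z \in Z, q \in Q :\: Z & r z q]) -> cut_conn r R Q.
Proof.
move=> h; apply/forallP => Z; apply/implyP => /andP[RZ ZQ].
have [z [q [zZ qZ zq]]] := h Z RZ ZQ.
by apply/exists_inP; exists z => //; apply/exists_inP; exists q.
Qed.

Lemma card_dep_pair (A B : finType) (X : {set A}) (F : A -> {set B}) n :
  (forall a, a \in X -> #|F a| <= n) ->
  #|[set p : A * B | (p.1 \in X) && (p.2 \in F p.1)]| <= #|X| * n.
Proof.
move=> h; rewrite -(sum_card_fiber (fun a b => (a \in X) && (b \in F a))).
rewrite (bigID (mem X)) /= [X in _ + X]big1 ?addn0.
  rewrite -sum_nat_const; apply: leq_sum => a aX; apply: leq_trans (h a aX).
  by apply: subset_leq_card; apply/subsetP => b; rewrite inE => /andP[].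
by move=> a /negbTE aX; apply: eq_card0 => b; rewrite inE aX.
Qed.

(** * Growth estimates on the torus *)

Lemma root_bracket k d q0 : 0 < k -> q0 ^ k <= d -> exists q, [/\ q0 <= q, q ^ k <= d & d < (q + 1) ^ k].
Proof.
move=> k0 hd; pose P q := q ^ k <= d.
have ub q : P q -> q <= d.
  move=> hq; apply: leq_trans hq; case: q => // q; rewrite -{1}[q.+1]expn1.
  by rewrite leq_pexp2l.
have exP : exists q, P q by exists q0.
case: (ex_maxnP exP ub) => q Pq hmax; exists q; split=> //; first exact: hmax.
by rewrite ltnNge; apply/negP => h; have := hmax _ h; rewrite addn1 ltnn.
Qed.

Lemma leq_block m d : 0 < m -> d <= m * 2 ^ (d %/ m).
Proof.
move=> m0; apply: leq_trans (ltnW (ltn_ceil d m0)) _.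
by rewrite mulnC leq_mul2l ltn_expl ?orbT.
Qed.

Lemma pow8_growth d : 64 <= d -> d ^ 8 <= 4 ^ (d - 2).
Proof.
move=> hd; have h := @leq_block (2 ^ 4) d isT.
have : d ^ 8 <= (2 ^ 4 * 2 ^ (d %/ 16)) ^ 8 by rewrite leq_exp2r.
move=> /leq_trans; apply; rewrite -expnD -expnM -[4]/(2 ^ 2) -expnM leq_exp2l //.
by lia.
Qed.

Lemma pow4_growth D : 200 <= D -> 4 * D ^ 4 <= 2 ^ (D %/ 4).
Proof.
move=> hD; have h := @leq_block (2 ^ 5) D isT.
have : 4 * D ^ 4 <= 2 ^ 2 * (2 ^ 5 * 2 ^ (D %/ 32)) ^ 4 by rewrite leq_mul2l leq_exp2r.
move=> /leq_trans; apply; rewrite -expnD -expnM -expnD leq_exp2l //.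
by lia.
Qed.

Lemma side_growth L d : 4 <= L -> 64 <= d -> L * d ^ 8 <= L ^ d.-1.
Proof.
move=> hL hd; have -> : d.-1 = (d - 2).+1 by lia.
rewrite [X in _ <= X]expnS leq_mul2l; apply/orP; right; apply: leq_trans (pow8_growth hd) _.
by rewrite leq_exp2r //; lia.
Qed.

Lemma bin4_growth d : 8 <= d -> 4 * d <= 'C(d, 4).
Proof.
move=> hd; rewrite -(@leq_pmul2r 4`!) // bin_ffact.
have -> : d = (d - 4).+4 by lia.
rewrite !ffactnS ffactn0 /=; set e := d - 4; have : 4 <= e by rewrite /e; lia.
by clearbody e; clear; move=> he; rewrite -[4`!]/24; nia.
Qed.

Section TorusFacts.
Variables (d l : nat).
Hypothesis l_gt0 : 0 < l.
Hypothesis l_even : ~~ odd l.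
Hypothesis d200 : 200 <= d.
Local Notation L := l.+2.
Local Notation G := (torusG d l_gt0 l_even).
Local Notation T := (vert G).
Local Notation D := #|dir G|.

Lemma torus_adjE (u v : T) : @torus_adj L d u v = [exists a, st u a == v].
Proof.
rewrite /torus_adj; apply/existsP/existsP => [[i /andP[/forallP h1 h2]]|[[i b] /eqP <-]].
  have off j : j != i -> (u : {ffun 'I_d -> 'I_L}) j = (v : {ffun _ -> _}) j.
    by move=> ji; have := h1 j; rewrite (negbTE ji) eqbF_neg negbK => /eqP.
  have step (x y : {ffun 'I_d -> 'I_L}) : (forall j, j != i -> x j = y j) ->
      (x i).+1 = y i %[mod L] -> y = (x + torus_gen l (i, true))%R.
    move=> hoff hi; apply/ffunP => j; rewrite ffunE.
    have [->|ji] := eqVneq j i; last by rewrite torus_gen0 // GRing.addr0 hoff.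
    rewrite torus_gen1; apply: val_inj => /=.
    by rewrite modnDmr addn1 hi modn_small.
  move: h2 => /orP[/eqP h2|/eqP h2].
    by exists (i, true); rewrite torus_step -(step _ _ off h2).
  exists (i, false); rewrite torus_step.
  have -> : torus_gen l (i, false) = (- torus_gen l (i, true))%R :> {ffun 'I_d -> 'I_L} by rewrite -torus_gen_op.
  rewrite [X in (X + _)%R](step v u _ h2) ?GRing.addrK // => j ji; exact/esym/off.
exists i; rewrite torus_step; apply/andP; split.
  apply/forallP => j; rewrite ffunE; have [->|ji] := eqVneq j i; last first.
    by rewrite torus_gen0 // GRing.addr0 eqxx.
  rewrite torus_gen1 eqb_id eq_sym -GRing.subr_eq0 GRing.addrAC GRing.subrr GRing.add0r.
  by case: b; rewrite // GRing.oppr_eq0.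
rewrite ffunE torus_gen1; case: b; apply/orP; [left|right].
  by rewrite /= modnDmr addn1 modn_mod.
set x := (u : {ffun 'I_d -> 'I_L}) i.
have <- : ((x - 1) + 1)%R = x by rewrite GRing.subrK.
by rewrite GRing.addrK /= modnDmr addn1 modn_mod.
Qed.

Lemma torus_isoA (K : {set T}) : #|K| < 2 * D -> #|K| * D <= (gam K).*2.
Proof.
move=> hK; apply: iso_small; apply: leq_trans (ltnW hK) _.
apply: leq_trans (pow4_growth _); rewrite torus_deg; last by lia.
by apply: leq_mul => //; rewrite -[X in X <= _]expn1 leq_pexp2l //; lia.
Qed.

Lemma torus_isoB (K : {set T}) : 2 * D <= #|K| -> (#|K|).*2 <= #|T| -> D * D <= gam K.
Proof.
move=> hK h2; have [||h|//] := @iso_mid d l l_gt0 l_even K _ h2; first by lia.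
  by apply: pow4_growth; rewrite torus_deg; lia.
have : 2 * D * D <= #|K| * D by rewrite leq_mul2r hK orbT.
by move=> /leq_trans/(_ h); rewrite -mul2n -mulnA leq_pmul2l.
Qed.

Lemma torus_ball (K : {set T}) x : x \in K -> #|K| < 2 * D -> exists2 y, y \notin K & near 4 x y.
Proof.
apply: ball_exit; apply: leq_trans (bin4_growth _); last by lia.
by rewrite torus_deg; lia.
Qed.

Lemma torus_fill (X C : {set T}) : closed X -> C \in clusters X -> cgam X C < L ^ d.-1 ->
  exists Y : {set T}, [/\ forall x a,
     ((x \in Y) != (st x a \in Y)) = ((x \in X) != (st x a \in X)) && (x \in C),
     #|Y| <= 4 * gam Y ^ 2 & D * D <= (gam Y).*2].
Proof.
move=> clX hC small.
have cC : #|C| <= cgam X C.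
  rewrite -[#|C|]muln1; apply: leq_sum_card => x xC.
  by have := subsetP (cluster_sub hC) x xC; rewrite inE.
have [Y [Y2 hY]] := cluster_fill hC (leq_ltn_trans cC small).
have d2 : 2 <= d by lia.
exists Y; split=> //; first exact: iso_poly.
have DY := fill_card clX hC hY.
have [||h|h] := @iso_mid d l l_gt0 l_even Y _ Y2 => //.
- by apply: pow4_growth; rewrite torus_deg; lia.
- by apply: leq_trans h; rewrite leq_mul2r DY orbT.
by apply: leq_trans h _; rewrite -addnn leq_addr.
Qed.

Lemma torus_iso (Y : {set T}) : #|Y| * #|~: Y| <= #|T| * (L * gam Y).
Proof. exact: iso_global. Qed.

End TorusFacts.

(** * Counting codes *)

Import Order.TTheory GRing.Theory Num.Theory.
Local Open Scope ring_scope.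

Lemma sum_subsets (R : comNzRingType) (T : finType) (C : {set T}) (x : R) :
  \sum_(Y : {set T} | Y \subset C) x ^+ #|Y| = (1 + x) ^+ #|C|.
Proof.
transitivity (\prod_i ((if i \in C then x else 0) + 1)); last first.
  rewrite -prodr_const [RHS]big_mkcond /=; apply: eq_bigr => i _.
  by case: ifP; rewrite ?add0r // addrC.
rewrite bigA_distr big_mkcond /=; apply: eq_bigr => Y _.
case: ifP => [/subsetP YC|/negbT/subsetPn[i iY iC]].
  rewrite -prodr_const big_mkcond /=; apply: eq_bigr => i _.
  by case: ifP => // /YC ->.
by rewrite (bigD1 i) //= iY (negbTE iC) mul0r.
Qed.

Section Counting.
Variable R : realType.

Lemma exp1D_le (x : R) n : 0 <= x -> (1 + x) ^+ n <= expR (n%:R * x).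
Proof.
by move=> x0; rewrite expRM_natl lerXn2r ?nnegrE ?expR_ge0 ?addr_ge0 // expR_ge1Dx.
Qed.

(** Chernoff bound: each subset of size at most [k] has weight at least [x ^+ k] in the expansion of
    [(1 + x) ^+ #|C|], with [x = expR (- y)]. *)
Lemma card_subsets_le (T : finType) (C : {set T}) k (y : R) : 0 <= y ->
  #|[set Y : {set T} | (Y \subset C) && (#|Y| <= k)%N]|%:R
    <= expR (#|C|%:R * expR (- y) + y * k%:R).
Proof.
move=> y0; rewrite expRD; set x := expR (- y).
have x0 : 0 <= x by apply: expR_ge0.
have x1 : x <= 1 by rewrite expR_le1 oppr_le0.
apply: le_trans (ler_wpM2r (expR_ge0 _) (exp1D_le _ x0)).
have -> : expR (y * k%:R) = x ^- k.
  by rewrite /x -expRM_natl -expRN mulrN opprK mulrC.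
rewrite ler_pdivlMr ?exprn_gt0 ?expR_gt0 // -sum_subsets -sum1_card natr_sum mulr_suml.
rewrite [leRHS](bigID (fun Y : {set T} => (#|Y| <= k)%N)) /=.
apply: ler_wpDr; first by apply: sumr_ge0 => Y _; apply: exprn_ge0.
rewrite (eq_bigl (fun Y : {set T} => (Y \subset C) && (#|Y| <= k)%N)); last by move=> Y; rewrite inE.
by apply: ler_sum => Y /andP[_ Yk]; rewrite mul1r ler_wiXn2l.
Qed.

(** The bound [(e N / k)^k], from a single term of [(1 + k / N)^N]. *)
Lemma bin_le_exp N k : (0 < k)%N -> (0 < N)%N ->
  'C(N, k)%:R <= expR (k%:R * (1 + ln (N%:R / k%:R))) :> R.
Proof.
move=> k0 N0; pose x : R := k%:R / N%:R.
have x0 : 0 < x by rewrite divr_gt0 // ltr0n.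
have Nk0 : 0 < N%:R / k%:R :> R by rewrite divr_gt0 // ltr0n.
rewrite mulrDr mulr1 expRD [expR (k%:R * ln _)]expRM_natl lnK ?posrE //.
have -> : N%:R / k%:R = x^-1 by rewrite /x invf_div.
rewrite exprVn ler_pdivlMr ?exprn_gt0 //.
have <- : N%:R * x = k%:R by rewrite /x mulrC divfK // pnatr_eq0 -lt0n.
apply: le_trans (exp1D_le _ (ltW x0)).
have [kN|Nk] := leqP k N; last by rewrite bin_small // mul0r exprn_ge0 // addr_ge0 // ltW.
rewrite exprDn (bigD1 (Ordinal (n := N.+1) (m := k) kN)) //=.
rewrite expr1n mul1r mulr_natl lerDl.
by apply: sumr_ge0 => i _; rewrite mulrn_wge0 // expr1n mul1r exprn_ge0 // ltW.
Qed.

Section Codes.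
Variable G : cayley.
Local Notation T := (vert G).
Local Notation D := #|dir G|.
Variables (M n k : nat) (l : R).
Hypothesis D0 : (0 < D)%N.
Hypothesis n0 : (0 < n)%N.
Hypothesis l1 : 1 <= l.
Hypothesis Dl : D.+1%:R <= expR l.
Hypothesis isoB : forall K : {set T}, (M <= #|K|)%N -> ((#|K|).*2 <= #|T|)%N -> (D * D <= gam K)%N.

Definition rooted (Q : {set T}) :=
  [exists R : {set T}, [&& R \subset Q, #|R| == k & cut_conn (near 12) R Q]].
Definition skels := [set Q : {set T} | (#|Q| <= n)%N && rooted Q].
Definition codes := [set c : code G | valid_code M n c && rooted (skel c)].

Local Notation Delta := (D.+1 ^ 12)%N.

Lemma card_animals_le (A : {set T}) m : #|A| = k -> (k + m <= n)%N ->
  #|animals (near (G := G) 12) A set0 m|%:R <= expR ((2 + 12 * l) * n%:R).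
Proof.
move=> cA kmn.
have D1 : 0 < Delta%:R :> R by rewrite ltr0n expn_gt0.
have := @card_animals _ (near (G := G) 12) Delta (@card_near G 12) A set0 m (Delta * (k + m))%N.
rewrite sub0set cards0 addn0 cA => /(_ isT).
have d0 : [disjoint set0 & A] by rewrite disjoints_subset sub0set.
move=> /(_ d0 erefl); rewrite -(ler_nat R) natrM natrX [X in _ <= X]natrX => h.
have {h} : #|animals (near (G := G) 12) A set0 m|%:R <=
    Delta.+1%:R ^+ m * (Delta.+1%:R / Delta%:R) ^+ (Delta * (k + m)) :> R.
  rewrite expr_div_n mulrA -exprD ler_pdivlMr ?exprn_gt0 //.
move=> /le_trans; apply.
have hD : Delta.+1%:R <= expR (1 + 12 * l) :> R.
  apply: (@le_trans _ _ (2 * Delta%:R)).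
    by rewrite -natrM ler_nat mul2n -addnn -addn1 leq_add2l expn_gt0.
  rewrite expRD ler_pM ?ler0n //.
    by apply: le_trans (expR_ge1Dx _); rewrite -[2]/(1 + 1).
  by rewrite natrX expRM_natl lerXn2r ?nnegrE ?ler0n ?expR_ge0.
have mn : m%:R <= n%:R :> R by rewrite ler_nat (leq_trans _ kmn) ?leq_addl.
have jn : (k + m)%:R <= n%:R :> R by rewrite ler_nat.
have n0' : 0 <= n%:R :> R by rewrite ler0n.
apply: (@le_trans _ _ (expR ((1 + 12 * l) * m%:R) * expR (k + m)%:R)).
  apply: ler_pM.
  - by rewrite exprn_ge0 // ler0n.
  - by rewrite exprn_ge0 // divr_ge0 ?ler0n.
  - by rewrite expRM_natr lerXn2r ?nnegrE ?ler0n ?expR_ge0.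
  have -> : Delta.+1%:R / Delta%:R = 1 + Delta%:R^-1 :> R.
    by rewrite -natr1 mulrDl mul1r divff // gt_eqF.
  apply: le_trans (exp1D_le _ _) _; first by rewrite invr_ge0 ltW.
  by rewrite ler_expR natrM mulrAC divff ?mul1r // gt_eqF.
rewrite -expRD ler_expR.
have l0 : 0 <= 1 + 12 * l by have := l1; lra.
have := ler_wpM2l l0 mn; lra.
Qed.

Lemma card_skels : #|skels|%:R <= 'C(#|T|, k)%:R * expR ((3 + 12 * l) * n%:R).
Proof.
pose roots := [set A : {set T} | #|A| == k].
have sub : skels \subset \bigcup_(A in roots) \bigcup_(m < n.+1 | (k + m <= n)%N) animals (near (G := G) 12) A set0 m.
  apply/subsetP => Q; rewrite inE => /andP[Qn /existsP[A /and3P[AQ /eqP cA cc]]].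
  apply/bigcupP; exists A; first by rewrite inE cA.
  have kQ : (k <= #|Q|)%N by rewrite -cA subset_leq_card.
  have hm : (#|Q| - k < n.+1)%N by rewrite ltnS (leq_trans _ Qn) // leq_subr.
  apply/bigcupP; exists (Ordinal hm); first by rewrite /= subnKC.
  by rewrite inE AQ disjoints_subset sub0set /= cA subnKC // eqxx.
have card_bigcup (I : finType) (P : pred I) (F : I -> {set {set T}}) :
    (#|\bigcup_(i | P i) F i| <= \sum_(i | P i) #|F i|)%N.
  elim/big_rec2: _ => [|i a A _ IH]; first by rewrite cards0.
  by apply: (leq_trans (leq_card_setU _ _).1); rewrite leq_add2l.
apply: (@le_trans _ _ (\sum_(A in roots) \sum_(m < n.+1 | (k + m <= n)%N)
    #|animals (near (G := G) 12) A set0 m|)%:R).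
  rewrite ler_nat; apply: leq_trans (subset_leq_card sub) _.
  by apply: leq_trans (card_bigcup _ _ _) _; apply: leq_sum => A _; apply: card_bigcup.
rewrite natr_sum.
apply: (@le_trans _ _ (\sum_(A in roots) n.+1%:R * expR ((2 + 12 * l) * n%:R))).
  apply: ler_sum => A; rewrite inE => /eqP cA; rewrite natr_sum.
  apply: (@le_trans _ _ (\sum_(m < n.+1) expR ((2 + 12 * l) * n%:R))).
    rewrite big_mkcond /=; apply: ler_sum => m _; case: ifP => [h|_]; last exact: expR_ge0.
    exact: card_animals_le.
  by rewrite sumr_const card_ord -[leLHS]mulr_natl.
rewrite sumr_const card_draws -[leLHS]mulr_natl ler_wpM2l ?ler0n //.
rewrite (_ : (3 + 12 * l) * n%:R = n%:R + (2 + 12 * l) * n%:R); last by lra.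
rewrite expRD ler_wpM2r ?expR_ge0 //.
by rewrite -natr1 addrC expR_ge1Dx.
Qed.

Definition near_subsets (Q : {set T}) j :=
  [set Y : {set T} | (Y \subset ball_around 6 Q) && (#|Y| <= j)%N].

Lemma card_near_subsets (Q : {set T}) j : (#|Q| <= n)%N ->
  #|near_subsets Q j|%:R <= expR (n%:R + 6 * l * j%:R).
Proof.
move=> Qn; apply: le_trans (card_subsets_le _ _ (y := 6 * l) _) _; first by have := l1; lra.
rewrite ler_expR lerD2r expRN ler_pdivrMr ?expR_gt0 //.
apply: (@le_trans _ _ (D.+1 ^ 6 * n)%N%:R).
  rewrite ler_nat; apply: leq_trans (card_ball_around _ _) _.
  by rewrite leq_mul2l Qn orbT.
rewrite natrM mulrC ler_wpM2l ?ler0n // natrX expRM_natl lerXn2r ?nnegrE ?ler0n ?expR_ge0 //.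
Qed.

(** The roots account for the binomial. In the exponent, the skeleton gives 12 and the four
    correction sets give [4 * 6 * 32 = 768]; the rest of 800 covers the components and lower
    terms. *)
Lemma card_codes : #|codes|%:R <= 'C(#|T|, k)%:R * expR (800 * l * n%:R).
Proof.
pose YY Q := setX (near_subsets Q (32 * n)) (near_subsets Q (32 * n)).
pose X2 := [set q : {set T} * {set {set T}} | (q.1 \in skels) &&
   (q.2 \in powerset (large_comps M (nbs q.1)))].
pose X1 := [set q : {set T} * {set {set T}} * ({set T} * {set T}) |
   (q.1 \in X2) && (q.2 \in YY q.1.1)].
pose X0 := [set c : code G | (c.1 \in X1) && (c.2 \in YY c.1.1.1)].
have sub : codes \subset X0.
  apply/subsetP => -[[[Q B] [Y1 Y2]] [Y3 Y4]].
  rewrite !in_set /valid_code /skel /compo /set1 /set2 /set3 /set4 /= andbT.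
  move=> /andP[/and3P[Qn BQ /and4P[/andP[a1 b1] /andP[a2 b2] /andP[a3 b3] /andP[a4 b4]]] rt].
  by rewrite Qn rt BQ a1 b1 a2 b2 a3 b3 a4 b4.
pose S : R := expR (n%:R + 6 * l * (32 * n)%:R).
have cY (Q : {set T}) : (#|Q| <= n)%N -> #|YY Q|%:R <= S ^+ 2.
  move=> Qn; rewrite cardsX natrM expr2; apply: ler_pM; rewrite ?ler0n //;
  exact: card_near_subsets.
have cX2 : #|X2|%:R <= #|skels|%:R * 2 ^+ n.+1 :> R.
  rewrite -natrX -natrM ler_nat.
  apply: (card_dep_pair (F := fun Q => powerset (large_comps M (nbs Q)))) => Q.
  rewrite inE => /andP[Qn _]; rewrite card_powerset leq_exp2l //.
  rewrite -(leq_pmul2r D0); apply: leq_trans (card_large_comps isoB _ D0) _.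
  by rewrite mulSn addnC leq_add2l (leq_trans (card_nbs _)) // mulnC leq_mul2r Qn orbT.
have trn (m : nat) (z : R) : m%:R <= z -> (m <= Num.truncn z)%N.
  by move=> h; rewrite Num.Theory.truncn_ge_nat // (le_trans _ h) ?ler0n.
have trn' (z : R) : 0 <= z -> (Num.truncn z)%:R <= z.
  by move=> h; rewrite Num.Theory.truncn_le.
have S2 : 0 <= S ^+ 2 by rewrite exprn_ge0 // expR_ge0.
have cX1 : #|X1|%:R <= #|X2|%:R * S ^+ 2.
  apply: (@le_trans _ _ (#|X2| * Num.truncn (S ^+ 2))%N%:R).
    rewrite ler_nat; apply: (card_dep_pair (F := fun q => YY q.1)) => q.
    by rewrite inE => /andP[]; rewrite inE => /andP[Qn _] _; apply: trn; apply: cY.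
  by rewrite natrM ler_wpM2l ?ler0n // trn'.
have cX0 : #|X0|%:R <= #|X1|%:R * S ^+ 2.
  apply: (@le_trans _ _ (#|X1| * Num.truncn (S ^+ 2))%N%:R).
    rewrite ler_nat; apply: (card_dep_pair (F := fun q => YY q.1.1)) => q.
    rewrite inE => /andP[]; rewrite inE => /andP[]; rewrite inE => /andP[Qn _] _ _.
    by apply: trn; apply: cY.
  by rewrite natrM ler_wpM2l ?ler0n // trn'.
apply: (@le_trans _ _ #|X0|%:R); first by rewrite ler_nat subset_leq_card.
apply: le_trans cX0 _.
apply: (@le_trans _ _ (#|skels|%:R * 2 ^+ n.+1 * S ^+ 2 * S ^+ 2)).
  by apply: ler_wpM2r => //; apply: le_trans cX1 _; apply: ler_wpM2r.
have c2 : 2 ^+ n.+1 <= expR n.+1%:R :> R.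
  rewrite -[n.+1%:R]mulr1 expRM_natl lerXn2r ?nnegrE ?ler0n ?expR_ge0 //.
  by apply: le_trans (expR_ge1Dx _); rewrite -[2]/(1 + 1).
apply: (@le_trans _ _ ('C(#|T|, k)%:R * expR ((3 + 12 * l) * n%:R) * expR n.+1%:R * S ^+ 2 * S ^+ 2)).
  do 2 apply: ler_wpM2r => //; apply: ler_pM; rewrite ?ler0n ?exprn_ge0 //.
  exact: card_skels.
rewrite -!mulrA ler_wpM2l ?ler0n // /S -!expRM_natl -!expRD ler_expR natrM.
have n1 : 1 <= n%:R :> R by rewrite ler1n.
rewrite -[n.+1%:R]natr1; move: n%:R n1 => m m1.
have := ler_wpM2r (le_trans ler01 m1) l1; rewrite mul1r => h.
by lra.
Qed.

End Codes.

End Counting.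

(** * Greedy filling *)

Section Greedy.
Variable R : realType.
Variable G : cayley.
Local Notation T := (vert G).
Local Notation D := #|dir G|.
Local Notation N := #|T|.
Variables (eps A V : R) (Lb : nat).
Hypothesis D0 : (0 < D)%N.
Hypothesis eps0 : 0 < eps.
Hypothesis A0 : 0 <= A.
Hypothesis fillable : forall X C : {set T}, closed X -> C \in clusters X -> (cgam X C < Lb)%N ->
  exists Y : {set T}, [/\ forall x a,
     ((x \in Y) != (st x a \in Y)) = ((x \in X) != (st x a \in X)) && (x \in C),
     (#|Y| <= 4 * gam Y ^ 2)%N & (D * D <= (gam Y).*2)%N].
Hypothesis hLb : 2 * (1 + ln N%:R) <= eps * Lb%:R.
Hypothesis hw : forall w : R, eps * (D * D)%:R <= 2 * w ->
  4 * w ^+ 2 <= eps ^+ 2 * (A / 2 * expR ((w - 1) / 2)).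

Definition few_clusters (X : {set T}) := 'C(N, #|clusters X|)%:R <= expR (eps * (gam X)%:R) :> R.

Lemma small_cluster (X : {set T}) : (0 < #|clusters X|)%N ->
  exists2 C, C \in clusters X & (#|clusters X| * cgam X C <= (gam X).*2)%N.
Proof.
move=> /card_gt0P[C0 hC0].
have [C hC hmin] := @arg_minnP _ C0 (mem (clusters X)) (cgam X) hC0.
exists C => //; rewrite -sum_cgam -sum_nat_const; exact: leq_sum.
Qed.

(** With too many clusters the smallest one has boundary below [2 * w / eps], where
    [w = 1 + ln (N / k)]. It is therefore fillable, and the filling has at most [(2 * w / eps)^2]
    vertices. As a fillable cluster has boundary at least [D * D], [w] is large, and by [hw] the
    exponential [E], which is [sqrt (N / k)], dominates this square. *)
Lemma greedy_step (X : {set T}) : closed X -> ~~ few_clusters X ->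
  V + A * Num.sqrt (N%:R * #|clusters X|%:R) <= #|X|%:R ->
  V + A * Num.sqrt (N%:R * #|clusters X|%:R) <= #|~: X|%:R ->
  exists X' : {set T}, [/\ agrees X X', (#|clusters X'| < #|clusters X|)%N,
    V + A * Num.sqrt (N%:R * #|clusters X'|%:R) <= #|X'|%:R &
    V + A * Num.sqrt (N%:R * #|clusters X'|%:R) <= #|~: X'|%:R].
Proof.
rewrite /few_clusters -ltNge; set k := #|clusters X| => clX bad hX hX'.
have k0 : (0 < k)%N.
  rewrite lt0n; apply/negP => /eqP k0; move: bad; rewrite k0 bin0 ltNge => /negP; apply.
  by rewrite -expR0 ler_expR mulr_ge0 ?ler0n // ltW.
have kN : (k <= N)%N.
  rewrite leqNgt; apply/negP => Nk; move: bad; rewrite bin_small // ltNge => /negP; apply.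
  exact: expR_ge0.
have N0 : (0 < N)%N := leq_trans k0 kN.
pose w : R := 1 + ln (N%:R / k%:R).
have kR : 0 < k%:R :> R by rewrite ltr0n.
have NR : 0 < N%:R :> R by rewrite ltr0n.
have kw : eps * (gam X)%:R < k%:R * w.
  by rewrite -ltr_expR; apply: lt_le_trans bad _; apply: bin_le_exp.
have wN : w <= 1 + ln N%:R.
  rewrite lerD2l ler_ln ?posrE ?divr_gt0 // ler_pdivrMr //.
  by rewrite ler_peMr ?ler1n // ltW.
have [C hC hk] := small_cluster k0.
have cw : eps * (cgam X C)%:R < 2 * w.
  rewrite -(ltr_pM2l kR) mulrCA -natrM.
  apply: (@le_lt_trans _ _ (eps * (gam X).*2%:R)); first by rewrite ler_pM2l // ler_nat.
  by rewrite -mul2n natrM mulrCA [X in _ < X]mulrCA ltr_pM2l // ltr0n.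
have cL : (cgam X C < Lb)%N.
  rewrite -(ltr_nat R) -(ltr_pM2l eps0); apply: lt_le_trans cw _.
  by apply: le_trans hLb; rewrite ler_pM2l.
have [Y [hY cY gY]] := fillable clX hC cL.
have g2 := fill_gam hY.
have [X' [agr lt1 b1 b2]] := fill_exists hC hY.
pose E : R := expR ((w - 1) / 2).
have E0 : 0 < E by apply: expR_gt0.
have E2 : k%:R * E ^+ 2 = N%:R.
  rewrite /E -expRM_natl mulrC (_ : 2%:R * _ = w - 1); last by lra.
  by rewrite /w addrC addKr lnK ?posrE ?divr_gt0 // divfK // gt_eqF.
have Y2 : #|Y|%:R <= A / 2 * E.
  rewrite -(ler_pM2l (exprn_gt0 2 eps0)); apply: le_trans (hw _); last first.
    apply: ltW; apply: le_lt_trans cw; rewrite ler_pM2l // ler_nat.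
    by rewrite -g2.
  apply: (@le_trans _ _ (eps ^+ 2 * ((cgam X C)%:R ^+ 2))).
    rewrite ler_pM2l ?exprn_gt0 // -natrX ler_nat; apply: leq_trans cY _.
    by rewrite -g2 -mul2n expnMn.
  rewrite -exprMn (_ : 4 * w ^+ 2 = (2 * w) ^+ 2); last by ring.
  have e0 : 0 <= eps * (cgam X C)%:R by rewrite mulr_ge0 ?ler0n // ltW.
  by rewrite lerXn2r ?nnegrE ?(le_trans e0) ?(ltW cw).
have sk : Num.sqrt (N%:R * k%:R) = k%:R * E.
  rewrite -E2 (_ : k%:R * E ^+ 2 * k%:R = (k%:R * E) ^+ 2); last by ring.
  by rewrite sqrtr_sqr ger0_norm // mulr_ge0 ?ler0n // ltW.
(* From [k * (k - 1) <= (k - 1/2)^2]: losing one cluster frees at least [A / 2 * E] of the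
   budget. *)
have sk' : Num.sqrt (N%:R * #|clusters X'|%:R) <= (k%:R - 2^-1) * E.
  have k1 : 1 <= k%:R :> R by rewrite ler1n.
  have -> : (k%:R - 2^-1) * E = Num.sqrt (((k%:R - 2^-1) * E) ^+ 2).
    by rewrite sqrtr_sqr ger0_norm // mulr_ge0 // ?ltW //; lra.
  apply: ler_wsqrtr; apply: (@le_trans _ _ (N%:R * (k%:R - 1))).
    by rewrite ler_pM2l // lerBrDr natr1 ler_nat.
  rewrite -E2 exprMn mulrAC ler_wpM2r ?exprn_ge0 ?ltW //.
  rewrite (_ : (k%:R - 2^-1) ^+ 2 = k%:R * (k%:R - 1) + 4^-1); last by field.
  by rewrite ltrDl invr_gt0 ltr0n.
have key (Z Z' : {set T}) : V + A * Num.sqrt (N%:R * k%:R) <= #|Z|%:R -> (#|Z| <= #|Z'| + #|Y|)%N ->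
    V + A * Num.sqrt (N%:R * #|clusters X'|%:R) <= #|Z'|%:R.
  move=> h; rewrite -(ler_nat R) natrD => h'.
  have := ler_wpM2l A0 sk'; move: h h' Y2; rewrite sk.
  rewrite (_ : A * ((k%:R - 2^-1) * E) = A * (k%:R * E) - A / 2 * E); last by field.
  lra.
by exists X'; split => //; [apply: key b1|apply: key b2].
Qed.

(* [A * sqrt (N * k)] pays for filling [k] clusters one by one: with [k] left,
   the next one costs at most [A / 2 * sqrt (N / k)]. *)
Lemma greedy_fill (X : {set T}) : closed X ->
  V + A * Num.sqrt (N%:R * #|clusters X|%:R) <= #|X|%:R ->
  V + A * Num.sqrt (N%:R * #|clusters X|%:R) <= #|~: X|%:R ->
  exists X' : {set T}, [/\ agrees X X', few_clusters X', V <= #|X'|%:R & V <= #|~: X'|%:R].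
Proof.
have [n] := ubnP #|clusters X|; elim: n X => // n IH X kn clX h1 h2.
have [good|bad] := boolP (few_clusters X).
  have s0 : 0 <= A * Num.sqrt (N%:R * #|clusters X|%:R) by rewrite mulr_ge0 ?sqrtr_ge0.
  exists X; split => //.
    by apply: le_trans h1; rewrite lerDl.
  by apply: le_trans h2; rewrite lerDl.
have [X1 [agr lt1 b1 b2]] := greedy_step clX bad h1 h2.
have [|X' [agr' good c1 c2]] := IH X1 (leq_trans lt1 _) (agrees_closed D0 clX agr) b1 b2.
  by rewrite -ltnS.
by exists X'; split => //; apply: agrees_trans agr agr'.
Qed.

End Greedy.

(** * Shifting an independent set inside a contour *)

Section Shift.
Variable G : cayley.
Local Notation T := (vert G).

Definition ind (I : {set T}) := [forall x in I, forall a, st x a \notin I].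

Lemma indP (I : {set T}) : reflect (forall x a, x \in I -> st x a \notin I) (ind I).
Proof.
apply: (iffP forall_inP) => [h x a xI|h x xI]; first by have /forallP := h x xI; apply.
by apply/forallP => a; apply: h.
Qed.

Variable a0 : dir G.
Local Notation sh x := (st x a0).
Local Notation bk x := (st x (op a0)).
Variables F S : {set T}.
Hypothesis S_even : forall u, u \in S -> ~~ par u.
Hypothesis S_nbr : forall u, u \in S -> exists a, st u a \in F.

(** [deep] depends on the code only, not on the region. Occupied deep vertices can be read off after
    the shift; occupation on the rest of [S] is lost and recorded separately. An odd vertex of the
    region not reached from [deep] is free for an arbitrary choice [B]. *)
Definition deep := [set u in S | sh u \in F].
Definition freed (X : {set T}) := [set v in X | par v & bk v \notin deep].
Definition shifted (X I B : {set T}) :=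
  [set x | if x \in X then if x \in freed X then x \in B else bk x \in I else x \in I].

(* [X] is the filled even region of [I], approximated by [F] from inside on
   the odd side and by [S] from outside on the even side. *)
Definition compatible (X I : {set T}) := [/\ [/\ ind I, closed X, F \subset odds X & evens X \subset S],
  (forall u a, (u \in X) != (st u a \in X) -> u \notin I) &
  (forall v a b, v \in odds X -> (v \in Bd X) || (v \notin F) -> st v a \in X -> st (st v a) b \notin I)].

Section One.
Variables X I B : {set T}.
Hypothesis cXI : compatible X I.
Hypothesis BX : B \subset freed X.
Local Notation J := (shifted X I B).

Let indI : ind I. Proof. by have [[]] := cXI. Qed.
Let clX : closed X. Proof. by have [[]] := cXI. Qed.
Let FX : F \subset odds X. Proof. by have [[]] := cXI. Qed.
Let XS : evens X \subset S. Proof. by have [[]] := cXI. Qed.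
Let edge u a : (u \in X) != (st u a \in X) -> u \notin I. Proof. by have [_ h _] := cXI; apply: h. Qed.

Lemma freed_out v : v \in freed X -> (v \in Bd X) || (v \notin F).
Proof.
rewrite inE => /and3P[vX pv]; rewrite inE stKV negb_and => /orP[vS|->]; last by rewrite orbT.
rewrite (@mem_Bd _ _ _ (op a0)) // vX /=; apply: contra vS => /eqP bX.
by apply: (subsetP XS); rewrite inE -bX parS pv.
Qed.

Lemma occupied_S u : u \in I -> u \in S -> u \in X.
Proof.
move=> uI uS; have [a aF] := S_nbr uS; apply: contraLR uI => uX; apply: (@edge _ a).
by rewrite (negbTE uX); have := subsetP FX _ aF; rewrite inE => /andP[->].
Qed.

(** The delicate pair is a chosen freed vertex and an even neighbour in [X], occupied after the
    shift if the vertex one step behind it was occupied. That vertex is two steps from the freed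
    one, and the last clause of [compatible] excludes it. *)
Lemma shifted_ind : ind J.
Proof.
apply/indP => x a xJ; apply/negP => yJ.
have oe v b : par v -> v \in X -> v \in J -> st v b \in X -> st v b \in J -> False.
  move=> pv vX vJ uX uJ.
  have uF : st v b \notin freed X by rewrite inE parS pv andbF.
  move: uJ; rewrite inE uX (negbTE uF) => uI.
  move: vJ; rewrite inE vX; case: ifP => [vF _|_ vI].
    have [_ _ h] := cXI; move: uI; apply/negP; apply: h => //; last exact: freed_out.
    by rewrite inE vX.
  by move: uI; rewrite stC; apply/negP; apply: (indP _ indI).
have eo v b : v \in X -> st v b \notin X -> st v b \in J -> False.
  move=> vX uX; rewrite inE (negbTE uX) => uI; move: uI; apply/negP.
  by apply: (@edge _ (op b)); rewrite stK vX (negbTE uX).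
have [xX|xX] := boolP (x \in X); have [yX|yX] := boolP (st x a \in X).
- case px: (par x); first exact: (@oe x a).
  apply: (@oe (st x a) (op a)); rewrite ?stK ?parS ?px //.
- exact: (@eo x a).
- by apply: (@eo (st x a) (op a)); rewrite ?stK.
- move: xJ yJ; rewrite !inE (negbTE xX) (negbTE yX) => xI; apply/negP.
  exact: (indP _ indI).
Qed.

Lemma shifted_card : (#|J| + #|I :&: (S :\: deep)| = #|I| + #|B|)%N.
Proof.
have BsubX : B \subset X by apply: (subset_trans BX); apply/subsetP => x; rewrite inE => /andP[].
pose K := (I :&: X) :\: (S :\: deep).
have eK : [set x in X | (x \notin freed X) && (bk x \in I)] = [set sh y | y in K].
  apply/setP => x; apply/idP/imsetP => [|[y]].
    rewrite inE => /and3P[xX xF xI]; exists (bk x); last by rewrite stKV.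
    have bX : bk x \in X.
      apply: contraLR xI => bX; apply: (@edge _ a0); rewrite stKV xX (negbTE bX) //.
    rewrite /K !in_setD in_setI xI bX negb_and negbK !andbT; have [//|bd] := boolP (bk x \in deep); apply/negP => bS.
    move: xF; rewrite inE xX bd andbT /=; have := S_even bS; rewrite parS negbK => -> //.
  rewrite /K !in_setD in_setI negb_and negbK => /andP[yS /andP[yI yX]] ->.
  have sX : sh y \in X by apply: contraLR yI => sX; apply: (@edge _ a0); rewrite yX (negbTE sX).
  rewrite inE sX stK yI andbT /= inE sX parS stK /= negb_and !negbK.
  move: yS => /orP[->|yS]; rewrite ?orbT //.
  by apply/orP; left; apply: contraNT yS => py; apply: (subsetP XS); rewrite inE yX.
have -> : J = (I :\: X) :|: ([set x in X | (x \notin freed X) && (bk x \in I)] :|: B).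
  apply/setP => x; rewrite in_setU in_setD in_setU.
  have -> : (x \in [set y in X | (y \notin freed X) && (bk y \in I)]) =
    [&& x \in X, x \notin freed X & bk x \in I] by rewrite in_set.
  rewrite [x \in J]in_set; have [xX|xX] /= := boolP (x \in X).
    have [xF|xF] /= := boolP (x \in freed X); rewrite ?orbF //.
    by have /contraNF -> := subsetP BX x; rewrite ?orbF.
  by have /contraNF -> := subsetP BsubX x; rewrite ?orbF.
rewrite cardsU disjoint_setI0 ?cards0 ?subn0; last first.
  rewrite disjoints_subset; apply/subsetP => x; rewrite in_setD in_setC in_setU => /andP[xX _].
  rewrite inE (negbTE xX) /=; apply: contra xX; exact: (subsetP BsubX).
rewrite [X in (_ + X + _)%N]cardsU disjoint_setI0 ?cards0 ?subn0; last first.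
  rewrite disjoints_subset; apply/subsetP => x; rewrite in_setC inE => /and3P[_ xF _].
  by apply: contra xF; apply: (subsetP BX).
rewrite eK card_imset; last exact: st_inj.
have e1 : #|I| = (#|I :\: X| + #|I :&: X|)%N by rewrite addnC cardsID.
have e2 : #|I :&: X| = (#|I :&: (S :\: deep)| + #|K|)%N.
  rewrite -(cardsID (S :\: deep) (I :&: X)); congr (_ + _)%N; apply: eq_card => y.
  rewrite setIAC in_setI; have [yIS|//] := boolP (y \in I :&: _).
  by move: yIS; rewrite in_setI in_setD => /and3P[yI _ yS]; rewrite occupied_S.
by rewrite e1 e2; lia.
Qed.

(** First stage of decoding: the right side involves the code, [J] and the recorded set, but neither
    [X] nor [B]. The even part then yields [X], and with it [shifted_odd] and [shifted_freed]
    recover the rest. *)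
Lemma shifted_even y : ~~ par y ->
  (y \in I) = if y \in deep then sh y \in J else if y \in S then y \in I :&: (S :\: deep) else y \in J.
Proof.
move=> py; case: ifP => [yd|yd].
  have : sh y \in F by move: yd; rewrite inE => /andP[].
  move=> /(subsetP FX); rewrite [sh y \in odds X]inE => /andP[sX _].
  by rewrite inE sX [sh y \in freed X]inE stK yd !andbF.
case: ifP => yS; first by rewrite in_setI in_setD yd yS !andbT.
have yX : y \notin X by apply: contraFN yS => yX; apply: (subsetP XS); rewrite inE yX.
by rewrite inE (negbTE yX).
Qed.

Lemma shifted_odd y : par y ->
  (y \in I) = if y \in X then (sh y \in X) && (sh y \in J) else y \in J.
Proof.
move=> py; case: ifP => [yX|yX]; last by rewrite inE yX.
have [sX|sX] /= := boolP (sh y \in X).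
  by rewrite inE sX [sh y \in freed X]inE parS py andbF stK.
by apply/negbTE; apply: (@edge _ a0); rewrite yX (negbTE sX).
Qed.

Lemma shifted_freed : B = J :&: freed X.
Proof.
apply/setP => x; rewrite in_setI; have [xF|xF] := boolP (x \in freed X).
  by rewrite andbT inE xF; have := xF; rewrite inE => /andP[->].
by rewrite andbF; have /contraNF -> := subsetP BX x.
Qed.

Lemma card_freed : (#|odds X| = #|freed X| + #|deep|)%N.
Proof.
rewrite -(cardsID (freed X) (odds X)); congr (_ + _)%N.
  by apply: eq_card => x; rewrite !inE; case: (x \in X); rewrite //= andbA andbb.
rewrite -(card_imset (mem deep) (@st_inj G a0)); apply: eq_card => x.
rewrite in_setD; apply/idP/imsetP => [|[y yd ->]].
  rewrite !inE => /andP[h /andP[xX px]]; move: h; rewrite xX px /= => /negbNE h.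
  by exists (bk x); rewrite ?stKV // inE.
have sF : sh y \in F by move: yd; rewrite inE => /andP[].
by rewrite (subsetP FX) // andbT inE stK yd !andbF.
Qed.

End One.

Section Sum.
Variables (R : realFieldType) (lam : R) (Phi : {set T} -> {set T}) (P : pred {set T}) (m : nat).
Hypothesis lam0 : 0 <= lam.
Hypothesis hP : forall I, P I -> compatible (Phi (evens I)) I.
Hypothesis hm : forall I, P I -> (m <= #|odds (Phi (evens I))|)%N.

(** Pairs of a set and a choice [B] inject, with equal weight, into pairs of an independent set and
    a recorded subset of [S :\: deep]. The choices gain the exponent [#|odds X| - #|deep|], the
    records cost [#|S| - #|deep|]; [deep] cancels. *)
Lemma shift_sum : (1 + lam) ^+ m * (\sum_(I | P I) lam ^+ #|I|)
  <= (1 + lam) ^+ #|S| * \sum_(J | ind J) lam ^+ #|J|.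
Proof.
have l1 : 1 <= 1 + lam by rewrite lerDl.
have l0 : 0 <= 1 + lam := le_trans ler01 l1.
pose X I := Phi (evens I).
have -> : #|S| = (#|deep| + #|S :\: deep|)%N.
  rewrite -(cardsID deep S); congr (_ + _)%N; apply: eq_card => x.
  by rewrite !inE; case: (x \in S).
rewrite exprD -mulrA.
pose A := [set p : {set T} * {set T} | P p.1 && (p.2 \subset freed (X p.1))].
pose f (p : {set T} * {set T}) := (shifted (X p.1) p.1 p.2, p.1 :&: (S :\: deep)).
have f_inj : {in A &, injective f}.
  move=> [I1 B1] [I2 B2]; rewrite !inE /= => /andP[P1 h1] /andP[P2 h2] [eJ eB].
  have eI : evens I1 = evens I2.
    apply/setP => y; rewrite !inE; have [py|py] := boolP (par y); rewrite ?andbF // !andbT.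
    by rewrite (shifted_even B1 (hP P1) py) (shifted_even B2 (hP P2) py) -/(X I1) -/(X I2) eJ eB.
  have eX : X I1 = X I2 by rewrite /X eI.
  congr pair.
    apply/setP => y; have [py|py] := boolP (par y).
      by rewrite (shifted_odd B1 (hP P1) py) (shifted_odd B2 (hP P2) py) -/(X I1) -/(X I2) eJ eX.
    by have := congr1 (fun Z : {set T} => y \in Z) eI; rewrite /= !inE py !andbT.
  by rewrite (shifted_freed I1 h1) (shifted_freed I2 h2) eJ eX.
have fsum : \sum_(p in A) lam ^+ (#|p.1| + #|p.2|) <=
    (\sum_(J | ind J) lam ^+ #|J|) * (1 + lam) ^+ #|S :\: deep|.
  rewrite -sum_subsets mulr_suml.
  under [leRHS]eq_bigr do rewrite mulr_sumr.
  rewrite pair_big /=.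
  rewrite (eq_bigr (fun p => (fun q : {set T} * {set T} => lam ^+ (#|q.1| + #|q.2|)) (f p))); last first.
    by move=> [I B]; rewrite inE /= => /andP[PI BX]; rewrite (shifted_card (hP PI)).
  rewrite -(big_imset (fun q : {set T} * {set T} => lam ^+ (#|q.1| + #|q.2|)) f_inj) /=.
  rewrite [leRHS](bigID (mem (f @: A))) /=.
  rewrite -[leLHS]addr0 lerD ?sumr_ge0 //; last by move=> q _; rewrite mulr_ge0 ?exprn_ge0.
  rewrite [leRHS](eq_bigl (mem (f @: A))); last first.
    move=> q /=; apply/andP/idP => [[]//|qA]; split=> //.
    move: qA => /imsetP[[I B]]; rewrite inE /= => /andP[PI BX] -> /=.
    by rewrite (shifted_ind B (hP PI)) // subsetIr.
  by rewrite le_eqVlt; apply/orP; left; apply/eqP; apply: eq_bigr => q _; rewrite exprD.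
rewrite [X in _ <= _ * X]mulrC; apply: le_trans (ler_wpM2l (exprn_ge0 _ l0) fsum).
rewrite (eq_bigl (fun p : {set T} * {set T} => P p.1 && (p.2 \subset freed (X p.1)))); last first.
  by move=> p; rewrite inE.
rewrite -(pair_big_dep P (fun I (B : {set T}) => B \subset freed (X I))
  (fun I (B : {set T}) => lam ^+ (#|I| + #|B|))) /=.
rewrite !mulr_sumr; apply: ler_sum => I PI.
under [X in _ <= _ * X]eq_bigr do rewrite exprD.
rewrite -mulr_sumr sum_subsets mulrCA -exprD [leLHS]mulrC ler_wpM2l ?exprn_ge0 //.
by apply: ler_weXn2l => //; rewrite addnC -(card_freed (hP PI)) hm.
Qed.

End Sum.

End Shift.

(** * The region determined by the even part *)

Local Close Scope ring_scope.

Section Region.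
Variable G : cayley.
Local Notation T := (vert G).
Local Notation D := #|dir G|.

Definition region (E : {set T}) :=
  [set x | if par x then x \in nbs E else [forall a, st x a \in nbs E]].

Lemma nbs_st (E : {set T}) x a : x \in E -> st x a \in nbs E.
Proof. by move=> xE; rewrite inE; apply/existsP; exists (op a); rewrite stK. Qed.

Lemma region_closed (I : {set T}) : closed (region (evens I)).
Proof.
apply/forallP => x; rewrite inE; case px: (par x).
  apply/implyP; rewrite inE => /existsP[a xa]; apply/existsP; exists a.
  by rewrite inE parS px; apply/forallP => b; apply: nbs_st.
have e a : (st x a \in region (evens I)) = (st x a \in nbs (evens I)) by rewrite inE parS px.
case: ifP => [/forallP h|/negbT]; first by apply/forallP => a; rewrite e.
by rewrite negb_forall => /existsP[a h]; apply/existsP; exists a; rewrite e.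
Qed.

Lemma evens_region (I : {set T}) : evens I \subset region (evens I).
Proof.
apply/subsetP => x xE; rewrite inE; have := xE; rewrite inE => /andP[_ /negbTE ->].
by apply/forallP => a; apply: nbs_st.
Qed.

Lemma nbs_unoccupied (I : {set T}) x : ind I -> x \in nbs (evens I) -> x \notin I.
Proof.
move=> /indP iI; rewrite inE => /existsP[a]; rewrite inE => /andP[xI _].
by apply: contraL xI => h; apply: iI.
Qed.

Lemma odds_region (I : {set T}) : ind I -> odds I \subset ~: region (evens I).
Proof.
move=> iI; apply/subsetP => x; rewrite inE => /andP[xI px].
rewrite in_setC; apply: contraL xI => xX; apply: nbs_unoccupied => //.
by move: xX; rewrite inE px.
Qed.

(** Near its boundary [X] is still the original region, where every neighbour of an even vertex is
    adjacent to an occupied even vertex and hence empty. A missed odd vertex is within 5 of the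
    boundary, its neighbours within 6. *)
Lemma compatible_agrees (I X F S : {set T}) : 0 < D -> ind I -> agrees (region (evens I)) X ->
  F \subset odds X -> evens X \subset S ->
  (forall x, x \in odds X :\: F -> exists2 q, q \in Bd X & near 5 q x) ->
  compatible F S X I.
Proof.
move=> D0 iI agr FX XS hF; have clX := agrees_closed D0 (region_closed I) agr.
split=> // [u a h|v a b].
  have uB := mem_Bd h; have [e _] := agrees_st a agr uB.
  case pu: (par u).
    have uX : u \in X.
      by apply: contraTT h => uX; rewrite (negbTE uX) (negbTE (cl_odd_out clX _ pu uX)).
    by apply: nbs_unoccupied => //; move: uX; rewrite e inE pu.
  have uX : u \notin X by apply: contraTN h => uX; rewrite uX cl_even // pu.
  by move: uX; rewrite e; apply: contra => uI; apply: (subsetP (evens_region I)); rewrite inE uI pu.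
rewrite inE => /andP[vX pv] hv uX.
have [q qB n] : exists2 q, q \in Bd X & near 6 q (st v a).
  have [vB|vB] := boolP (v \in Bd X).
    by exists v => //; apply: (@near_mono _ 1) => //; apply: near1.
  have [|q qB n] := hF v; last by exists q => //; apply: near_st'.
  by move: hv; rewrite (negbTE vB) /= in_setD => ->; rewrite inE vX.
move: uX; rewrite (agr q) // inE parS pv /= => /forallP h.
exact: nbs_unoccupied.
Qed.

End Region.

Local Open Scope ring_scope.

(** * Mixing time and bottlenecks *)

Section Mixing.
Variables (T : finType) (e : rel T) (R : realType) (lam : R).
Hypothesis lam0 : 0 < lam.
Local Notation indset := (indepset e).
Local Notation Z := (partition_function e lam).
Local Notation pi := (@hardcore T e R lam).
Local Notation P := (@glauber T e R lam).
Local Notation move := (@glauber_move T e R lam).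

Lemma indep0 : indep e set0.
Proof. by apply/forall_inP => x; rewrite inE. Qed.

Lemma partition_gt0 : 0 < Z.
Proof.
rewrite /partition_function (bigD1 (exist _ set0 indep0)) //= cards0 expr0.
apply: (lt_le_trans ltr01); rewrite lerDl.
by apply: sumr_ge0 => I _; apply: exprn_ge0; apply: ltW.
Qed.

Lemma hardcore_ge0 I : 0 <= pi I.
Proof. by rewrite /hardcore divr_ge0 ?exprn_ge0 ?ltW ?partition_gt0. Qed.

Lemma sum_hardcore : \sum_I pi I = 1.
Proof. by rewrite /hardcore -mulr_suml divff // gt_eqF // partition_gt0. Qed.

Lemma symdiffC (A B : {set T}) : symdiff A B = symdiff B A.
Proof. by rewrite /symdiff setUC. Qed.

Lemma symdiff_inj (A : {set T}) : injective (symdiff A).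
Proof.
move=> B C h; apply/setP => x; have := congr1 (fun S : {set T} => x \in S) h.
by rewrite /= !inE; case: (x \in A); case: (x \in B); case: (x \in C).
Qed.

Lemma move_ge0 I J : 0 <= move I J.
Proof.
rewrite /glauber_move; case: ifP => // _; have := lam0; have : 0 <= #|T|%:R^-1 :> R by rewrite invr_ge0.
by case: ifP => _ *; rewrite mulr_ge0 // divr_ge0 //; lra.
Qed.

Lemma move_le I J : move I J <= (#|symdiff (val I) (val J)| == 1%N)%:R / #|T|%:R.
Proof.
rewrite /glauber_move; case: ifP => _; last by rewrite mul0r.
have h := lam0; have t0 : 0 <= #|T|%:R^-1 :> R by rewrite invr_ge0.
have l1 : 0 < 1 + lam by lra.
by case: ifP => _; rewrite [leRHS]mul1r ler_piMr // ler_pdivrMr //; lra.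
Qed.

Lemma sum_move_le I : \sum_J move I J <= 1.
Proof.
apply: (@le_trans _ _ (\sum_(J : indset) (#|symdiff (val I) (val J)| == 1%N)%:R / #|T|%:R)).
  by apply: ler_sum => J _; apply: move_le.
rewrite -mulr_suml -natr_sum.
have [T0|T0] := posnP #|T|; first by rewrite T0 invr0 mulr0 ler01.
rewrite ler_pdivrMr ?ltr0n // mul1r ler_nat.
have -> : (\sum_(J : indset) (#|symdiff (val I) (val J)| == 1) =
   #|[set symdiff (val I) (val J) | J : indset in [pred J : indset | #|symdiff (val I) (val J)| == 1]]|)%N.
  rewrite card_imset; last by move=> J K /symdiff_inj /val_inj.
  by rewrite -sum1_card [RHS]big_mkcond /=; apply: eq_bigr => J _; rewrite inE; case: eqP.
rewrite -(card_imset predT (@set1_inj T)); apply: subset_leq_card.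
apply/subsetP => A /imsetP[J]; rewrite inE => /cards1P[x ex] ->.
by rewrite ex; apply/imsetP; exists x.
Qed.

Lemma glauber_ge0 I J : 0 <= P I J.
Proof.
rewrite /glauber; case: ifP => _; last exact: move_ge0.
rewrite subr_ge0; apply: le_trans (sum_move_le I).
rewrite [leRHS](bigD1 I) //= lerDr; exact: move_ge0.
Qed.

Lemma sum_glauber I : \sum_J P I J = 1.
Proof.
rewrite (bigD1 I) //= {1}/glauber eqxx.
rewrite [X in _ + X](_ : _ = \sum_(K | K != I) move I K); first by rewrite subrK.
by apply: eq_bigr => J JI; rewrite /glauber eq_sym (negbTE JI).
Qed.

Lemma glauber_balance I J : pi I * P I J = pi J * P J I.
Proof.
rewrite /glauber eq_sym; case: eqP => [->//|ne].
rewrite /hardcore mulrAC [RHS]mulrAC; congr (_ / _).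
rewrite /glauber_move symdiffC; case: ifP => // /eqP c1; last by rewrite !mulr0.
have l1 : 1 + lam != 0 by rewrite gt_eqF // addr_gt0.
have key (A B : {set T}) : #|symdiff A B| = 1%N -> A \subset B -> #|B| = #|A|.+1 /\ (B \subset A) = false.
  move=> c AB; have D0 : A :\: B = set0 by apply/eqP; rewrite setD_eq0.
  move: c; rewrite /symdiff D0 set0U => c; split.
    by rewrite -(cardsID A B) (setIidPr AB) c addn1.
  by apply/negP; rewrite -setD_eq0 => /eqP h; rewrite h cards0 in c.
have key2 (A B : {set T}) : #|symdiff A B| = 1%N -> ~~ (A \subset B) -> B \subset A.
  move=> /eqP/cards1P[x ex] /subsetPn[y yA yB]; apply/subsetP => z zB; apply: contraT => zA.
  have : y \in symdiff A B by rewrite !inE yA yB.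
  have : z \in symdiff A B by rewrite !inE zA zB.
  by rewrite ex !inE => /eqP zx /eqP yx; rewrite zx -yx yA in zA.
have c1' : #|symdiff (val I) (val J)| = 1%N by rewrite symdiffC.
have [IJ|IJ] := boolP (val I \subset val J).
  have [-> ->] := key _ _ c1' IJ; rewrite exprS; field; rewrite l1 /=.
  by rewrite pnatr_eq0 -lt0n; move: c1' => /eqP/cards1P[x _]; apply/card_gt0P; exists x.
have JI := key2 _ _ c1' IJ; rewrite JI; have [-> _] := key _ _ c1 JI.
rewrite exprS; field; rewrite l1 /=.
by rewrite pnatr_eq0 -lt0n; move: c1' => /eqP/cards1P[x _]; apply/card_gt0P; exists x.
Qed.

Lemma stationary J : \sum_I pi I * P I J = pi J.
Proof.
under eq_bigr do rewrite glauber_balance.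
by rewrite -mulr_sumr sum_glauber mulr1.
Qed.

Local Notation Pt := (@glauber_iter T e R lam).

Lemma iter_ge0 t I J : 0 <= Pt t I J.
Proof.
elim: t J => [|t IH] J /=; first by rewrite ler0n.
by apply: sumr_ge0 => K _; rewrite mulr_ge0 // glauber_ge0.
Qed.

Lemma sum_iter t I : \sum_J Pt t I J = 1.
Proof.
elim: t => [|t IH] /=.
  by rewrite (bigD1 I) //= eqxx big1 ?addr0 // => J; rewrite eq_sym => /negbTE ->.
rewrite exchange_big /= -[RHS]IH; apply: eq_bigr => K _.
by rewrite -mulr_sumr sum_glauber mulr1.
Qed.

Lemma stationary_iter t J : \sum_I pi I * Pt t I J = pi J.
Proof.
elim: t J => [|t IH] J /=.
  rewrite (bigD1 J) //= eqxx mulr1 big1 ?addr0 // => I /negbTE ->; exact: mulr0.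
under eq_bigr do rewrite mulr_sumr.
rewrite exchange_big /= -[RHS]stationary; apply: eq_bigr => K _.
rewrite -[in RHS]IH mulr_suml; apply: eq_bigr => I _; exact: mulrA.
Qed.

Section Bottleneck.
Variables A1 A2 : pred indset.
Hypothesis A12 : forall I J, A1 I -> A2 J -> (1 < #|symdiff (val I) (val J)|)%N.

Let B := [pred I : indset | ~~ A1 I && ~~ A2 I].
Let flow t J := \sum_(I | A1 I) pi I * Pt t I J.

Lemma flow_le t J : 0 <= flow t J <= pi J.
Proof.
have h I : 0 <= pi I * Pt t I J by rewrite mulr_ge0 ?hardcore_ge0 ?iter_ge0.
apply/andP; split; first by apply: sumr_ge0.
by rewrite -[leRHS](stationary_iter t) [leRHS](bigID A1) /= lerDl sumr_ge0.
Qed.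

Lemma A12_glauber I J : A1 I -> A2 J -> P I J = 0.
Proof.
move=> a1 a2; have h := A12 a1 a2.
rewrite /glauber /glauber_move; case: eqP => [e1|_].
  by move: h; rewrite e1 /symdiff !setDv setU0 cards0.
by rewrite gtn_eqF.
Qed.

(** No move leads from [A1] to [A2], so mass enters [A2] only through [B], and by stationarity the
    flow present in [B] at any time is at most the measure of [B]. *)
Lemma flow_bottleneck t : \sum_(J | A2 J) flow t J <= t%:R * \sum_(J | B J) pi J.
Proof.
elim: t => [|t IH].
  rewrite mul0r; apply: sumr_le0 => J a2; apply: sumr_le0 => I a1 /=.
  case: eqP => [e1|_]; last by rewrite mulr0.
  by have := A12 a1 a2; rewrite e1 /symdiff !setDv setU0 cards0.
have -> : \sum_(J | A2 J) flow t.+1 J = \sum_K flow t K * \sum_(J | A2 J) P K J.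
  rewrite /flow /=; under eq_bigr do under eq_bigr do rewrite mulr_sumr.
  under [RHS]eq_bigr do rewrite mulr_sumr.
  rewrite [RHS]exchange_big /=; apply: eq_bigr => J _.
  rewrite exchange_big /=; apply: eq_bigr => K _.
  by rewrite mulr_suml; apply: eq_bigr => I _; rewrite mulrA.
have le1 K : \sum_(J | A2 J) P K J <= 1.
  by rewrite -(sum_glauber K) [leRHS](bigID A2) /= lerDl sumr_ge0 // => J _; apply: glauber_ge0.
have f0 K : 0 <= flow t K by have /andP[] := flow_le t K.
rewrite -natr1 mulrDl mul1r (bigID A2) /=; apply: lerD.
  apply: le_trans IH; apply: ler_sum => K _; exact: ler_piMr.
rewrite [leRHS]big_mkcond [leLHS]big_mkcond /=; apply: ler_sum => K _.
case: (boolP (A2 K)) => [_|nA2] /=; first by case: ifP => // _; apply: hardcore_ge0.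
have [a1|na1] /= := boolP (A1 K).
  by rewrite big1 ?mulr0 // => J a2; apply: A12_glauber.
by apply: le_trans (ler_piMr (f0 K) (le1 K)) _; have /andP[] := flow_le t K.
Qed.

Lemma tv_event t I (A : pred indset) : \sum_(J | A J) pi J - \sum_(J | A J) Pt t I J <= tv_dist lam t I.
Proof.
have s0 : \sum_J (Pt t I J - pi J) = 0 by rewrite sumrB sum_iter sum_hardcore subrr.
have s1 : \sum_(J | A J) (Pt t I J - pi J) + \sum_(J | ~~ A J) (Pt t I J - pi J) = 0.
  by rewrite -[RHS]s0 [RHS](bigID A).
have a1 : - \sum_(J | A J) (Pt t I J - pi J) <= \sum_(J | A J) `|Pt t I J - pi J|.
  by apply: le_trans (ler_norm _) _; rewrite normrN ler_norm_sum.
have a2 : \sum_(J | ~~ A J) (Pt t I J - pi J) <= \sum_(J | ~~ A J) `|Pt t I J - pi J|.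
  by apply: le_trans (ler_norm _) _; rewrite ler_norm_sum.
rewrite /tv_dist [X in _ <= _ * X](bigID A) /=.
have : \sum_(J | A J) (Pt t I J - pi J) = \sum_(J | A J) Pt t I J - \sum_(J | A J) pi J by rewrite sumrB.
move: s1 a1 a2; set a := \sum_(J | A J) (_ - _); set b := \sum_(J | ~~ A J) (_ - _).
set c := \sum_(J | A J) `|_|; set d := \sum_(J | ~~ A J) `|_|; lra.
Qed.

Hypothesis A_sym : \sum_(J | A1 J) pi J = \sum_(J | A2 J) pi J.

Lemma mixing_bottleneck (th : R) : 0 <= th ->
  \sum_(J | B J) pi J <= 1000^-1 -> th * \sum_(J | B J) pi J <= 1000^-1 ->
  (th%:E <= mixing_time e lam)%E.
Proof.
move=> th0 hB hth; rewrite leNgt; apply/negP => hlt.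
(* From every start the chain is mixed after some [t0 < th], hence at this common time. *)
set t := (Num.truncn th).+1.
have tth : th < t%:R by apply: truncnS_gt.
have tth' : t%:R <= th + 1 by rewrite -natr1 lerD2r truncn_le.
have tv (I : {A : {set T} | indep e A}) : tv_dist lam t I <= (expR 1)^-1.
  have : (mixing_time_from lam I < th%:E)%E by apply: le_lt_trans hlt; apply: le_bigmax.
  move=> /ereal_inf_lt[_ [t0 ht0 <-]]; rewrite lte_fin => h.
  by apply: ht0; rewrite -(ltr_nat R); apply: lt_trans h tth.
(* From [e >= (1 + 1/2)^2]. The two sides have measure at least 0.4995 each, and
   [0.4995 * (0.4995 - 4/9)] exceeds [2/1000]. *)
have e1 : (expR 1 : R)^-1 <= 4 / 9.
  have h := expR_ge1Dx (2^-1 : R).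
  have -> : expR 1 = expR 2^-1 ^+ 2 :> R by rewrite -expRM_natl mulfV.
  have h2 : (9 / 4 : R) <= expR 2^-1 ^+ 2.
    rewrite (_ : 9 / 4 = (1 + 2^-1) ^+ 2 :> R); last by field.
    by rewrite lerXn2r ?nnegrE ?expR_ge0 //; lra.
  rewrite -[4 / 9]invrK lef_pV2 ?posrE ?exprn_gt0 ?expR_gt0 ?invr_gt0 ?divr_gt0 //.
  by rewrite invf_div.
have flow_lb : (\sum_(J | A1 J) pi J) * (\sum_(J | A2 J) pi J - 4 / 9) <= \sum_(J | A2 J) flow t J.
  rewrite /flow exchange_big /= mulr_suml; apply: ler_sum => I _.
  rewrite -mulr_sumr ler_wpM2l ?hardcore_ge0 //.
  have := tv_event t I A2; have := tv I; lra.
have tot : \sum_(J | A1 J) pi J + \sum_(J | A2 J) pi J + \sum_(J | B J) pi J = 1.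
  rewrite -sum_hardcore [RHS](bigID A1) /= -addrA; congr (_ + _).
  rewrite [RHS](bigID A2) /=; congr (_ + _).
  apply: eq_bigl => J; apply/idP/andP => [a2|[]//]; split=> //.
  by apply/negP => a1; have := A12 a1 a2; rewrite /symdiff !setDv setU0 cards0.
have up := flow_bottleneck t.
have b0 : 0 <= \sum_(J | B J) pi J by apply: sumr_ge0 => J _; apply: hardcore_ge0.
have up2 : t%:R * \sum_(J | B J) pi J <= 2 / 1000.
  have := ler_wpM2r b0 tth'; rewrite mulrDl mul1r; lra.
move: flow_lb tot up up2 hB; rewrite -A_sym.
set x := \sum_(J | A1 J) pi J; set y := \sum_(J | A2 J) _; set b := \sum_(J | B J) _.
move=> h1 h2 h3 h4 h5; nra.
Qed.

End Bottleneck.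

End Mixing.

(** * Summing over contours *)

Lemma exp_natr_le (R : realType) (a x : R) m n : expR a <= x -> (m <= n)%N -> 0 <= a ->
  expR (a * m%:R) <= x ^+ n.
Proof.
move=> ax mn a0; have x1 : 1 <= x by apply: le_trans ax; rewrite -expR0 ler_expR.
apply: le_trans (ler_weXn2l x1 mn); rewrite expRM_natr lerXn2r ?nnegrE ?expR_ge0 //.
exact: le_trans ax; apply: expR_ge0.
Qed.

(** Substituting [f = o - k] and [d = S - o + t], the balance becomes
    [(S - o + k) * (D - s) <= t * s]. If [S] exceeds [o - a], then [k <= a + t * s / (D - s)], and
    both terms are at most [t / r]. *)
Lemma missing_odds_le D s r t k f S o e d a : (0 < r)%N -> (8 * s <= D)%N -> (0 < D)%N ->
  (2 * s * r <= D)%N -> o = (f + k)%N -> S = (e + d)%N -> (t + e)%N = o -> (a * r <= t)%N ->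
  (S * D <= f * D + (k + d) * s)%N -> (o < S + a)%N -> (k * r <= 2 * t)%N.
Proof.
move=> r0 s8 D0 sr cO cS dO tr; have [u hu] : exists u, D = (s + u)%N by exists (D - s)%N; lia.
have u0 : (0 < u)%N by lia.
have sru : (s * r <= u)%N by clear -hu s8 sr; nia.
rewrite hu => bal small.
have e1 : (k * u <= a * u + t * s)%N.
  have : ((S + k) * u <= o * u + t * s)%N by clear -cO cS dO bal; nia.
  have : (o * u <= (S + a) * u)%N by rewrite leq_mul2r ltnW ?orbT.
  clear; nia.
rewrite -(leq_pmul2r u0); have : (k * u * r <= (a * u + t * s) * r)%N by rewrite leq_mul2r e1 orbT.
have : (a * r * u <= t * u)%N by rewrite leq_mul2r tr orbT.
have : (t * (s * r) <= t * u)%N by rewrite leq_mul2l sru orbT.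
clear; nia.
Qed.

Lemma sum_cover (R : numDomainType) (I J : finType) (P : pred I) (Q : pred J) (rel : I -> J -> bool) (w : I -> R) :
  (forall i, 0 <= w i) -> (forall i, P i -> exists2 j, Q j & rel i j) ->
  \sum_(i | P i) w i <= \sum_(j | Q j) \sum_(i | P i && rel i j) w i.
Proof.
move=> w0 h; rewrite (exchange_big_dep P) /=; last by move=> j i _ /andP[].
apply: ler_sum => i Pi; have [j Qj rij] := h i Pi.
by rewrite (bigD1 j) ?Qj ?Pi //= lerDl sumr_ge0.
Qed.

Section Assembly.
Variables (R : realType) (G : cayley) (a0 : dir G).
Local Notation T := (vert G).
Local Notation D := #|dir G|.
Local Notation N := #|T|.
Variables (M s r q : nat) (l rho lam : R).
Hypothesis D8 : (8 <= D)%N.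
Hypothesis s0 : (0 < s)%N.
Hypothesis s8 : (8 * s <= D)%N.
Hypothesis r0 : (0 < r)%N.
Hypothesis sr : (2 * s * r <= D)%N.
Hypothesis Dq : (2 * D)%:R <= expR q%:R :> R.
Hypothesis l1 : 1 <= l.
Hypothesis Dl : D.+1%:R <= expR l.
Hypothesis rho0 : 0 <= rho.
Hypothesis rho_lam : expR rho <= 1 + lam.
Hypothesis isoA : forall K : {set T}, (#|K| < M)%N -> (#|K| * D <= (gam K).*2)%N.
Hypothesis isoB : forall K : {set T}, (M <= #|K|)%N -> ((#|K|).*2 <= #|T|)%N -> (D * D <= gam K)%N.
Hypothesis ballM : forall (K : {set T}) x, x \in K -> (#|K| < M)%N ->
  exists2 y, y \notin K & near 4 x y.

Let D0 : (0 < D)%N. Proof. exact: leq_trans D8. Qed.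

(** A greedy choice covers a fraction at least [s / (2 t)] of what is left, so
    [2 * q * (t %/ s + 1)] choices leave a fraction [expR (- q)] of at most [2 * D * t / s] heavy
    vertices. That is at most [t %/ s], because [2 * D <= expR q]. *)
Definition skel_size t := ((2 * q + 1) * (t %/ s + 1))%N.

Lemma skeleton_exists (X : {set T}) t : closed X -> gam X = (t * D)%N -> (0 < t)%N ->
  exists Q : {set T}, [/\ Q \subset Bd X, heavy X s \subset nbs Q & (#|Q| <= skel_size t)%N].
Proof.
move=> clX gX t0; pose n1 := (2 * q * (t %/ s + 1))%N.
have sD : (0 < s * D)%N by rewrite muln_gt0 s0.
have [Q [w [QB hQ cQ cw]]] := heavy_cover X n1 sD.
exists Q; split=> //; apply: leq_trans cQ _.
rewrite /skel_size mulnDl mul1n leq_add2l; apply: (@leq_trans (t %/ s)); last exact: leq_addr.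
rewrite leq_divRL //.
have ch := card_heavy X s; move: ch cw; rewrite gX.
set m := (t * D).*2 => ch cw.
have m0 : 0 < m%:R :> R by rewrite ltr0n double_gt0 muln_gt0 t0.
have tR : 0 < t%:R :> R by rewrite ltr0n.
have sR : 0 < s%:R :> R by rewrite ltr0n.
have DR : 0 < D%:R :> R by rewrite ltr0n.
have n1R : 2 * q%:R * t%:R <= n1%:R * s%:R :> R.
  rewrite /n1 -!natrM ler_nat -!mulnA leq_mul2l /= leq_mul2l; apply/orP; right.
  by rewrite addn1 ltnW // ltn_ceil.
clearbody n1.
have hm : (m - s * D)%:R <= m%:R * expR (- ((s * D)%:R / m%:R)) :> R.
  have [h|h] := leqP (s * D) m; last first.
    by rewrite (eqP (ltnW h)) mulr_ge0 ?expR_ge0 ?ltW.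
  rewrite natrB //; have := expR_ge1Dx (- ((s * D)%:R / m%:R) : R).
  rewrite -(ler_pM2l m0) mulrDr mulr1 mulrN mulrCA divff ?mulr1 //; exact: lt0r_neq0.
have cwR : w%:R <= #|heavy X s|%:R * expR (- q%:R) :> R.
  rewrite -(ler_pM2r (exprn_gt0 n1 m0)) -natrX -natrM.
  apply: (@le_trans _ _ (#|heavy X s| * (m - s * D) ^ n1)%N%:R); first by rewrite ler_nat.
  rewrite natrM -mulrA ler_wpM2l ?ler0n // natrX.
  apply: (@le_trans _ _ ((m%:R * expR (- ((s * D)%:R / m%:R))) ^+ n1)).
    by rewrite lerXn2r ?nnegrE ?ler0n ?mulr_ge0 ?expR_ge0 ?ler0n.
  rewrite exprMn natrX [leRHS]mulrC ler_wpM2l ?exprn_ge0 ?ler0n // -expRM_natl ler_expR.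
  rewrite mulrN lerN2 mulrA ler_pdivlMr // /m -mul2n !natrM.
  by have := ler_wpM2r (ltW DR) n1R; lra.
rewrite -(ler_nat R) natrM.
have chR : #|heavy X s|%:R * s%:R <= (2 * D)%:R * t%:R :> R.
  rewrite -natrM -natrM ler_nat -(leq_pmul2r D0) -mulnA.
  by apply: leq_trans ch _; rewrite /m -mul2n; rewrite mulnA (mulnC D) mulnA.
apply: le_trans (ler_wpM2r (ler0n _ _) cwR) _.
rewrite mulrAC; apply: le_trans (ler_wpM2r (expR_ge0 _) chR) _.
rewrite mulrAC expRN ler_piMl ?ler0n // ler_pdivrMr ?expR_gt0 // mul1r //.
Qed.

Definition good_code (c : code G) (X : {set T}) := let F := approx_in s c in let S := approx_out s c in
  [&& F \subset odds X, evens X \subset S, [forall u in S, (D - s <= din F u)%N],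
      (#|S| * D <= #|F| * D + (#|odds X :\: F| + #|S :\: evens X|) * s)%N &
      [forall x in odds X :\: F, (x \in ball_around 6 (skel c)) && [exists p in Bd X, near 5 p x]]].

Lemma good_code_exists (X : {set T}) t : closed X -> gam X = (t * D)%N -> (0 < t)%N ->
  exists2 c, c \in codes G M (skel_size t) #|clusters X| & good_code c X.
Proof.
move=> clX gX t0; have [Q [QB hQ cQ]] := skeleton_exists clX gX t0.
have s6 : (6 * s <= D)%N by apply: leq_trans s8; rewrite leq_mul2r orbT.
have hts : (t <= s * skel_size t)%N.
  rewrite /skel_size mulnCA; apply: (@leq_trans (s * (t %/ s + 1))).
    by rewrite addn1 mulnC ltnW // ltn_ceil.
  by rewrite leq_pmull // addn1.
have [c [eQ val [h1 h2 h3 h4 h5]]] := code_exists isoA ballM clX gX s0 s8 D8 hts QB hQ cQ.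
have [A [AQ cA cc]] := cluster_roots QB (near_skeleton clX s6 D0 hQ).
exists c.
  rewrite inE val eQ; apply/existsP; exists A; rewrite AQ cA eqxx /=; exact: cut_connP.
rewrite /good_code h1 h2 h4 /=; apply/andP; split; first by apply/forall_inP.
apply/forall_inP => x /h5[p pQ np]; apply/andP; split.
  by rewrite inE eQ; apply/exists_inP; exists p => //; apply: nearS.
by apply/exists_inP; exists p => //; apply: (subsetP QB).
Qed.

Local Notation Z := (\sum_(J | ind (G := G) J) lam ^+ #|J|).
Variable Phi : {set T} -> {set T}.
Variable P : pred {set T}.
Hypothesis hP : forall I, P I -> ind I /\ agrees (region (evens I)) (Phi (evens I)).

Let lam0 : 0 <= lam.
Proof.
have : 1 <= expR rho by rewrite -expR0 ler_expR.
by move=> h; have := le_trans h rho_lam; rewrite lerDl.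
Qed.

Lemma weight_sum_ge0 (Q : pred {set T}) : 0 <= \sum_(I | Q I) lam ^+ #|I|.
Proof. by apply: sumr_ge0 => I _; apply: exprn_ge0. Qed.

Lemma shift_bound (Q : pred {set T}) (F S : {set T}) m :
  (forall u, u \in S -> ~~ par u) -> (forall u, u \in S -> exists a, st u a \in F) ->
  (forall I, Q I -> compatible F S (Phi (evens I)) I) ->
  (forall I, Q I -> (#|S| + m <= #|odds (Phi (evens I))|)%N) ->
  \sum_(I | Q I) lam ^+ #|I| <= expR (- (rho * m%:R)) * Z.
Proof.
move=> h1 h2 h3 h4; have := shift_sum a0 h1 h2 lam0 h3 h4.
have l0 : 0 < 1 + lam by apply: lt_le_trans rho_lam; apply: expR_gt0.
rewrite exprD -mulrA ler_pM2l ?exprn_gt0 // => h.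
rewrite expRN mulrC ler_pdivlMr ?expR_gt0 // mulrC; apply: le_trans h.
by rewrite ler_wpM2r ?weight_sum_ge0 // exp_natr_le.
Qed.

Definition coded t c := [pred I | [&& P I, gam (Phi (evens I)) == (t * D)%N & good_code c (Phi (evens I))]].

(* Either [S] is smaller than the odd side by [t %/ r], which is the gain; or the
   code misses so few odd vertices that listing them determines the region, and
   the gain is the full [t]. *)
Lemma coded_bound t c n : (#|skel c| <= n)%N ->
  \sum_(I | coded t c I) lam ^+ #|I| <=
  (expR (- (rho * (t %/ r)%:R)) + expR (n%:R + 6 * l * ((2 * t) %/ r)%:R - rho * t%:R)) * Z.
Proof.
move=> cn; set F := approx_in s c; set S := approx_out s c.
have F_S I : coded t c I -> forall u, u \in S -> ~~ par u /\ exists a, st u a \in F.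
  move=> /and3P[PI _ /and5P[FX _ /forall_inP hS _ _]] u uS.
  have : (0 < din F u)%N by apply: leq_trans (hS u uS); rewrite subn_gt0 (leq_trans _ s8) // ltn_Pmull.
  move=> /card_gt0P[a]; rewrite inE => aF; split; last by exists a.
  by have := subsetP FX _ aF; rewrite inE parS => /andP[_ ->].
have Zge := weight_sum_ge0 (@ind G).
have comp I : coded t c I -> compatible F S (Phi (evens I)) I.
  move=> /and3P[PI _ /and5P[FX XS _ _ /forall_inP h]]; have [iI agr] := hP PI.
  by apply: compatible_agrees => // x /h /andP[_ /exists_inP[p pB np]]; exists p.
rewrite (bigID (fun I => #|S| + t %/ r <= #|odds (Phi (evens I))|)%N) /= mulrDl; apply: lerD.
  have [I0 hI0|none] := pickP (coded t c); last first.
    rewrite big_pred0 ?mulr_ge0 ?expR_ge0 // => I.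
    by have := none I; rewrite /= => ->.
  apply: (@shift_bound _ F S) => [u uS|u uS|I /andP[hI _]|I /andP[_ ->]] //.
  - by have [] := F_S _ hI0 u uS.
  - by have [] := F_S _ hI0 u uS.
  - exact: comp.
pose j := ((2 * t) %/ r)%N.
pose KK I := odds (Phi (evens I)) :\: F.
have hK I : coded t c I -> (#|odds (Phi (evens I))| < #|S| + t %/ r)%N -> KK I \in near_subsets (skel c) j.
  move=> /and3P[PI /eqP gX /and5P[FX XS _ bal /forall_inP h]] small.
  have [iI agr] := hP PI.
  rewrite inE; apply/andP; split; first by apply/subsetP => x /h /andP[].
  have clX := agrees_closed D0 (region_closed I) agr.
  have := gam_diff clX; rewrite gX -mulnDl => /eqP; rewrite eqn_pmul2r // => /eqP dO.
  have cO : (#|odds (Phi (evens I))| = #|F| + #|KK I|)%N.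
    by rewrite -(cardsID F (odds _)) (setIidPr FX).
  have cS : (#|S| = #|evens (Phi (evens I))| + #|S :\: evens (Phi (evens I))|)%N.
    by rewrite -(cardsID (evens (Phi (evens I))) S) (setIidPr XS).
  rewrite leq_divRL //; move: bal small; rewrite -/(KK I) -/F -/S.
  have tr := leq_trunc_div t r.
  move: cO cS dO tr; move: #|KK I| #|F| #|S| #|odds _| #|evens _| #|S :\: _| (t %/ r)%N => k f S' o e' d a.
  move=> h1 h2 h3 h4 h5 h6; exact: (missing_odds_le r0 s8 D0 sr h1 h2 h3 h4 h5 h6).
rewrite (partition_big KK (mem (near_subsets (skel c) j))) /=; last first.
  by move=> I /andP[hI]; rewrite -ltnNge; apply: hK.
apply: (@le_trans _ _ (\sum_(K in near_subsets (skel c) j) expR (- (rho * t%:R)) * Z)).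
  apply: ler_sum => K _.
  have [I0 hI0|none] := pickP (fun I => coded t c I && (KK I == K)); last first.
    rewrite big_pred0 ?mulr_ge0 ?expR_ge0 // => I; have := none I; rewrite /= => h.
    by apply/negP => /andP[/andP[h1 _] h2]; move: h; rewrite h1 h2.
  have oX I : coded t c I -> KK I == K -> odds (Phi (evens I)) = F :|: K.
    move=> /and3P[_ _ /and5P[FX _ _ _ _]] /eqP <-.
    by rewrite /KK setDE setUIr setUCr setIT; apply/esym/setUidPr.
  have cl I : coded t c I -> closed (Phi (evens I)).
    by move=> /and3P[PI _ _]; have [_ agr] := hP PI; apply: (agrees_closed D0 (region_closed I) agr).
  have eX I : coded t c I -> KK I == K -> evens (Phi (evens I)) = full_evens 0 (F :|: K).
    by move=> h1 h2; rewrite -(oX I h1 h2) full_evens_odds ?cl.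
  have [h1 h2] := andP hI0.
  apply: (@shift_bound _ (F :|: K) (full_evens 0 (F :|: K))) => [u|u|I /andP[/andP[hI _] hIK]|I /andP[/andP[hI _] hIK]].
  - by rewrite inE => /andP[].
  - rewrite -(eX _ h1 h2) inE => /andP[uX pu]; have /card_gt0P[a _] := D0; exists a.
    by rewrite -(oX _ h1 h2) inE parS pu (cl_even (cl _ h1)).
  - have /and3P[PI _ _] := hI; have [iI agr] := hP PI.
    rewrite -(eX _ hI hIK) -(oX _ hI hIK); apply: compatible_agrees => // x.
    by rewrite setDv inE.
  have /and3P[_ /eqP gX _] := hI; have := gam_diff (cl _ hI); rewrite gX -mulnDl => /eqP.
  by rewrite eqn_pmul2r // -(eX _ hI hIK) => /eqP <-; rewrite addnC.
rewrite sumr_const -[leLHS]mulr_natl mulrA ler_wpM2r // expRD ler_wpM2r ?expR_ge0 //.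
exact: card_near_subsets.
Qed.

Variables (eps beta : R) (t0 : nat).
Hypothesis t0_gt0 : (0 < t0)%N.
Hypothesis beta0 : 0 <= beta.
Hypothesis many : forall I, P I -> exists t, [/\ (t0 <= t <= N)%N,
  gam (Phi (evens I)) = (t * D)%N & few_clusters eps (Phi (evens I))].
Hypothesis exponent1 : forall t, (t0 <= t)%N ->
  eps * (t * D)%:R + 800 * l * (skel_size t)%:R - rho * (t %/ r)%:R <= - (beta * t%:R).
Hypothesis exponent2 : forall t, (t0 <= t)%N ->
  eps * (t * D)%:R + 800 * l * (skel_size t)%:R +
    ((skel_size t)%:R + 6 * l * ((2 * t) %/ r)%:R - rho * t%:R) <= - (beta * t%:R).

(** The factor [N.+1 ^+ 2] counts the pairs of [t] and a number of clusters. For each pair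
    [few_clusters] bounds the binomial in the number of codes, and the two exponent hypotheses
    compare that number with the two terms of [coded_bound]. *)
Lemma contour_sum : \sum_(I | P I) lam ^+ #|I| <= 2 * N.+1%:R ^+ 2 * expR (- (beta * t0%:R)) * Z.
Proof.
pose ok (j : 'I_N.+1 * 'I_N.+1) := (t0 <= j.1)%N && ('C(N, j.2)%:R <= expR (eps * (j.1 * D)%:R) :> R).
pose Q (j : 'I_N.+1 * 'I_N.+1 * code G) := ok j.1 && (j.2 \in codes G M (skel_size j.1.1) j.1.2).
have w0 I : 0 <= lam ^+ #|I : {set T}| by apply: exprn_ge0.
have Zge := weight_sum_ge0 (@ind G).
have cov I : P I -> exists2 j, Q j & coded j.1.1 j.2 I.
  move=> PI; have [t [/andP[tt tN] gX fX]] := many PI.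
  have [iI agr] := hP PI.
  have clX := agrees_closed D0 (region_closed I) agr.
  have [c cc gc] := good_code_exists clX gX (leq_trans t0_gt0 tt).
  have kN : (#|clusters (Phi (evens I))| < N.+1)%N.
    rewrite ltnS; exact: card_clusters.
  exists (Ordinal (tN : (t < N.+1)%N), Ordinal kN, c); rewrite /Q /ok /=.
    by rewrite tt cc andbT; move: fX; rewrite /few_clusters gX.
  by rewrite PI gX eqxx.
apply: le_trans (sum_cover w0 cov) _.
pose bd (t : nat) := (expR (- (rho * (t %/ r)%:R)) +
  expR ((skel_size t)%:R + 6 * l * ((2 * t) %/ r)%:R - rho * t%:R)) * Z.
apply: (@le_trans _ _ (\sum_(j | Q j) bd j.1.1)).
  apply: ler_sum => -[[t k] c] /andP[_]; rewrite inE /= => /andP[/and3P[cs _ _] _].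
  apply: le_trans (coded_bound t cs); rewrite le_eqVlt; apply/orP; left; apply/eqP.
  by apply: eq_bigl => I; rewrite inE andbA andbb.
rewrite /Q -(pair_big_dep ok
  (fun (j : 'I_N.+1 * 'I_N.+1) (c : code G) => c \in codes G M (skel_size j.1) j.2)
  (fun j _ => bd j.1)) /=.
apply: (@le_trans _ _ (\sum_(j : 'I_N.+1 * 'I_N.+1) 2 * expR (- (beta * t0%:R)) * Z)); last first.
  rewrite sumr_const card_prod card_ord -[leLHS]mulr_natl natrM.
  move: (N.+1%:R : R) (expR _) (\sum_(J | _) _) => x y z.
  by rewrite expr2 !mulrA ![_ * 2]mulrC !mulrA.
rewrite big_mkcond /=; apply: ler_sum => -[t k] _; case: ifP => [/andP[/= tt hk]|_]; last first.
  by rewrite !mulr_ge0 ?expR_ge0.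
rewrite sumr_const -[leLHS]mulr_natl /bd mulrA ler_wpM2r //.
have n0 : (0 < skel_size t)%N by rewrite /skel_size muln_gt0 !addn1.
have cc : #|codes G M (skel_size t) k|%:R <= expR (eps * (t * D)%:R + 800 * l * (skel_size t)%:R).
  apply: le_trans (card_codes k D0 n0 l1 Dl isoB) _.
  by rewrite expRD; apply: ler_wpM2r; [apply: expR_ge0|apply: hk].
apply: le_trans (ler_wpM2r _ cc) _; first by rewrite addr_ge0 ?expR_ge0.
have bt : - (beta * t%:R) <= - (beta * t0%:R) by rewrite lerN2 ler_wpM2l // ler_nat.
rewrite mulrDr -!expRD (_ : 2 * _ = expR (- (beta * t0%:R)) + expR (- (beta * t0%:R))); last by ring.
by apply: lerD; rewrite ler_expR; [apply: le_trans (exponent1 tt) bt|apply: le_trans (exponent2 tt) bt].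
Qed.

End Assembly.

(** * Sparse independent sets *)

Section Sparse.
Variables (R : realType) (G : cayley) (a0 : dir G).
Local Notation T := (vert G).
Local Notation D := #|dir G|.

Lemma card_par : (#|[set x : T | ~~ par x]|.*2 = #|T|)%N.
Proof.
rewrite -cardsT -(cardsID [set x : T | ~~ par x] [set: T]) setTI -addnn; congr (_ + _)%N.
rewrite -(card_imset _ (@st_inj G a0)); apply: eq_card => x.
rewrite !inE negbK andbT; apply/imsetP/idP => [[y]|px].
  by rewrite inE => py ->; rewrite parS.
by exists (st x (op a0)); rewrite ?stKV // inE parS px.
Qed.

Definition free (A : {set T}) := [set x : T | ~~ par x & x \notin nbs A].

Lemma sum_fiber (A : {set T}) (y : R) : (forall x, x \in A -> par x) -> ind A ->
  \sum_(I | ind I && (odds I == A)) y ^+ #|evens I| = (1 + y) ^+ #|free A|.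
Proof.
move=> pA iA; rewrite -sum_subsets.
have oAE (E : {set T}) : E \subset free A -> odds (A :|: E) = A /\ evens (A :|: E) = E.
  move=> /subsetP EU; split; apply/setP => x; rewrite !inE; apply/idP/idP.
  - by move=> /andP[/orP[//|/EU]]; rewrite inE => /andP[/negbTE ->].
  - by move=> xA; rewrite xA pA.
  - by move=> /andP[/orP[/pA ->|]].
  - by move=> xE; rewrite xE orbT /=; have := EU _ xE; rewrite inE => /andP[].
rewrite (reindex_onto (fun E => A :|: E) (@evens G)) /=; last first.
  move=> I /andP[_ /eqP <-]; apply/setP => x; rewrite !inE.
  by case: (par x); rewrite ?andbT ?andbF ?orbF.
apply: eq_big => [E|E /andP[_ /eqP ->]] //.
apply/idP/idP => [/andP[/andP[iI /eqP oI] /eqP eI]|EU].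
  apply/subsetP => x xE; have : x \in evens (A :|: E) by rewrite eI.
  rewrite !inE => /andP[_ ->] /=; apply/negP => /existsP[a aA].
  have /indP h := iI; have := h x a; rewrite !inE xE orbT aA => /(_ isT) //.
have [-> ->] := oAE _ EU; rewrite !eqxx !andbT; apply/indP => x a; rewrite !inE.
have fr z b : z \in E -> st z b \notin A.
  move=> /(subsetP EU); rewrite !inE => /andP[_]; apply: contra => h; by apply/existsP; exists b.
have evE z : z \in E -> ~~ par z by move=> /(subsetP EU); rewrite inE => /andP[].
rewrite negb_or => /orP[xA|xE].
  have /indP h := iA; rewrite h //=; apply/negP => aE.
  by have := fr _ (op a) aE; rewrite stK xA.
by rewrite fr //=; apply/negP => /evE; rewrite parS evE.
Qed.

(** For a fixed odd part, even parts of size at most [h] weigh at most [2 ^+ h] times their weight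
    at activity [lam / 2]. The unrestricted even parts give [(1 + lam)] to the number of free even
    vertices, and at most [D * h] of the even vertices are blocked. *)
Lemma sparse_sum (lam : R) h : 0 <= lam ->
  \sum_(I : {set T} | [&& ind I, (#|odds I| <= h)%N & (#|evens I| <= h)%N]) lam ^+ #|I| <=
  2 ^+ h * ((1 + lam / 2) / (1 + lam)) ^+ (#|T| %/ 2 - D * h) * \sum_(J | ind (G := G) J) lam ^+ #|J|.
Proof.
move=> lam0; have l1 : 0 < 1 + lam by rewrite ltr_pwDl.
have card_oe (I : {set T}) : (#|I| = #|odds I| + #|evens I|)%N.
  rewrite -(cardsID [set x : T | par x] I); congr (_ + _)%N; apply: eq_card => x; rewrite !inE //.
  by rewrite andbC.
set rr := (1 + lam / 2) / (1 + lam).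
have rr0 : 0 <= rr by rewrite divr_ge0 ?(ltW l1) // addr_ge0 // divr_ge0.
have rr1 : rr <= 1 by rewrite ler_pdivrMr // mul1r lerD2l ler_pdivrMr // ler_peMr // ler1n.
rewrite (partition_big (@odds G) predT) //= [X in _ <= _ * X](partition_big (@odds G) predT) //=.
rewrite mulr_sumr; apply: ler_sum => A _.
have [I0 /and3P[/and3P[iI hA _] hE /eqP oA]|none] := pickP (fun I : {set T} =>
    [&& [&& ind I, (#|odds I| <= h)%N & (#|evens I| <= h)%N], true & odds I == A]); last first.
  rewrite big_pred0; last by move=> I; have := none I; rewrite /= => ->.
  rewrite !mulr_ge0 ?exprn_ge0 //; apply: sumr_ge0 => I _; exact: exprn_ge0.
have pA x : x \in A -> par x by rewrite -oA inE => /andP[].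
have iA : ind A.
  by apply/indP => x a xA; apply/negP => /pA; rewrite parS pA.
rewrite oA in hA.
have -> : \sum_(I | ind I && (odds I == A)) lam ^+ #|I| = lam ^+ #|A| * (1 + lam) ^+ #|free A|.
  rewrite -(sum_fiber _ pA iA) mulr_sumr; apply: eq_bigr => I /andP[_ /eqP oI].
  by rewrite card_oe oI exprD.
apply: (@le_trans _ _ (lam ^+ #|A| * 2 ^+ h * \sum_(I | ind I && (odds I == A)) (lam / 2) ^+ #|evens I|)).
  rewrite mulr_sumr big_mkcond [leRHS]big_mkcond /=; apply: ler_sum => I _.
  have pos : 0 <= lam ^+ #|A| * 2 ^+ h * (lam / 2) ^+ #|evens I|.
    by rewrite !mulr_ge0 ?exprn_ge0 // divr_ge0.
  case: ifP => [/andP[/and3P[-> _ hI] /eqP oI]|_]; last by case: ifP.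
  rewrite oI eqxx /= card_oe oI exprD -mulrA ler_wpM2l ?exprn_ge0 //.
  rewrite expr_div_n mulrCA ler_peMr ?exprn_ge0 // ler_pdivlMr ?exprn_gt0 // mul1r.
  by rewrite ler_weXn2l // ler1n.
rewrite sum_fiber // [leRHS]mulrCA -!mulrA ler_wpM2l ?exprn_ge0 // ler_wpM2l ?exprn_ge0 //.
have -> : (1 + lam / 2) = rr * (1 + lam) by rewrite /rr divfK // gt_eqF.
rewrite exprMn ler_wpM2r ?exprn_ge0 ?(ltW l1) //; apply: ler_wiXn2l => //.
rewrite -card_par divn2 doubleK leq_subLR.
apply: (@leq_trans (#|nbs A| + #|free A|)); last first.
  by rewrite leq_add2r (leq_trans (card_nbs A)) // leq_mul2l hA orbT.
apply: leq_trans (leq_card_setU _ _).1; apply: subset_leq_card; apply/subsetP => x.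
by rewrite in_setU [x \in free A]in_set in_set => ->; case: (x \in nbs A).
Qed.

End Sparse.

(** * Choice of a contour *)

Section Contour.
Variables (R : realType) (G : cayley).
Local Notation T := (vert G).
Local Notation D := #|dir G|.
Local Notation N := #|T|.
Variables (eps : R) (Lb L W t0 : nat).
Hypothesis D0 : (0 < D)%N.
Hypothesis eps0 : 0 < eps.
Hypothesis fillable : forall X C : {set T}, closed X -> C \in clusters X -> (cgam X C < Lb)%N ->
  exists Y : {set T}, [/\ forall x a,
     ((x \in Y) != (st x a \in Y)) = ((x \in X) != (st x a \in X)) && (x \in C),
     (#|Y| <= 4 * gam Y ^ 2)%N & (D * D <= (gam Y).*2)%N].
Hypothesis hLb : 2 * (1 + ln N%:R) <= eps * Lb%:R.
Hypothesis hw : forall w : R, eps * (D * D)%:R <= 2 * w ->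
  4 * w ^+ 2 <= eps ^+ 2 * ((16 * D)%:R^-1 / 2 * expR ((w - 1) / 2)).
Hypothesis iso : forall Y : {set T}, (#|Y| * #|~: Y| <= N * (L * gam Y))%N.
Hypothesis L0 : (0 < L)%N.
Hypothesis NLW : N = (L * W)%N.
Hypothesis W0 : (0 < W)%N.
Hypothesis t0W : (32 * (D * D) * t0 <= W)%N.

Lemma large_gam (Y : {set T}) t : gam Y = (t * D)%N ->
  (N <= 16 * D * #|Y|)%N -> (N <= 16 * D * #|~: Y|)%N -> (t0 <= t)%N.
Proof.
move=> gY; have := iso Y; rewrite gY; have := cardsC Y.
move: #|Y| #|~: Y| => y z e h h1 h2.
have N0 : (0 < N)%N by rewrite NLW muln_gt0 L0.
have e1 : (N * N <= 32 * D * (y * z))%N.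
  case: (leqP y z) => yz.
    have : (N * N <= 2 * z * (16 * D * y))%N by apply: leq_mul => //; rewrite -e; lia.
    by clear; nia.
  have : (N * N <= 2 * y * (16 * D * z))%N by apply: leq_mul => //; rewrite -e; lia.
  by clear; nia.
have e2 : (N * N <= N * (32 * D * (L * (t * D))))%N.
  apply: leq_trans e1 _; rewrite [(N * _)%N]mulnCA leq_mul2l h orbT //.
rewrite leq_pmul2l // in e2; rewrite NLW in e2.
have e3 : (W <= 32 * (D * D) * t)%N.
  by rewrite -(leq_pmul2l L0); apply: leq_trans e2 _; clear; nia.
have DD : (0 < 32 * (D * D))%N by rewrite !muln_gt0 D0.
by rewrite -(leq_pmul2l DD); apply: leq_trans t0W e3.
Qed.

Lemma contour_exists (E : {set T}) : exists X' : {set T}, forall I : {set T}, ind I -> evens I = E ->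
  (N <= 8 * D * #|evens I|)%N -> (N <= 8 * D * #|odds I|)%N ->
  agrees (region E) X' /\ exists t, [/\ (t0 <= t <= N)%N, gam X' = (t * D)%N & few_clusters eps X'].
Proof.
(* The region depends on [E] only, but its complement is known to be large through the odd part of
   some admissible set; any one with even part [E] serves. *)
have [[I0 [iI eE hE hO]]|none] := pselect (exists I : {set T}, [/\ ind I, evens I = E,
  (N <= 8 * D * #|evens I|)%N & (N <= 8 * D * #|odds I|)%N]); last first.
  by exists set0 => I iI eI h1 h2; case: none; exists I.
have clX := region_closed I0; rewrite eE in clX.
(* There are at most [N] clusters, so the budget is at most [A * N = V]. The initial [N / (8 D)]
   vertices on each side are [2 * V], and [V] survives the filling. *)
pose A : R := (16 * D)%:R^-1; pose V : R := N%:R / (16 * D)%:R.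
have D16 : 0 < (16 * D)%:R :> R by rewrite ltr0n muln_gt0.
have A0 : 0 <= A by rewrite invr_ge0 ltW.
have sN : Num.sqrt (N%:R * #|clusters (region E)|%:R) <= N%:R :> R.
  rewrite -[leRHS]ger0_norm ?ler0n // -sqrtr_sqr; apply: ler_wsqrtr.
  by rewrite expr2 ler_wpM2l ?ler0n // ler_nat card_clusters.
have VA n : (N <= 8 * D * n)%N -> V + A * Num.sqrt (N%:R * #|clusters (region E)|%:R) <= n%:R.
  move=> hn; apply: (@le_trans _ _ (2 * V)).
    have eV : V = A * N%:R by rewrite mulrC.
    have -> : 2 * V = V + A * N%:R by rewrite -eV; ring.
    by rewrite lerD2l ler_wpM2l.
  rewrite /V mulrA ler_pdivrMr // -!natrM ler_nat mulnC; move: hn; clear; nia.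
have [||X' [agr few c1 c2]] := @greedy_fill R G eps A V Lb D0 eps0 A0 fillable hLb hw (region E) clX.
- by apply: VA; apply: leq_trans hE _; rewrite leq_mul2l eE subset_leq_card ?orbT // -eE evens_region.
- apply: VA; apply: leq_trans hO _; rewrite leq_mul2l -eE subset_leq_card ?orbT //; exact: odds_region.
have clX' := agrees_closed D0 clX agr.
exists X' => I _ _ _ _; split=> //; have dg := gam_diff clX'.
have eo : (#|evens X'| <= #|odds X'|)%N by rewrite -(leq_pmul2r D0) -dg leq_addl.
have gX : gam X' = ((#|odds X'| - #|evens X'|) * D)%N by rewrite mulnBl -dg addnK.
have VN n : V <= n%:R -> (N <= 16 * D * n)%N.
  by rewrite /V ler_pdivrMr // -natrM ler_nat mulnC.
exists (#|odds X'| - #|evens X'|)%N; split=> //; apply/andP; split.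
  exact: (large_gam gX (VN _ c1) (VN _ c2)).
by apply: leq_trans (leq_subr _ _) _; apply: max_card.
Qed.

Lemma contour_choice : exists Phi : {set T} -> {set T}, forall I : {set T}, ind I ->
  (N <= 8 * D * #|evens I|)%N -> (N <= 8 * D * #|odds I|)%N ->
  agrees (region (evens I)) (Phi (evens I)) /\
  exists t, [/\ (t0 <= t <= N)%N, gam (Phi (evens I)) = (t * D)%N & few_clusters eps (Phi (evens I))].
Proof.
have [Phi hPhi] := choice contour_exists.
by exists Phi => I iI h1 h2; apply: (hPhi _ I).
Qed.

End Contour.

(** * Balanced sets are a bottleneck *)

Section CayleyMixing.
Variables (R : realType) (G : cayley) (a0 : dir G) (e : rel (vert G)).
Local Notation T := (vert G).
Hypothesis eE : forall x y, e x y = [exists a, st x a == y].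

Lemma indep_ind (I : {set T}) : indep e I = ind I.
Proof.
apply/forall_inP/indP => [h x a xI|h x xI].
  apply/negP => aI; have /forall_inP/(_ _ aI) := h x xI.
  by rewrite eE => /existsP; apply; exists a.
apply/forall_inP => y yI; rewrite eE; apply/existsPn => a.
by apply: contraTneq yI => <-; apply: h.
Qed.

Definition translate a (I : {set T}) := [set x | st x a \in I].

Lemma translateK a : cancel (translate a) (translate (op a)).
Proof. by move=> I; apply/setP => x; rewrite !inE stKV. Qed.

Lemma translate_ind a I : ind (translate a I) = ind I.
Proof.
have h b (J : {set T}) : ind J -> ind (translate b J).
  by move=> /indP h; apply/indP => x c; rewrite !inE stC; apply: h.
by apply/idP/idP => /h // /(_ (op a)); rewrite translateK.
Qed.

Lemma card_translate a (I : {set T}) (Q : pred T) :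
  #|[set x in translate a I | Q (st x a)]| = #|[set x in I | Q x]|.
Proof.
rewrite -(card_imset _ (@st_inj G a)); apply: eq_card => x; rewrite !inE.
apply/imsetP/idP => [[y]|h]; first by rewrite !inE => h ->.
by exists (st x (op a)); rewrite ?inE stKV.
Qed.

Lemma translate_odds a (I : {set T}) : #|odds (translate a I)| = #|evens I|.
Proof.
rewrite -(card_translate a I (fun x => ~~ par x)); apply: eq_card => x.
by rewrite !inE parS negbK.
Qed.

Lemma translate_evens a (I : {set T}) : #|evens (translate a I)| = #|odds I|.
Proof.
rewrite -(card_translate a I (@par G)); apply: eq_card => x.
by rewrite !inE parS.
Qed.

Lemma card_translateT a (I : {set T}) : #|translate a I| = #|I|.
Proof.
rewrite -[RHS](_ : #|[set x in I | predT x]| = _); last by apply: eq_card => x; rewrite inE andbT.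
by rewrite -(card_translate a I predT); apply: eq_card => x; rewrite !inE andbT.
Qed.

(** The difference between odd and even counts falls by at least 2, and changing one vertex moves it
    by 1. *)
Lemma symdiff_crossing (I J : {set T}) : (#|evens I| < #|odds I|)%N -> (#|odds J| < #|evens J|)%N ->
  (1 < #|symdiff I J|)%N.
Proof.
move=> hI hJ.
have cD (A B : {set T}) : (#|A| <= #|B| + #|A :\: B|)%N.
  by rewrite -{1}(cardsID B A) leq_add2r subset_leq_card // subsetIr.
have cS : #|symdiff I J| = (#|I :\: J| + #|J :\: I|)%N.
  rewrite /symdiff cardsU disjoint_setI0 ?cards0 ?subn0 // disjoints_subset.
  by apply/subsetP => x; rewrite !inE => /andP[_ ->].
have h1 := cD (odds I) (odds J); have h2 := cD (evens J) (evens I).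
have h3 : (#|odds I :\: odds J| <= #|I :\: J|)%N.
  by apply/subset_leq_card/subsetP => x; rewrite !inE; case: (par x); rewrite ?andbF ?andbT.
have h4 : (#|evens J :\: evens I| <= #|J :\: I|)%N.
  by apply/subset_leq_card/subsetP => x; rewrite !inE; case: (par x); rewrite ?andbF ?andbT.
by rewrite cS; lia.
Qed.

Variables (lam : R).
Hypothesis lam0 : 0 < lam.
Local Notation Z := (\sum_(J | ind (G := G) J) lam ^+ #|J|).

Lemma sum_indset (Q : pred {set T}) :
  \sum_(J : indepset e | Q (val J)) lam ^+ #|val J| = \sum_(J | ind J && Q J) lam ^+ #|J|.
Proof.
rewrite -(big_sub_cond (indep e) Q (fun J : {set T} => lam ^+ #|J|)).
by apply: eq_bigl => J; rewrite -indep_ind.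
Qed.

Lemma cayley_mixing (th : R) : 1 <= th ->
  th * \sum_(J : {set T} | ind J && (#|evens J| == #|odds J|)) lam ^+ #|J| <= 1000^-1 * Z ->
  (th%:E <= mixing_time e lam)%E.
Proof.
move=> th1 h.
have Z0 := partition_gt0 e lam0.
have ZE : partition_function e lam = Z.
  rewrite /partition_function (sum_indset predT); apply: eq_bigl => J; exact: andbT.
rewrite -ZE in h.
have pE (Q : pred {set T}) : \sum_(J : indepset e | Q (val J)) hardcore lam J =
    (\sum_(J | ind J && Q J) lam ^+ #|J|) / partition_function e lam.
  by rewrite /hardcore -mulr_suml sum_indset.
have hB : th * \sum_(J : indepset e | [pred I | ~~ (#|evens (val I)| < #|odds (val I)|)%N &&
    ~~ (#|odds (val I)| < #|evens (val I)|)%N] J) hardcore lam J <= 1000^-1.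
  rewrite (pE (fun I => ~~ (#|evens I| < #|odds I|)%N && ~~ (#|odds I| < #|evens I|)%N)).
  rewrite mulrA ler_pdivrMr // (eq_bigl (fun J => ind J && (#|evens J| == #|odds J|))) // => J.
  by congr (_ && _); rewrite -!leqNgt eqn_leq andbC.
apply: (@mixing_bottleneck _ e R lam lam0 (fun I => (#|evens (val I)| < #|odds (val I)|)%N)
  (fun I => (#|odds (val I)| < #|evens (val I)|)%N)) => //.
- by move=> I J; apply: symdiff_crossing.
- rewrite (pE (fun I => (#|evens I| < #|odds I|)%N)) (pE (fun I => (#|odds I| < #|evens I|)%N)).
  congr (_ / _); rewrite (reindex (translate a0)) /=; last first.
    exists (translate (op a0)) => I _; first exact: translateK.
    by rewrite -{1}[a0]opK translateK.
  apply: eq_big => [I|I _]; last by rewrite card_translateT.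
  by rewrite translate_ind translate_odds translate_evens.
- exact: le_trans th1.
- apply: le_trans hB; rewrite ler_peMl //; apply: sumr_ge0 => J _; exact: hardcore_ge0.
Qed.

End CayleyMixing.

(** * Numerical estimates *)

Section Numerics.
Variable R : realType.

Lemma expR_ge_pow (x : R) n : (0 < n)%N -> 0 <= x -> (x / n%:R) ^+ n <= expR x.
Proof.
move=> n0 x0; have nR : n%:R != 0 :> R by rewrite pnatr_eq0 -lt0n.
have -> : expR x = expR (x / n%:R) ^+ n by rewrite -expRM_natl mulrC divfK.
rewrite lerXn2r ?nnegrE ?expR_ge0 ?divr_ge0 //.
by apply: le_trans (expR_ge1Dx _); rewrite lerDr.
Qed.

(** From [e^q >= (q / 64)^64]: the spare [q^16] must beat [2^(384 + 50)], which [q >= 2^28] ensures.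
    The left side bounds [4 * (q + 1)^48], hence twice the degree. *)
Lemma exp_dominates (q : R) : 2 ^+ 28 <= q -> 2 ^+ 50 * q ^+ 48 <= expR q.
Proof.
move=> hq; have q0 : 0 <= q by apply: le_trans hq; apply: exprn_ge0.
apply: le_trans (expR_ge_pow (n := 64) _ q0) => //.
have h16 : 2 ^+ 434 <= q ^+ 16 :> R.
  apply: (@le_trans _ _ ((2 ^+ 28) ^+ 16)).
    by rewrite -exprM ler_weXn2l ?ler1n.
  by rewrite lerXn2r ?nnegrE ?exprn_ge0.
have e64 : 64%:R = 2 ^+ 6 :> R by rewrite -natrX.
rewrite e64 expr_div_n -exprM ler_pdivlMr ?exprn_gt0 //.
rewrite mulrAC -exprD (_ : q ^+ 64 = q ^+ 16 * q ^+ 48); last by rewrite -exprD.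
by rewrite ler_wpM2r // exprn_ge0.
Qed.

Lemma degree_bound (q d : nat) : 2 ^+ 28 <= q%:R :> R -> (d < (q + 1) ^ 48)%N ->
  (2 * d.*2)%:R <= expR q%:R :> R.
Proof.
move=> hq hd; apply: le_trans (exp_dominates hq).
have q1 : (1 <= q)%N.
  rewrite -(ler_nat R); apply: le_trans hq; exact: exprn_ege1 (ler1n _ 2).
apply: (@le_trans _ _ (4 * (2 * q) ^ 48)%N%:R).
  rewrite ler_nat -mul2n mulnA leq_mul2l /=; apply: leq_trans (ltnW hd) _.
  by rewrite leq_exp2r //; lia.
rewrite natrM expnMn natrM natrX natrX mulrA ler_wpM2r ?exprn_ge0 //.
have e4 : 4%:R = 2 ^+ 2 :> R by rewrite expr2 -natrM.
by rewrite e4 -exprD ler_weXn2l ?ler1n.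
Qed.

(** The premise forces [w >= 200 * q], as [eps * D * D] is at least of order [q^22]. All polynomial
    factors in [q] and [D] are at most [expR (55 * q)], and [w ^+ 2] costs [expR (w / 8)] up to a
    constant; both fit into [expR (w / 2)]. *)
Lemma hw_bound (q D w y eps : R) : 200 <= q -> y * q = 1 -> 2 * q ^+ 48 <= D -> D <= expR q ->
  eps = y ^+ 26 / (8 * D) -> eps * (D * D) <= 2 * w ->
  4 * w ^+ 2 <= eps ^+ 2 * ((16 * D)^-1 / 2 * expR ((w - 1) / 2)).
Proof.
move=> q200 yq Dlo Dhi heps hw.
have q0 : 0 < q by lra.
have y0 : 0 < y by rewrite -(pmulr_lgt0 _ q0) yq ltr01.
have D0 : 0 < D by apply: lt_le_trans Dlo; rewrite mulr_gt0 // exprn_gt0.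
have ey : eps * (q ^+ 26 * (8 * D)) = 1.
  rewrite heps (_ : _ * _ = (y * q) ^+ 26); first by rewrite yq expr1n.
  by rewrite exprMn; field; rewrite gt_eqF.
have e0 : 0 < eps by rewrite heps divr_gt0 ?exprn_gt0 // mulr_gt0.
have wq : 200 * q <= w.
  have h1 : eps * (D * D) * 8 = y ^+ 26 * D by rewrite heps; field; rewrite gt_eqF.
  have h2 : 2 * q ^+ 22 <= y ^+ 26 * D.
    apply: (@le_trans _ _ (y ^+ 26 * (2 * q ^+ 48))); last by rewrite ler_pM2l ?exprn_gt0.
    rewrite (_ : y ^+ 26 * (2 * q ^+ 48) = 2 * ((y * q) ^+ 26 * q ^+ 22)); last by ring.
    by rewrite yq expr1n mul1r.
  have h3 : q * (200 * 8) <= q ^+ 22.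
    have s1 : 200 * q <= q * q by rewrite ler_wpM2r // ltW.
    have s2 : 200 * (q * q) <= q * (q * q) by rewrite ler_wpM2r // mulr_ge0 // ltW.
    have s3 : q * (q * q) <= q ^+ 22.
      have e3 : q * (q * q) = q ^+ 3 by ring.
      by rewrite e3; apply: ler_weXn2l => //; lra.
    lra.
  lra.
have w0 : 0 < w by lra.
have ww : w ^+ 2 <= 2 ^+ 8 * expR (w / 8).
  have w8 : 0 <= w / 8 by apply: divr_ge0 => //; apply: ltW.
  have := @expR_ge_pow (w / 8) 2 isT w8.
  by rewrite (_ : (w / 8 / 2%:R) ^+ 2 = 256^-1 * w ^+ 2); [lra|field].
have key : 4 * w ^+ 2 * (q ^+ 26 * (8 * D)) ^+ 2 * (2 * (16 * D)) <= expR ((w - 1) / 2).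
  have -> : 4 * w ^+ 2 * (q ^+ 26 * (8 * D)) ^+ 2 * (2 * (16 * D)) = 2 ^+ 13 * (q ^+ 52 * (D ^+ 3 * w ^+ 2)).
    by rewrite exprMn -exprM; ring.
  apply: (@le_trans _ _ (2 ^+ 13 * (expR (52 * q) * (expR (3 * q) * (2 ^+ 8 * expR (w / 8)))))).
    rewrite ler_wpM2l ?exprn_ge0 //; apply: ler_pM.
    - by rewrite exprn_ge0 // ltW.
    - by rewrite mulr_ge0 // exprn_ge0 // ltW.
    - rewrite expRM_natl lerXn2r ?nnegrE ?expR_ge0 ?(ltW q0) //.
      by apply: le_trans (expR_ge1Dx _); rewrite lerDr.
    apply: ler_pM => //; first by apply: exprn_ge0; apply: ltW.
      by apply: exprn_ge0; apply: ltW.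
    by rewrite expRM_natl lerXn2r ?nnegrE ?expR_ge0 ?(ltW D0).
  have e2 : 2 ^+ 13 * 2 ^+ 8 <= expR 21 :> R.
    rewrite -exprD -[X in expR X]mulr1 expRM_natl lerXn2r ?nnegrE ?expR_ge0 //.
    by apply: le_trans (expR_ge1Dx _); rewrite -[2]/(1 + 1).
  rewrite (_ : _ * _ = 2 ^+ 13 * 2 ^+ 8 * (expR (52 * q) * expR (3 * q) * expR (w / 8))); last first.
    by move: (expR _) (expR _) (expR _) => a b c; ring.
  apply: le_trans (ler_wpM2r _ e2) _; first by rewrite !mulr_ge0 ?expR_ge0.
  by rewrite -!expRD ler_expR; lra.
rewrite -(ler_pM2r (exprn_gt0 2 (_ : 0 < q ^+ 26 * (8 * D)))); last by rewrite !mulr_gt0 ?exprn_gt0.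
rewrite [leRHS]mulrAC -exprMn ey expr1n mul1r.
have D16 : 0 < 2 * (16 * D) by rewrite !mulr_gt0.
rewrite -(ler_pM2r D16); apply: le_trans key _.
rewrite (_ : (16 * D)^-1 / 2 * expR ((w - 1) / 2) * (2 * (16 * D)) = expR ((w - 1) / 2)) //.
by field; rewrite gt_eqF.
Qed.

Section Exponents.
Variables (Q y t n a b : R).
Hypothesis Q200 : 200 <= Q.
Hypothesis yQ : y * Q = 1.
Hypothesis t0 : 0 <= t.
Hypothesis n0 : 0 <= n.
Hypothesis n_le : n <= 6 * (t * y ^+ 29).

Let Q0 : 0 < Q. Proof. by apply: lt_le_trans Q200; rewrite ltr0n. Qed.
Let y0 : 0 < y. Proof. by rewrite -(pmulr_lgt0 _ Q0) yQ ltr01. Qed.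
Let y200 : y * 200 <= 1.
Proof. by have := ler_wpM2l (ltW y0) Q200; rewrite yQ. Qed.

Let u := t * y ^+ 26.
Let v := t * y ^+ 12.
Let u0 : 0 <= u. Proof. by apply: mulr_ge0 => //; apply: exprn_ge0; apply: ltW. Qed.
Let v0 : 0 <= v. Proof. by apply: mulr_ge0 => //; apply: exprn_ge0; apply: ltW. Qed.

Let uv : 200 * u <= v.
Proof.
have y1 : y ^+ 13 <= 1.
  by rewrite exprn_ile1 ?(ltW y0) //; have := y200; have := y0; lra.
have h1 := ler_wpM2l v0 y1; have h2 := ler_wpM2l (mulr_ge0 v0 (exprn_ge0 13 (ltW y0))) y200.
have e1 : v * y ^+ 13 * (y * 200) = 200 * u by rewrite /v /u; ring.
by rewrite e1 in h2; lra.
Qed.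

Let Qn : 800 * Q * n <= 12 / 100 * u.
Proof.
have h1 := ler_wpM2l (ltW Q0) n_le.
have e1 : Q * (6 * (t * y ^+ 29)) = y * Q * (6 * (y ^+ 2 * u)) by rewrite /u; ring.
rewrite e1 yQ mul1r in h1.
have h2 := ler_wpM2r u0 y200; have h3 := ler_wpM2r (mulr_ge0 (ltW y0) u0) y200.
rewrite (_ : y * 200 * (y * u) = 200 * (y ^+ 2 * u)) in h3; last by ring.
lra.
Qed.

(** In units of [u = t * y ^+ 26]: positions cost 1/8, codes 12/100, and the gain is at least 3/4,
    since rounding down loses at most a quarter of [t * y ^+ 14 >= 4]. The net gain is at least
    1/2. *)
Lemma exponent_case1 : t * y ^+ 14 <= b + 1 -> 4 <= t * y ^+ 14 ->
  8^-1 * (t * y ^+ 26) + 800 * Q * n - y ^+ 12 * b <= - (y ^+ 26 / 2 * t).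
Proof.
move=> fl four; have h := Qn.
have h3 : 3 / 4 * (t * y ^+ 14) <= b by lra.
have := ler_wpM2l (exprn_ge0 12 (ltW y0)) h3.
have -> : y ^+ 12 * (3 / 4 * (t * y ^+ 14)) = 3 / 4 * u by rewrite /u; ring.
have -> : y ^+ 26 / 2 * t = u / 2 by rewrite /u; ring.
by rewrite -/u; have := u0; lra.
Qed.

Lemma exponent_case2 : a <= 2 * t * y ^+ 14 ->
  8^-1 * (t * y ^+ 26) + 800 * Q * n + (n + 6 * Q * a - y ^+ 12 * t) <= - (y ^+ 26 / 2 * t).
Proof.
move=> ha; have h := Qn.
have nq : n <= 800 * Q * n by have := ler_wpM2r n0 Q200; have := n0; lra.
have h2 : 6 * Q * a <= 6 / 100 * v.
  have := ler_wpM2l (ltW Q0) ha.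
  have -> : Q * (2 * t * y ^+ 14) = y * Q * (2 * (y * v)) by rewrite /v; ring.
  by rewrite yQ mul1r; have := ler_wpM2l v0 y200; lra.
have -> : y ^+ 26 / 2 * t = u / 2 by rewrite /u; ring.
have -> : y ^+ 12 * t = v by rewrite /v mulrC.
by rewrite -/u; have := u0; have := v0; have := uv; lra.
Qed.

End Exponents.

(** For [d >= 2048] the contour exponent [W / (512 d^3)] is at least [4 * W / d^4], which leaves
    room for the polynomial factors in [N]. The value 11 makes each of the two parts at most
    [1/2000]. *)
Lemma final_exponents (d L W : R) : 2048 <= d -> 1 <= L -> L * d ^+ 8 <= W ->
  W / d ^+ 4 - W / (8 * d) <= - 11 /\ W / d ^+ 4 + 5 * (d * L) - W / (512 * d ^+ 3) <= - 11.
Proof.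
move=> hd hL hW; have d0 : 0 < d by apply: lt_le_trans hd; rewrite ltr0n.
have dn0 : d != 0 by rewrite gt_eqF.
pose w := W / d ^+ 4; have eW : W = w * d ^+ 4 by rewrite /w divfK // expf_neq0.
have d4 : 0 < d ^+ 4 by apply: exprn_gt0.
have hw : L * d ^+ 4 <= w.
  rewrite -(ler_pM2r d4) -eW -mulrA -exprD //.
have d3 : d <= d ^+ 3.
  by rewrite -[leLHS]expr1; apply: ler_weXn2l => //; lra.
have dd : 2048 * d <= d ^+ 4.
  have := ler_wpM2l (ltW d0) d3; rewrite -exprS; have := ler_wpM2r (ltW d0) hd.
  have : d * d <= d * d ^+ 3 by rewrite ler_pM2l.
  by rewrite -exprS; lra.
have hLd : 2048 * (d * L) <= L * d ^+ 4.
  by have := ler_wpM2l (le_trans ler01 hL) dd; lra.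
have dL : 2048 <= d * L by have := ler_wpM2l (ltW d0) hL; lra.
have w0 : 0 <= w by lra.
have e1 : W / (8 * d) = w * d ^+ 3 / 8 by rewrite eW; field.
have e2 : W / (512 * d ^+ 3) = w * d / 512 by rewrite eW; field.
have h1 : w * 2048 <= w * d by rewrite ler_wpM2l.
have h2 : w * d <= w * d ^+ 3 by rewrite ler_wpM2l.
by rewrite e1 e2 -/w; split; lra.
Qed.

End Numerics.

(** * Mixing on the torus *)

Lemma remaining_evens a b c e : (c * (8 * e) <= b)%N -> b = (2 * a)%N -> (3 * b <= 8 * (a - e * c))%N.
Proof. by rewrite mulnCA [(c * e)%N]mulnC; move: (e * c)%N => p; lia. Qed.

Lemma threshold_le z d : (z <= d)%N -> (2048 <= d)%N -> (4 * z * (32 * (2 * d * (2 * d))) <= d ^ 8)%N.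
Proof.
move=> zd hd; apply: (@leq_trans (512 * d ^ 3)); first by rewrite !expnS expn0; nia.
apply: (@leq_trans (d * d ^ 3)); first by rewrite leq_mul2r (leq_trans _ hd) // orbT.
by rewrite -expnS leq_pexp2l // (leq_trans _ hd).
Qed.

Lemma square_const d : (2 * (32 * (2 * d * (2 * d))) = 256 * d ^ 2)%N.
Proof. by rewrite expnS expn1; lia. Qed.

Lemma quotient_double t W x : (0 < t)%N -> (W < t.+1 * x)%N -> (W <= t * (2 * x))%N.
Proof. by nia. Qed.

Lemma sum_subpred (R : numDomainType) (I : finType) (P Q : pred I) (F : I -> R) :
  (forall i, 0 <= F i) -> (forall i, P i -> Q i) -> \sum_(i | P i) F i <= \sum_(i | Q i) F i.
Proof.
move=> F0 PQ; rewrite big_mkcond [leRHS]big_mkcond; apply: ler_sum => i _.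
by case: ifP => [/PQ ->|_]; last case: ifP.
Qed.

Lemma ln_threshold d L : (2048 <= d)%N -> (4 * (d * L) * (d * (16 * d)) <= L * d ^ 8)%N.
Proof.
move=> hd; apply: (@leq_trans (L * (d * d ^ 3))); last first.
  by rewrite leq_mul2l -expnS leq_pexp2l ?orbT // (leq_trans _ hd).
rewrite (_ : 4 * (d * L) * (d * (16 * d)) = L * (64 * d ^ 3))%N; last by rewrite !expnS expn0; lia.
by rewrite leq_mul2l leq_mul2r (leq_trans _ hd) ?orbT.
Qed.

Lemma expR1_le4 (R : realType) : expR 1 <= 4 :> R.
Proof.
have h : 1 - 2^-1 <= expR (- 2^-1) :> R by apply: expR_ge1Dx.
have e1 : expR 1 * (expR (- 2^-1) * expR (- 2^-1)) = 1 :> R.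
  by rewrite -!expRD (_ : 1 + (- 2^-1 + - 2^-1) = 0) ?expR0 //; field.
have h2 : 4^-1 <= expR (- 2^-1) * expR (- 2^-1) :> R.
  by rewrite (_ : 4^-1 = (1 - 2^-1) * (1 - 2^-1)); [apply: ler_pM => //; lra|field].
by have := ler_wpM2l (expR_ge0 1) h2; rewrite e1; lra.
Qed.

(* With [q] close to [d ^ (1/48)], the gain per unit of boundary is [q ^- 12],
   or [q ^- 26] in the undetermined case; the skeleton costs about [q ^- 28] and
   the positions of the clusters [q ^- 26 / 8]. *)
Section TorusMixing.
Variables (R : realType) (d l q : nat) (lam : R).
Hypothesis l_gt0 : (0 < l)%N.
Hypothesis l_even : ~~ odd l.
Hypothesis q_large : 2 ^+ 28 <= q%:R :> R.
Hypothesis qd : (q ^ 48 <= d)%N.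
Hypothesis dq : (d < (q + 1) ^ 48)%N.
Hypothesis l_gt1 : (2 <= l)%N.
Local Notation L := l.+2.
Local Notation G := (torusG d l_gt0 l_even).
Local Notation T := (vert G).
Local Notation D := #|dir G|.
Local Notation N := #|T|.
Local Notation W := (L ^ d.-1)%N.
Local Notation y := (q%:R^-1 : R).
Hypothesis lam0 : 0 < lam.
Hypothesis lam_large : 2 * y ^+ 12 <= lam.
Local Notation Z := (\sum_(J | ind (G := G) J) lam ^+ #|J|).
Local Notation t0 := (W %/ (32 * (D * D)))%N.

Let q2048 : (2048 <= q)%N.
Proof.
rewrite -(ler_nat R); apply: le_trans q_large.
by rewrite (_ : 2048%:R = 2 ^+ 11); [rewrite ler_weXn2l ?ler1n|rewrite -natrX].
Qed.

Let q0 : 0 < q%:R :> R. Proof. by rewrite ltr0n; apply: leq_trans q2048. Qed.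
Let y0 : 0 < y. Proof. by rewrite invr_gt0. Qed.
Let yq : y * q%:R = 1. Proof. by rewrite mulVf // gt_eqF. Qed.

Let y1 : y <= 1. Proof. by rewrite invf_le1 // ler1n; apply: leq_trans q2048. Qed.

Let qkd k : (k <= 48)%N -> (q ^ k <= d)%N.
Proof. by move=> hk; apply: leq_trans qd; rewrite leq_pexp2l //; apply: leq_trans q2048. Qed.

Let d2048 : (2048 <= d)%N.
Proof. by apply: leq_trans q2048 _; rewrite -[q]expn1; apply: qkd. Qed.

Let d0 : 0 < d%:R :> R. Proof. by rewrite ltr0n; apply: leq_trans d2048. Qed.

Let yd k : (k <= 48)%N -> d%:R^-1 <= y ^+ k.
Proof.
by move=> hk; rewrite exprVn lef_pV2 ?posrE ?exprn_gt0 // -natrX ler_nat; apply: qkd.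
Qed.

Let d200 : (200 <= d)%N. Proof. by apply: leq_trans d2048. Qed.
Let DE : D = d.*2. Proof. exact: torus_deg. Qed.
Let D2 : (D = 2 * d)%N. Proof. by rewrite DE mul2n. Qed.
Let W_large : (L * d ^ 8 <= W)%N. Proof. by apply: side_growth => //; apply: leq_trans d2048. Qed.
Let W0 : (0 < W)%N. Proof. by rewrite expn_gt0. Qed.

Let NLW : N = (L * W)%N.
Proof. by rewrite [LHS]torus_card -expnS prednK //; apply: leq_trans d2048. Qed.

Let WR : L%:R * d%:R ^+ 8 <= W%:R :> R. Proof. by rewrite -natrX -natrM ler_nat. Qed.
Let L4 : 4 <= L%:R :> R. Proof. by rewrite ler_nat. Qed.

Let N_le : N%:R <= expR (d%:R * L%:R) :> R.
Proof.
have -> : N = (L ^ d)%N by apply: torus_card.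
rewrite natrX expRM_natl lerXn2r ?nnegrE ?expR_ge0 ?ler0n //.
by apply: le_trans (expR_ge1Dx _); rewrite lerDr.
Qed.

Let N0 : 0 < N%:R :> R. Proof. by rewrite ltr0n NLW muln_gt0. Qed.

Let y12 : y ^+ 12 <= 2^-1.
Proof.
apply: (@le_trans _ _ y); first by rewrite -[leRHS]expr1; apply: ler_wiXn2l => //; apply: ltW.
by rewrite lef_pV2 ?posrE // ler_nat; apply: leq_trans q2048.
Qed.

Let rho0 : 0 < y ^+ 12. Proof. exact: exprn_gt0. Qed.

(** With [rho = y ^+ 12 <= 1/2], [e^rho <= 1 / (1 - rho) <= 1 + 2 * rho]. *)
Let rho_lam : expR (y ^+ 12) <= 1 + lam.
Proof.
have h : 1 - y ^+ 12 <= expR (- y ^+ 12) by apply: expR_ge1Dx.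
have h0 : 0 < 1 - y ^+ 12 by move: y12 rho0; lra.
rewrite -[leLHS]invrK -expRN -div1r ler_pdivrMr ?expR_gt0 //.
have := ler_wpM2l (ltW (addr_gt0 ltr01 lam0)) h.
apply: le_trans; have := ler_wpM2l (ltW lam0) y12.
by move: (y ^+ 12) lam_large y12 rho0 lam0 => rho; lra.
Qed.

Let half_le : (1 + lam / 2) / (1 + lam) <= expR (- (y ^+ 12 / 2)).
Proof.
apply: le_trans (expR_ge1Dx _).
rewrite ler_pdivrMr ?addr_gt0 //; have := ler_wpM2l (ltW lam0) y12.
by move: (y ^+ 12) lam_large y12 rho0 lam0 => rho; lra.
Qed.

Lemma sparse_numeric (h := (N %/ (8 * D))%N) :
  2 ^+ h * ((1 + lam / 2) / (1 + lam)) ^+ (N %/ 2 - D * h) <= expR (- (W%:R / (8 * d%:R))).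
Proof.
have Nh : (h * (8 * D) <= N)%N by apply: leq_trunc_div.
have even : (N = 2 * (N %/ 2))%N.
  have a0 : dir G by exact: (Ordinal (leq_trans (isT : 0 < 200)%N d200), true).
  by rewrite -(card_par a0) divn2 doubleK mul2n.
have hN : (8 * d)%:R * (2 * h%:R) <= N%:R :> R.
  by rewrite -!natrM ler_nat; apply: leq_trans Nh; rewrite D2; clear; nia.
have nN : 3 * N%:R <= 8 * (N %/ 2 - D * h)%:R :> R.
  by rewrite -!natrM ler_nat; apply: remaining_evens.
(* At least [3 N / 8] even vertices remain free and [y ^+ 12 >= 1 / d], so the loss is at least
   [3 N / (16 d)], while [h <= N / (16 d)]. *)
apply: (@le_trans _ _ (expR h%:R * expR (- (y ^+ 12 / 2)) ^+ (N %/ 2 - D * h))).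
  apply: ler_pM; rewrite ?exprn_ge0 // ?divr_ge0 ?addr_ge0 ?divr_ge0 ?(ltW lam0) //.
    rewrite -[h%:R]mulr1 expRM_natl lerXn2r ?nnegrE ?expR_ge0 //.
    by apply: le_trans (expR_ge1Dx _); rewrite -[2]/(1 + 1).
  by rewrite lerXn2r ?nnegrE ?expR_ge0 ?divr_ge0 ?addr_ge0 ?divr_ge0 ?(ltW lam0).
rewrite -expRM_natl -expRD ler_expR.
have WN : W%:R <= N%:R :> R by rewrite ler_nat NLW leq_pmull.
have hd : h%:R <= N%:R / (16 * d%:R) :> R.
  by rewrite ler_pdivlMr ?mulr_gt0 //; move: hN; rewrite natrM; lra.
have h12 : 3 / 16 * N%:R * d%:R^-1 <= (N %/ 2 - D * h)%:R * (y ^+ 12 / 2).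
  have := @yd 12 isT; move: nN d0 rho0 N0; rewrite -invr_gt0.
  move: (N %/ 2 - D * h)%:R N%:R d%:R^-1 (y ^+ 12) => n m e rho h1 e0 r0 m0 h2.
  have := ler_wpM2r (ltW r0) h1; have := ler_wpM2l (ltW m0) h2; lra.
have e1 : N%:R / (16 * d%:R) = 1 / 16 * (N%:R * d%:R^-1) :> R by field; rewrite gt_eqF.
have e2 : W%:R / (8 * d%:R) = 1 / 8 * (W%:R * d%:R^-1) :> R by field; rewrite gt_eqF.
rewrite e2; rewrite e1 in hd.
have := ler_wpM2r (_ : 0 <= d%:R^-1) WN; rewrite invr_ge0 ler0n => /(_ isT).
move: hd h12; rewrite mulrN -[3 / 16 * _ * _]mulrA; move: (W%:R / d%:R) (N%:R / d%:R) => w n; lra.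
Qed.

Let t0_large : (4 * q ^ 30 <= t0)%N.
Proof.
have DD : (0 < 32 * (D * D))%N by rewrite !muln_gt0 D2 muln_gt0 (leq_trans _ d2048).
rewrite leq_divRL // D2; apply: leq_trans W_large; apply: (@leq_trans (d ^ 8)); last by rewrite leq_pmull.
exact: threshold_le (qkd _) d2048.
Qed.

Lemma contour_numeric :
  2 * N.+1%:R ^+ 2 * expR (- (y ^+ 26 / 2 * t0%:R)) <= expR (5 * (d%:R * L%:R) - W%:R / (512 * d%:R ^+ 3)).
Proof.
have e1 : 2 <= expR 1 :> R by apply: le_trans (expR_ge1Dx _); rewrite -[2]/(1 + 1).
have hN : 2 * N.+1%:R ^+ 2 <= expR (3 + 2 * (d%:R * L%:R)) :> R.
  apply: (@le_trans _ _ (expR 1 * (expR 1 * expR (d%:R * L%:R)) ^+ 2)).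
    apply: ler_pM; rewrite ?exprn_ge0 // lerXn2r ?nnegrE ?mulr_ge0 ?expR_ge0 //.
    apply: (@le_trans _ _ (2 * N%:R)).
      by rewrite -natrM ler_nat mul2n -addnn -addn1 leq_add2l -(ltr_nat R).
    by apply: ler_pM; rewrite ?ler0n.
  by rewrite -expRD -expRM_natl -expRD ler_expR; lra.
apply: le_trans (ler_wpM2r (expR_ge0 _) hN) _; rewrite -expRD ler_expR.
have DD : (0 < 32 * (D * D))%N by rewrite !muln_gt0 D2 muln_gt0 (leq_trans _ d2048).
have tW : W%:R <= t0%:R * (256 * d%:R ^+ 2) :> R.
  rewrite -natrX -!natrM ler_nat.
  have tp : (0 < t0)%N.
    by apply: leq_trans t0_large; rewrite muln_gt0 expn_gt0 (leq_trans _ q2048).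
  apply: leq_trans (quotient_double tp (ltn_ceil W DD)) _.
  by rewrite leq_mul2l D2 square_const leqnn orbT.
have d3 : 3 <= d%:R * L%:R :> R.
  by rewrite -natrM ler_nat (leq_trans (_ : 3 <= 2048 * 1)%N) // leq_mul.
have h : W%:R / (512 * d%:R ^+ 3) <= y ^+ 26 / 2 * t0%:R.
  apply: (@le_trans _ _ (d%:R^-1 / 2 * t0%:R)); last first.
    by rewrite ler_wpM2r // ler_wpM2r ?invr_ge0 //; apply: yd.
  have p512 : 0 < 512 * d%:R ^+ 3 :> R by apply: mulr_gt0; [rewrite ltr0n|apply: exprn_gt0].
  rewrite (ler_pdivrMr _ _ p512).
  rewrite (_ : d%:R^-1 / 2 * t0%:R * (512 * d%:R ^+ 3) = t0%:R * (256 * d%:R ^+ 2)) //.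
  by field; rewrite gt_eqF.
lra.
Qed.

Let d_ge1 : (0 < d)%N. Proof. exact: leq_trans d2048. Qed.
Let a0 : dir G := (Ordinal d_ge1, true).

Lemma sparse_part :
  \sum_(I | [&& ind (G := G) I, (#|odds I| <= N %/ (8 * D))%N & (#|evens I| <= N %/ (8 * D))%N]) lam ^+ #|I|
  <= expR (- (W%:R / (8 * d%:R))) * Z.
Proof.
apply: le_trans (sparse_sum a0 _ (ltW lam0)) _.
rewrite ler_wpM2r ?sparse_numeric //.
by apply: sumr_ge0 => I _; rewrite exprn_ge0 // ltW.
Qed.

Let DR : D%:R = 2 * d%:R :> R. Proof. by rewrite D2 natrM. Qed.
Let D0 : 0 < D%:R :> R. Proof. by rewrite DR mulr_gt0. Qed.
Let eps : R := y ^+ 26 / (8 * D%:R).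
Let eps0 : 0 < eps. Proof. by rewrite divr_gt0 ?exprn_gt0 // mulr_gt0. Qed.
Let Dq : (2 * D)%:R <= expR q%:R :> R. Proof. by rewrite DE; apply: degree_bound. Qed.
Let q200 : 200 <= q%:R :> R. Proof. by rewrite ler_nat; apply: leq_trans q2048. Qed.

Let eps_large : 2 * (1 + ln N%:R) <= eps * W%:R.
Proof.
have h1 : ln N%:R <= d%:R * L%:R :> R by rewrite -ler_expR lnK ?posrE.
have h2 : (d%:R * (16 * d%:R))^-1 <= eps.
  rewrite invfM /eps DR (_ : 8 * (2 * d%:R) = 16 * d%:R) ?ler_wpM2r ?invr_ge0 ?mulr_ge0 //; last by ring.
  exact: yd.
have h3 : 4 * (d%:R * L%:R) <= (d%:R * (16 * d%:R))^-1 * W%:R :> R.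
  have p16 : 0 < d%:R * (16 * d%:R) :> R by rewrite !mulr_gt0 // ltr0n.
  rewrite [leRHS]mulrC (ler_pdivlMr _ _ p16); apply: le_trans WR.
  rewrite -natrX -!natrM ler_nat.
  exact: ln_threshold d2048.
have h4 := ler_wpM2r (ler0n R W) h2.
have d1 : 1 <= d%:R * L%:R :> R by rewrite -natrM ler1n muln_gt0 d_ge1.
lra.
Qed.

Lemma dense_part :
  \sum_(I | [&& ind (G := G) I, (N <= 8 * D * #|evens I|)%N & (N <= 8 * D * #|odds I|)%N]) lam ^+ #|I|
  <= expR (5 * (d%:R * L%:R) - W%:R / (512 * d%:R ^+ 3)) * Z.
Proof.
have Zge : 0 <= Z by apply: sumr_ge0 => I _; rewrite exprn_ge0 // ltW.
have Dn0 : (0 < D)%N by rewrite D2 muln_gt0.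
have qD k : (k <= 48)%N -> (2 * q ^ k <= D)%N by move=> hk; rewrite D2 leq_mul2l qkd.
have hw w : eps * (D * D)%:R <= 2 * w ->
    4 * w ^+ 2 <= eps ^+ 2 * ((16 * D)%:R^-1 / 2 * expR ((w - 1) / 2)).
  rewrite !natrM; apply: (@hw_bound R q%:R D%:R w y) => //.
    by rewrite -natrX -natrM ler_nat; apply: qD.
  by apply: le_trans Dq; rewrite ler_nat leq_pmull.
have [Phi hPhi] := contour_choice Dn0 eps0 (@torus_fill d l l_gt0 l_even d200) eps_large hw
  (@torus_iso d l l_gt0 l_even) (isT : (0 < L)%N) NLW W0 (leq_trans (eq_leq (mulnC _ _)) (leq_trunc_div W _)).
apply: le_trans (ler_wpM2r Zge contour_numeric).
have q1 : (0 < q)%N by apply: leq_trans q2048.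
have tq t : (t0 <= t)%N -> (4 * q ^ 30 <= t)%N by apply: leq_trans.
have yqk k : (q ^ k)%:R * y ^+ k = 1 by rewrite mulrC natrX -exprMn yq expr1n.
have y0' := ltW y0.
have div_le m k : (m %/ q ^ k)%:R <= m%:R * y ^+ k.
  have := ler_wpM2r (exprn_ge0 k y0') (_ : (m %/ q ^ k)%:R * (q ^ k)%:R <= m%:R).
  by rewrite -mulrA yqk mulr1; apply; rewrite -natrM ler_nat leq_trunc_div.
have one t k c : (c * q ^ k <= t)%N -> c%:R <= t%:R * y ^+ k.
  move=> h; have := ler_wpM2r (exprn_ge0 k y0') (_ : (c * q ^ k)%:R <= t%:R).
  by rewrite natrM -mulrA yqk mulr1; apply; rewrite -natrM ler_nat.
have size_le t : (t0 <= t)%N -> (skel_size (q ^ 30) q t)%:R <= 6 * (t%:R * y ^+ 29).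
  move=> /tq h; have h1 := one t 30 1%N (leq_trans (leq_mul (isT : 1 <= 4)%N (leqnn _)) h).
  have h2 : (t %/ q ^ 30 + 1)%:R <= 2 * (t%:R * y ^+ 30).
    by rewrite natrD; have := div_le t 30; lra.
  have h3 : (2 * q + 1)%:R <= 3 * q%:R :> R.
    by rewrite natrD natrM; have : 1 <= q%:R :> R; [rewrite ler1n|lra].
  rewrite natrM; apply: (@le_trans _ _ (3 * q%:R * (2 * (t%:R * y ^+ 30)))); first exact: ler_pM.
  have -> : 3 * q%:R * (2 * (t%:R * y ^+ 30)) = y * q%:R * (6 * (t%:R * y ^+ 29)) by rewrite [y ^+ 30]exprS; ring.
  by rewrite yq mul1r.
have epsE t : eps * (t * D)%:R = 8^-1 * (t%:R * y ^+ 26).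
  by rewrite /eps natrM; move: (y ^+ 26) => z; field; rewrite gt_eqF.
(* With [r = q ^ 14], listing the missed vertices costs of order [q^-13 t], below the full gain
   [q^-12 t]. With [s = q ^ 30], codes stay below the small gain [q^-26 t]. The constraint
   [2 * s * r <= D] holds as [D >= 2 * q ^ 48]. *)
apply: (@contour_sum R G a0 (2 * D) (q ^ 30) (q ^ 14) q q%:R (y ^+ 12) lam _ _ _ _ _ _ _ _ _ _ _ _ _ Phi _ _ eps).
- by rewrite D2 (leq_trans _ (leq_mul (leqnn 2) d2048)).
- by rewrite expn_gt0 q1.
- apply: leq_trans (qD 31 isT); rewrite [(q ^ 31)%N]expnS mulnA leq_mul2r; apply/orP; right.
  by rewrite (leq_trans _ (leq_mul (leqnn 2) q2048)).
- by rewrite expn_gt0 q1.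
- by rewrite -mulnA -expnD; apply: qD.
- exact: Dq.
- by apply: le_trans q200; rewrite ler1n.
- by apply: le_trans Dq; rewrite ler_nat mul2n -addnn -addn1 leq_add2l.
- exact: ltW.
- exact: rho_lam.
- by move=> K; apply: torus_isoA.
- by move=> K; apply: torus_isoB.
- by move=> K x; apply: torus_ball.
- by move=> I /and3P[iI h1 h2]; split=> //; have [] := hPhi I iI h1 h2.
- by apply: leq_trans t0_large; rewrite muln_gt0 expn_gt0 q1.
- by rewrite divr_ge0 // exprn_ge0.
- by move=> I /and3P[iI h1 h2]; have [] := hPhi I iI h1 h2.
- move=> t ht; rewrite epsE; apply: exponent_case1 => //; first exact: size_le.
    have := ler_wpM2r (exprn_ge0 14 y0') (_ : t%:R <= ((t %/ q ^ 14).+1 * q ^ 14)%:R).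
    rewrite natrM -mulrA yqk mulr1 natr1; apply.
    by rewrite -natrM ler_nat ltnW // ltn_ceil // expn_gt0 q1.
  apply: one; apply: leq_trans (tq t ht); rewrite leq_mul2l /= leq_pexp2l //.
- move=> t ht; rewrite epsE; apply: exponent_case2 => //; first exact: size_le.
  by apply: le_trans (div_le _ _) _; rewrite natrM.
Qed.

Lemma balanced_bound th : th <= expR (W%:R / d%:R ^+ 4) ->
  th * \sum_(J | ind (G := G) J && (#|evens J| == #|odds J|)) lam ^+ #|J| <= 1000^-1 * Z.
Proof.
move=> hth.
have Zge : 0 <= Z by apply: sumr_ge0 => I _; rewrite exprn_ge0 // ltW.
have sge : 0 <= \sum_(J | ind (G := G) J && (#|evens J| == #|odds J|)) lam ^+ #|J|.
  by apply: sumr_ge0 => I _; rewrite exprn_ge0 // ltW.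
apply: le_trans (ler_wpM2r sge hth) _.
have Dn0 : (0 < D)%N by rewrite D2 muln_gt0.
have split_sum : \sum_(J | ind (G := G) J && (#|evens J| == #|odds J|)) lam ^+ #|J| <=
    (expR (- (W%:R / (8 * d%:R))) + expR (5 * (d%:R * L%:R) - W%:R / (512 * d%:R ^+ 3))) * Z.
  rewrite mulrDl; apply: le_trans (lerD sparse_part dense_part).
  have lamI (J : {set T}) : 0 <= lam ^+ #|J| by rewrite exprn_ge0 // ltW.
  pose few (J : {set T}) := (#|odds J| <= N %/ (8 * D))%N.
  rewrite (bigID few); apply: lerD; apply: (sum_subpred lamI) => J.
    by move=> /andP[/andP[-> /eqP eJ]] h; rewrite eJ andbb.
  move=> /andP[/andP[-> /eqP eJ]]; rewrite -ltnNge eJ andbb => h.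
  have D8 : (0 < 8 * D)%N by rewrite muln_gt0.
  by apply: leq_trans (ltnW (ltn_ceil N D8)) _; rewrite mulnC leq_mul2l h orbT.
apply: le_trans (ler_wpM2l (expR_ge0 _) split_sum) _.
rewrite [leLHS]mulrA; apply: ler_wpM2r => //; rewrite mulrDr -!expRD addrA.
have d2 : 2048 <= d%:R :> R by rewrite ler_nat.
have L1 : 1 <= L%:R :> R by rewrite ler1n.
have [h1 h2] := final_exponents d2 L1 WR.
have e11 : expR (- 11) <= 2000^-1 :> R.
  have e2048 : 2 ^+ 11 = 2048 :> R by rewrite -natrX.
  have h11 : 2 ^+ 11 <= expR 11 :> R.
    rewrite -[X in expR X]mulr1 expRM_natl lerXn2r ?nnegrE ?expR_ge0 ?ler0n //.
    by apply: le_trans (expR_ge1Dx _); rewrite -[2]/(1 + 1).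
  have x0 := expR_ge0 (- 11 : R).
  have := ler_wpM2r x0 h11; rewrite -expRD subrr expR0 e2048.
  by move: (expR (- 11)) x0 => x; lra.
rewrite -ler_expR in h1; rewrite -ler_expR in h2.
have := le_trans h1 e11; have := le_trans h2 e11.
move: (expR (_ - _)) (expR (_ + _)) => u v; lra.
Qed.

Lemma torus_mixing :
  ((expR (L%:R ^+ d.-1 / (d%:R ^+ 4 * (ln L%:R) ^+ 2)))%:E <= mixing_time (@torus_adj L d) lam)%E.
Proof.
have lnL : 1 <= ln L%:R :> R.
  rewrite -[leLHS]expRK ler_ln ?posrE ?expR_gt0 ?ltr0n //.
  apply: le_trans L4.
  exact: expR1_le4.
have ln2 : 1 <= (ln L%:R) ^+ 2 :> R by rewrite exprn_ege1.
have d4 : 0 < d%:R ^+ 4 :> R by rewrite exprn_gt0.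
apply: (@cayley_mixing R G a0 _ (@torus_adjE d l l_gt0 l_even) lam lam0).
  rewrite -[leLHS]expR0 ler_expR divr_ge0 ?exprn_ge0 // mulr_ge0 ?exprn_ge0 //.
  exact: le_trans lnL.
apply: balanced_bound; rewrite ler_expR natrX ler_wpM2l ?exprn_ge0 //.
by rewrite lef_pV2 ?posrE ?mulr_gt0 ?ler_peMr // ?(ltW d4) // (lt_le_trans ltr01).
Qed.

End TorusMixing.

(** Since [d <= (2 q)^48], [q^-12 = 2^12 (2 q)^-12] is at most [2^12 d^(-1/4)]; one more factor 2
    gives the constant [2 ^+ 13]. *)
Lemma activity_bound (R : realType) (d q : nat) : (0 < q)%N -> (4 <= d)%N -> (d < (q + 1) ^ 48)%N ->
  2 * q%:R^-1 ^+ 12 <= 2 ^+ 13 * d%:R `^ (- (1 / 4)) * (ln d%:R) `^ (3 / 4) :> R.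
Proof.
move=> q0 hd hq; have d0 : 0 < d%:R :> R by rewrite ltr0n (leq_trans _ hd).
have q2 : 0 <= (2 * q)%:R :> R by rewrite ler0n.
have lnd : 1 <= (ln d%:R) `^ (3 / 4) :> R.
  have h : 1 <= ln d%:R :> R.
    rewrite -[leLHS]expRK ler_ln ?posrE ?expR_gt0 //.
    by apply: le_trans (expR1_le4 R) _; rewrite ler_nat.
  have e1 : 1 = 1 `^ (3 / 4) :> R by rewrite powR1.
  rewrite [leLHS]e1; apply: ge0_ler_powR; rewrite ?nnegrE ?divr_ge0 //.
  exact: le_trans h.
have dq : d%:R `^ (1 / 4) <= (2 * q)%:R ^+ 12 :> R.
  have -> : (2 * q)%:R ^+ 12 = ((2 * q) ^ 48)%:R `^ (1 / 4) :> R.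
    rewrite natrX -!powR_mulrn // -powRrM; congr (_ `^ _); lra.
  apply: ge0_ler_powR; rewrite ?nnegrE ?ler0n // ler_nat.
  by apply: leq_trans (ltnW hq) _; rewrite leq_exp2r // mul2n -addnn leq_add2l.
have dq' : (2 * q)%:R^-1 ^+ 12 <= d%:R `^ (- (1 / 4)) :> R.
  by rewrite powRN exprVn lef_pV2 ?posrE ?powR_gt0 // exprn_gt0 // ltr0n muln_gt0.
have e2 : q%:R^-1 ^+ 12 = 2 ^+ 12 * (2 * q)%:R^-1 ^+ 12 :> R.
  by rewrite natrM invfM exprMn mulrA -exprMn divff ?expr1n ?mul1r // pnatr_eq0.
have p2 k : 0 < 2 ^+ k :> R by rewrite exprn_gt0.
have p0 : 0 <= 2 ^+ 13 * d%:R `^ (- (1 / 4)) :> R by apply: mulr_ge0; [apply: ltW|apply: powR_ge0].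
apply: le_trans (ler_peMr p0 lnd); rewrite e2 mulrA -exprS.
by apply: ler_wpM2l => //; apply: ltW.
Qed.

Theorem theorem1p2 (R : realType) :
  exists c d0 : R, 0 < c /\ 0 < d0 /\
    forall (d L : nat) (lambda : R),
      d0 <= d%:R -> (4 <= L)%N -> ~~ odd L -> 0 < lambda ->
      c * d%:R `^ (- (1 / 4)) * (ln d%:R) `^ (3 / 4) <= lambda ->
      ((expR (L%:R ^+ d.-1 / (d%:R ^+ 4 * (ln L%:R) ^+ 2)))%:E
         <= mixing_time (@torus_adj L d) lambda)%E.
Proof.
have [q0 eq0] : exists q0 : nat, q0%:R = 2 ^+ 28 :> R by exists (2 ^ 28)%N; rewrite natrX.
have q04 : (4 <= q0)%N.
  rewrite -(ler_nat R) eq0 (_ : 4 = 2 ^+ 2) ?ler_weXn2l ?ler1n //.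
  by rewrite expr2 -natrM.
exists (2 ^+ 13), ((2 ^+ 28) ^+ 48); split; first by rewrite exprn_gt0.
split; first by rewrite !exprn_gt0.
move=> d [|[|l]] // lam; rewrite -eq0 -natrX ler_nat => hd hL hodd lam0 hlam.
have [q [q0q qd dq]] := root_bracket (isT : (0 < 48)%N) hd.
have q1 : (0 < q)%N by apply: leq_trans q0q; apply: leq_trans q04.
have d4 : (4 <= d)%N.
  apply: leq_trans qd; apply: leq_trans (leq_trans q04 q0q) _.
  by rewrite -{1}[q]expn1 leq_pexp2l.
have l_gt0 : (0 < l)%N by rewrite (leq_trans _ (hL : (2 <= l)%N)).
have l_even : ~~ odd l by move: hodd; rewrite /= negbK.
apply: (@torus_mixing R d l q lam l_gt0 l_even) => //.
  by rewrite -eq0 ler_nat.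
exact: le_trans (activity_bound R q1 d4 dq) hlam.
Qed.
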